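(* Let $\Phi$ be a stationary point process in $\mathbb{R}^d$ of unit intensity, let $k\ge1$, and let $\Gamma$ be a connected graph on $k$ vertices which is a feasible subgraph of $\Phi$. Assume that $\rho^{(k)}$ is almost everywhere continuous, and let $r_n^d\to\beta>0$. Write $\mathbf{y}=(0,y_2,\ldots,y_k)$ and $d\mathbf{y}=dy_2\cdots dy_k$. Then $$\lim_{n\to\infty}\frac{\mathbb{E}\{G_n(\Phi,\Gamma)\}}{n}=\mu_\beta(\Phi,\Gamma),\qquad \lim_{n\to\infty}\frac{\mathbb{E}\{J_n(\Phi,\Gamma)\}}{n}=\gamma_\beta(\Phi,\Gamma),$$ where for $k=1$: $\mu_\beta(\Phi,\Gamma):=1$ and $\gamma_\beta(\Phi,\Gamma):=\mathbb{P}^!_{O}\{\Phi(B_O(\beta^{1/d}))=0\}$ ($O$ being the origin), and for $k\ge2$: $$\mu_\beta(\Phi,\Gamma):=\frac{\beta^{k-1}}{k!}\int_{\mathbb{R}^{d(k-1)}}h_\Gamma(\mathbf{y})\rho^{(k)}(\beta^{1/d}\mathbf{y})\,d\mathbf{y},$$ $$\gamma_\beta(\Phi,\Gamma):=\frac{\beta^{k-1}}{k!}\int_{\mathbb{R}^{d(k-1)}}h_\Gamma(\mathbf{y})\rho^{(k)}(\beta^{1/d}\mathbf{y})\,\mathbb{P}^!_{\beta^{1/d}\mathbf{y}}\{\Phi(B_{\beta^{1/d}\mathbf{y}}(\beta^{1/d}))=0\}\,d\mathbf{y}.$$ If $\Phi$ is a negatively associated point process with $\mathbb{P}\{\Phi(B_{\mathbf{x}}(\beta^{1/d}))=0\}>0$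 for almost every $\mathbf{x}\in B_0(\beta^{1/d}k)^k$, then $\gamma_\beta(\Phi,\Gamma)>0$.
   Context: A point process $\Phi$ in $\mathbb{R}^d$ is a random locally finite counting measure, identified with its random set of points; $\Phi(B)$ is the number of points in $B$. $\Phi^{(k)}$ is the set of ordered $k$-tuples of pairwise distinct points of $\Phi$; $\alpha^{(k)}$ is its intensity measure, and the $k$th joint intensity $\rho^{(k)}$ is the density of $\alpha^{(k)}$ with respect to Lebesgue measure on $(\mathbb{R}^d)^k$. Standing assumptions: point processes are simple and all joint intensities exist. Stationary means the law is invariant under translations; unit intensity means $\alpha^{(1)}$ is Lebesgue measure. The reduced Palm distribution $\mathbb{P}^!_{\mathbf{x}}$ at $\mathbf{x}=(x_1,\ldots,x_k)$ (expectation $\mathbb{E}^!_{\mathbf{x}}$) is determined, for $\alpha^{(k)}$-a.e. $\mathbf{x}$, by $\mathbb{E}\{\sum_{X\in\Phi^{(k)}}u(\Phi,X)\}=\int_{(\mathbb{R}^d)^k}\mathbb{E}^!_{\mathbf{x}}\{u(\Phi\cup\{x_1,\ldots,x_k\},\mathbf{x})\}\rho^{(k)}(\mathbf{x})\,d\mathbf{x}$ for bounded measurable $u\ge0$ with compact support in the second variable; for stationary $\Phi$ the translation-covariant version is used. $\Phi$ is negatively associated if $\mathrm{Cov}(f(\Phi(B_1),\ldots,\Phi(B_k)),g(\Phi(B_{k+1}),\ldots,\Phi(B_l)))\le0$ for all bounded Borel $B_1,\ldots,B_l$ with $(B_1\cup\cdots\cup B_k)\cap(B_{k+1}\cup\cdots\cup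 B_l)=\varnothing$ and all increasing bounded continuous $f,g$. $B_x(r)$ is the ball of radius $r$ centred at $x$; $B_{\mathbf{x}}(r)=\bigcup_i B_{x_i}(r)$. $W_n=[-n^{1/d}/2,n^{1/d}/2]^d$, $\Phi_n=\Phi\cap W_n$. For a point set $P$ and $r>0$, the geometric graph $G(P,r)$ has vertex set $P$ and an edge between distinct points at distance $\le r$. For a graph $\Gamma$ on $k$ vertices, $h_\Gamma(\mathbf{x},r)=\mathbf{1}[G(\{x_1,\ldots,x_k\},r)\simeq\Gamma]$, $h_{\Gamma,n}(\mathbf{x})=h_\Gamma(\mathbf{x},r_n)$, $h_\Gamma(\mathbf{x})=h_\Gamma(\mathbf{x},1)$. A connected $\Gamma$ on $k$ vertices is a feasible subgraph of $\Phi$ if $\int_{(\mathbb{R}^d)^k}h_\Gamma(\mathbf{x})\rho^{(k)}(\mathbf{x})\,d\mathbf{x}>0$. For the given radii $r_n>0$, $$G_n(\Phi,\Gamma)=\frac1{k!}\sum_{X\in\Phi_n^{(k)}}h_{\Gamma,n}(X),\qquad J_n(\Phi,\Gamma)=\frac1{k!}\sum_{X\in\Phi_n^{(k)}}h_{\Gamma,n}(X)\mathbf{1}[\Phi_n(B_X(r_n))=k].$$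
   Formalization: For γ_β>0 the formal theorem also assumes ∫h_Γ(x,β^{1/d})ρ^(k)(x)dx>0, i.e. feasibility at radius β^{1/d}, not only at radius 1. This is necessary: γ_β=0 for Γ=K_2 if Φ is negatively associated with hard core s, β^{1/d}<s<1. Joint intensities are taken locally integrable. *)

(* Defs.v *)
From HB Require Import structures.
From mathcomp Require Import all_boot all_order all_algebra.
From mathcomp Require Import all_classical all_reals all_analysis.

Set Implicit Arguments.
Unset Strict Implicit.
Unset Printing Implicit Defensive.

Import Order.TTheory GRing.Theory Num.Theory.
Import numFieldNormedType.Exports.

Local Open Scope classical_set_scope.
Local Open Scope ring_scope.

(* A point of R^d is a row vector 'rV[R]_d and a k-tuple of points is the
   k x d matrix whose rows are the points, so that (R^d)^k is 'M[R]_(k, d). *)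

Section matrix_measurable.
Context {d0 : measure_display} {T : measurableType d0}.
Variables m n : nat.

(* The sigma-algebra generated by the coordinates; when T is R this is the
   Borel sigma-algebra of the matrix topology. *)
Definition mx_coord_sets : set (set 'M[T]_(m, n)) :=
  [set A | exists (i : 'I_m) (j : 'I_n) (B : set T),
    measurable B /\ A = [set x : 'M[T]_(m, n) | B (x i j)]].

Let mx_measurable := <<s mx_coord_sets >>.

Let mx_measurable0 : mx_measurable set0.
Proof. exact: sigma_algebra0. Qed.

Let mx_measurableC A : mx_measurable A -> mx_measurable (~` A).
Proof. by move=> mA; rewrite -setTD; exact: sigma_algebraCD. Qed.

Let mx_measurable_bigcup (F : (set 'M[T]_(m, n))^nat) :
  (forall i, mx_measurable (F i)) -> mx_measurable (\bigcup_i F i).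
Proof. exact: sigma_algebra_bigcup. Qed.

HB.instance Definition _ := @isMeasurable.Build (sigma_display mx_coord_sets)
  'M[T]_(m, n) mx_measurable mx_measurable0 mx_measurableC
  mx_measurable_bigcup.

End matrix_measurable.

Section lebesgue_step.
Context {R : realType}.
Variables (n : nat) (mu : {sigma_finite_measure set (n.-tuple R) -> \bar R}).

Definition tuple_cons (p : R * n.-tuple R) : n.+1.-tuple R :=
  [the n.+1.-tuple R of p.1 :: p.2].

Lemma measurable_tuple_cons : measurable_fun setT tuple_cons.
Proof. by apply: measurable_cons; [exact: measurable_fst|exact: measurable_snd]. Qed.

Definition leb_step : set (n.+1.-tuple R) -> \bar R :=
  pushforward (@lebesgue_measure R \x mu)%E tuple_cons.

Let leb_step0 : leb_step set0 = 0%E.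
Proof. by rewrite /leb_step /pushforward preimage_set0 measure0. Qed.

Let leb_step_ge0 A : (0 <= leb_step A)%E.
Proof. by rewrite /leb_step /pushforward; apply: measure_ge0. Qed.

Let leb_step_sigma_additive : semi_sigma_additive leb_step.
Proof.
have mc (A : set (n.+1.-tuple R)) : measurable A ->
    measurable (tuple_cons @^-1` A).
  move=> mA; rewrite -[X in measurable X]setTI.
  exact: measurable_tuple_cons.
move=> F mF tF mUF; rewrite /leb_step /pushforward preimage_bigcup.
apply: measure_semi_sigma_additive.
- by move=> i; exact: mc.
- apply/trivIsetP => /= i j _ _ ij; rewrite -preimage_setI.
  by move/trivIsetP : tF => /(_ _ _ _ _ ij) ->//; rewrite preimage_set0.
- by rewrite -preimage_bigcup; exact: mc.
Qed.

HB.instance Definition _ := isMeasure.Build _ _ _ leb_step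
  leb_step0 leb_step_ge0 leb_step_sigma_additive.

Let leb_step_sigma_finite : sigma_finite setT leb_step.
Proof.
have /sigma_finiteP[F [TF ndF Foo]] := sigma_finiteT (@lebesgue_measure R).
have /sigma_finiteP[G [TG ndG Goo]] := sigma_finiteT mu.
pose g (t : n.+1.-tuple R) : R * n.-tuple R := (thead t, [tuple of behead t]).
have mg : measurable_fun setT g.
  apply: measurable_fun_pair; [exact: measurable_tnth|exact: measurable_behead].
exists (fun i => g @^-1` (F i `*` G i)).
  rewrite predeqE => t; split=> // _.
  have [i _ Fi] : (\bigcup_i F i) (thead t) by rewrite -TF.
  have [j _ Gj] : (\bigcup_i G i) [tuple of behead t] by rewrite -TG.
  exists (maxn i j) => //=; split => /=.
  - by move: Fi; exact/subsetPset/ndF/leq_maxl.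
  - by move: Gj; exact/subsetPset/ndG/leq_maxr.
move=> k; have [mF Fk] := Foo k; have [mG Gk] := Goo k; split.
  by rewrite -[X in measurable X]setTI; apply: mg => //; exact: measurableX.
rewrite /leb_step /pushforward -comp_preimage.
rewrite (_ : g \o tuple_cons = id); last first.
  by rewrite funeqE => -[a t]; rewrite /g /= theadE; congr pair; exact/val_inj.
by rewrite preimage_id product_measure1E// lte_mul_pinfty// ge0_fin_numE.
Qed.

HB.instance Definition _ := Measure_isSigmaFinite.Build _ _ _ leb_step
  leb_step_sigma_finite.

End lebesgue_step.

Section lebesgue.
Context {R : realType}.

Fixpoint lebesgue_tuple (n : nat) :
    {sigma_finite_measure set (n.-tuple R) -> \bar R} :=
  if n is n'.+1 then leb_step (lebesgue_tuple n') else \d_[tuple].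

Variables k d : nat.

Definition mx_of_tuple (t : (k * d).-tuple R) : 'M[R]_(k, d) :=
  \matrix_(i, j) tnth t (mxvec_index i j).

Lemma measurable_mx_of_tuple : measurable_fun setT mx_of_tuple.
Proof.
apply: (@measurability _ _ _ _ _ _ (@mx_coord_sets _ R k d)) => //.
move=> _ [_ [i [j [B [mB ->]]]] <-].
rewrite (_ : mx_of_tuple @^-1` _ =
  (fun t : (k * d).-tuple R => tnth t (mxvec_index i j)) @^-1` B); last first.
  by apply/seteqP; split=> t /=; rewrite mxE.
exact: measurable_tnth.
Qed.

(* Lebesgue measure on (R^d)^k. *)
Definition lebesgue_mx : set 'M[R]_(k, d) -> \bar R :=
  pushforward (lebesgue_tuple (k * d)) mx_of_tuple.

Let lebesgue_mx0 : lebesgue_mx set0 = 0%E.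
Proof. by rewrite /lebesgue_mx /pushforward preimage_set0 measure0. Qed.

Let lebesgue_mx_ge0 A : (0 <= lebesgue_mx A)%E.
Proof. by rewrite /lebesgue_mx /pushforward; apply: measure_ge0. Qed.

Let lebesgue_mx_sigma_additive : semi_sigma_additive lebesgue_mx.
Proof.
have mc (A : set 'M[R]_(k, d)) : measurable A ->
    measurable (mx_of_tuple @^-1` A).
  move=> mA; rewrite -[X in measurable X]setTI.
  exact: measurable_mx_of_tuple.
move=> F mF tF mUF; rewrite /lebesgue_mx /pushforward preimage_bigcup.
apply: measure_semi_sigma_additive.
- by move=> i; exact: mc.
- apply/trivIsetP => /= i j _ _ ij; rewrite -preimage_setI.
  by move/trivIsetP : tF => /(_ _ _ _ _ ij) ->//; rewrite preimage_set0.
- by rewrite -preimage_bigcup; exact: mc.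
Qed.

HB.instance Definition _ := isMeasure.Build _ _ _ lebesgue_mx
  lebesgue_mx0 lebesgue_mx_ge0 lebesgue_mx_sigma_additive.

End lebesgue.

Arguments lebesgue_mx {R} k d.

Definition bounded_mx (R : realType) (k d : nat) (B : set 'M[R]_(k, d)) :=
  exists M : R, forall x, B x -> forall i j, `|x i j| <= M.

Definition translate (R : realType) (k d : nat) (t : 'rV[R]_d)
    (x : 'M[R]_(k, d)) : 'M[R]_(k, d) :=
  \matrix_(i, j) (x i j + t 0 j).

Section configurations.
Variables (R : realType) (d : nat).

Definition locally_finite (A : set 'rV[R]_d) :=
  forall B : set 'rV[R]_d, bounded_mx B -> finite_set (A `&` B).

(* Locally finite simple counting measures, identified with their supports. *)
Record config := Config {
  points :> set 'rV[R]_d ;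
  points_locally_finite : locally_finite points }.

Lemma locally_finite0 : locally_finite set0.
Proof. by move=> B _; rewrite set0I. Qed.

HB.instance Definition _ := gen_eqMixin config.
HB.instance Definition _ := gen_choiceMixin config.
HB.instance Definition _ := isPointed.Build config (Config locally_finite0).

(* phi B is the number of points of phi in B. *)
Definition npoints (phi B : set 'rV[R]_d) : \bar R := counting (phi `&` B).

Definition config_count_sets : set (set config) :=
  [set A | exists (B : set 'rV[R]_d) (n : nat), measurable B /\
    A = [set phi : config | npoints phi B = n%:R%:E]].

Let config_measurable := <<s config_count_sets >>.

Let config_measurable0 : config_measurable set0.
Proof. exact: sigma_algebra0. Qed.

Let config_measurableC A : config_measurable A -> config_measurable (~` A).
Proof. by move=> mA; rewrite -setTD; exact: sigma_algebraCD. Qed.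

Let config_measurable_bigcup (F : (set config)^nat) :
  (forall i, config_measurable (F i)) -> config_measurable (\bigcup_i F i).
Proof. exact: sigma_algebra_bigcup. Qed.

HB.instance Definition _ :=
  @isMeasurable.Build (sigma_display config_count_sets) config
    config_measurable config_measurable0 config_measurableC
    config_measurable_bigcup.

Lemma locally_finite_translate (phi : config) (t : 'rV[R]_d) :
  locally_finite (translate t @` phi).
Proof.
move=> B [M BM].
pose C : set 'rV[R]_d := [set x | B (translate t x)].
have bC : bounded_mx C.
  exists (M + \sum_j `|t 0 j|) => x /BM xM i j.
  rewrite (_ : x i j = translate t x i j - t 0 j); last by rewrite !mxE addrK.
  rewrite (le_trans (ler_normB _ _))// lerD// (bigD1 j)//= lerDl.
  exact: sumr_ge0.
apply: (@sub_finite_set _ _ (translate t @` (phi `&` C))).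
  by move=> _ [[x phix <-] Bx]; exists x.
exact/finite_image/points_locally_finite.
Qed.

Definition config_translate t (phi : config) : config :=
  Config (@locally_finite_translate phi t).

Lemma locally_finite_add (phi : config) k (x : 'M[R]_(k, d)) :
  locally_finite (phi `|` range (fun i => row i x)).
Proof.
move=> B bB; rewrite setIUl finite_setU; split.
  exact: points_locally_finite.
apply: (@sub_finite_set _ _ (range (fun i => row i x))); first exact: subIsetl.
exact/finite_image/finite_finset.
Qed.

Definition config_add k (phi : config) (x : 'M[R]_(k, d)) : config :=
  Config (@locally_finite_add phi k x).

End configurations.

Section geometric_graphs.
Context {R : realType} {d : nat}.

(* The Euclidean distance: the library norm on row vectors is the sup norm. *)
Definition euclid_dist (x y : 'rV[R]_d) : R :=
  Num.sqrt (\sum_j (x 0 j - y 0 j) ^+ 2).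

Definition balls k (x : 'M[R]_(k, d)) (r : R) : set 'rV[R]_d :=
  [set y | exists i, euclid_dist (row i x) y <= r].

Definition window (n : nat) : set 'rV[R]_d :=
  [set x | forall j, `|x 0 j| <= n%:R `^ (d%:R^-1) / 2].

Definition distinct_tuples k (A : set 'rV[R]_d) : set 'M[R]_(k, d) :=
  [set x | (forall i, A (row i x)) /\ injective (fun i => row i x)].

Definition geom_edge (r : R) (x y : 'rV[R]_d) :=
  x <> y /\ euclid_dist x y <= r.

(* The geometric graph G(V, r) is isomorphic to the graph Gam on 'I_k. *)
Definition geom_graph_iso k (Gam : rel 'I_k) (V : set 'rV[R]_d) (r : R) :=
  exists f : 'I_k -> 'rV[R]_d,
    [/\ injective f, range f = V &
        forall i j, Gam i j <-> geom_edge r (f i) (f j)].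

Definition h_graph k (Gam : rel 'I_k) (r : R) (x : 'M[R]_(k, d)) : R :=
  (`[< geom_graph_iso Gam (range (fun i => row i x)) r >])%:R.

Definition G_count k (Gam : rel 'I_k) (r : R) (n : nat) (phi : set 'rV[R]_d) :
    \bar R :=
  ((k`!%:R^-1)%:E *
   \esum_(x in distinct_tuples (phi `&` window n)) (h_graph Gam r x)%:E)%E.

Definition J_count k (Gam : rel 'I_k) (r : R) (n : nat) (phi : set 'rV[R]_d) :
    \bar R :=
  ((k`!%:R^-1)%:E *
   \esum_(x in distinct_tuples (phi `&` window n))
     (h_graph Gam r x *
      (npoints (phi `&` window n) (balls x r) == k%:R%:E)%:R)%:E)%E.

(* Feasibility at connection radius s; a feasible subgraph is one for which
   s = 1. *)
Definition feasible_at k (s : R) (rho : 'M[R]_(k, d) -> R) (Gam : rel 'I_k) :=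
  (0 < \int[lebesgue_mx k d]_x (h_graph Gam s x * rho x)%:E)%E.

Definition feasible k (rho : 'M[R]_(k, d) -> R) (Gam : rel 'I_k) :=
  feasible_at 1 rho Gam.

End geometric_graphs.

Definition connected_graph (k : nat) (Gam : rel 'I_k) :=
  [/\ symmetric Gam, irreflexive Gam & forall i j, connect Gam i j].

Section point_processes.
Context {dT : measure_display} {T : measurableType dT} {R : realType}.
Context {d : nat}.
Variables (P : probability T R) (Phi : {mfun T >-> config R d}).

Definition stationary := forall (t : 'rV[R]_d) (A : set (config R d)),
  measurable A ->
  P (Phi @^-1` A) = P [set w | A (config_translate t (Phi w))].

(* The intensity measure of the process of k-tuples of distinct points. *)
Definition alpha k (B : set 'M[R]_(k, d)) : \bar R :=
  (\int[P]_w counting (distinct_tuples (Phi w) `&` B))%E.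

Definition unit_intensity := forall B : set 'M[R]_(1, d), measurable B ->
  alpha B = lebesgue_mx 1 d B.

(* The k-th joint intensity exists when alpha is a locally finite measure with
   a density; without local finiteness the expected counts may diverge for
   radii arbitrarily close to one at which they are finite. *)
Definition joint_intensity k (rho : 'M[R]_(k, d) -> R) :=
  [/\ measurable_fun setT rho,
      forall x, 0 <= rho x,
      forall B : set 'M[R]_(k, d), measurable B -> bounded_mx B ->
        (alpha B < +oo)%E &
      forall B : set 'M[R]_(k, d), measurable B ->
        alpha B = (\int[lebesgue_mx k d]_(x in B) (rho x)%:E)%E].

Definition campbell_formula k (rho : 'M[R]_(k, d) -> R)
    (palm : 'M[R]_(k, d) -> {measure set (config R d) -> \bar R}) :=
  forall u : config R d * 'M[R]_(k, d) -> R,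
    measurable_fun setT u ->
    (forall z, 0 <= u z) ->
    (exists M, forall z, u z <= M) ->
    (exists2 K : set 'M[R]_(k, d), compact K &
      forall phi x, ~ K x -> u (phi, x) = 0) ->
    (\int[P]_w (\esum_(x in distinct_tuples (Phi w)) (u (Phi w, x))%:E) =
     \int[lebesgue_mx k d]_x
       ((\int[palm x]_phi (u (config_add phi x, x))%:E) * (rho x)%:E))%E.

(* With configurations encoded as sets, the Campbell formula alone does not
   see whether the points of x belong to phi under palm x: the second clause
   says that they do not, i.e., that palm is the reduced Palm distribution. *)
Definition reduced_palm k (rho : 'M[R]_(k, d) -> R)
    (palm : R.-pker 'M[R]_(k, d) ~> config R d) :=
  [/\ campbell_formula rho palm,
      {ae lebesgue_mx k d, forall x, 0 < rho x ->
        palm x [set phi | forall i, ~ points phi (row i x)] = 1%E} &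
      forall (t : 'rV[R]_d) (x : 'M[R]_(k, d)) (A : set (config R d)), measurable A ->
        palm (translate t x) A = palm x [set phi | A (config_translate t phi)]].

Definition increasing_bounded_continuous p (f : 'rV[R]_p -> R) :=
  [/\ forall a b : 'rV[R]_p, (forall i, a 0 i <= b 0 i) -> f a <= f b,
      exists M, forall a, `|f a| <= M &
      continuous f].

Definition counts p (B : 'I_p -> set 'rV[R]_d) (phi : set 'rV[R]_d) :
  'rV[R]_p := \row_i fine (npoints phi (B i)).

Definition negatively_associated :=
  forall p q (B : 'I_p -> set 'rV[R]_d) (C : 'I_q -> set 'rV[R]_d)
    (f : 'rV[R]_p -> R) (g : 'rV[R]_q -> R),
  (forall i, measurable (B i) /\ bounded_mx (B i)) ->
  (forall j, measurable (C j) /\ bounded_mx (C j)) ->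
  (\bigcup_i B i) `&` (\bigcup_j C j) = set0 ->
  increasing_bounded_continuous f -> increasing_bounded_continuous g ->
  (covariance P (fun w => f (counts B (Phi w)))
                (fun w => g (counts C (Phi w))) <= 0)%E.

End point_processes.

(* In this section k = m + 1, so that m = 0 is the case of a single vertex. *)
Section limits.
Context {R : realType} {d : nat}.
Variable m : nat.

(* The tuple (0, y_2, ..., y_k). *)
Definition anchor (y : 'M[R]_(m, d)) : 'M[R]_(m.+1, d) :=
  col_mx (0 : 'rV[R]_d) y.

Definition mu_lim (beta : R) (rho : 'M[R]_(m.+1, d) -> R)
    (Gam : rel 'I_m.+1) : \bar R :=
  let s := beta `^ (d%:R^-1) in
  if m == 0%N then 1%E else
  ((beta ^+ m / (m.+1)`!%:R)%:E *
   \int[lebesgue_mx m d]_y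
     (h_graph Gam 1 (anchor y) * rho (s *: anchor y))%:E)%E.

Definition gamma_lim (beta : R) (rho : 'M[R]_(m.+1, d) -> R)
    (palm : 'M[R]_(m.+1, d) -> {measure set (config R d) -> \bar R})
    (Gam : rel 'I_m.+1) : \bar R :=
  let s := beta `^ (d%:R^-1) in
  let void_prob x := palm x [set phi | npoints phi (balls x s) = 0%E] in
  if m == 0%N then void_prob 0 else
  ((beta ^+ m / (m.+1)`!%:R)%:E *
   \int[lebesgue_mx m d]_y
     ((h_graph Gam 1 (anchor y) * rho (s *: anchor y))%:E *
      void_prob (s *: anchor y)))%E.

End limits.

(* Main.v *)
Require Import Defs.
From HB Require Import structures.
From mathcomp Require Import all_boot all_order all_algebra finmap.
From mathcomp Require Import all_classical all_reals all_analysis.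
From mathcomp Require Import measurable_realfun.
From mathcomp Require Import ring lra.

Set Implicit Arguments.
Unset Strict Implicit.
Unset Printing Implicit Defensive.

Import Order.TTheory GRing.Theory Num.Theory.
Import numFieldNormedType.Exports.

Local Open Scope classical_set_scope.
Local Open Scope ring_scope.

(** Let s be the limit of the radii and call the tuple seen from its first point,
    translated to the origin, its shape.

    By the Campbell formula the expected counts are integrals over all tuples in
    the window: of the graph indicator times the joint intensity for G, and with the
    additional factor of a void probability under the reduced Palm distribution for
    J (campbell_tuples, campbell_isolated). All these factors are invariant under
    translations, except that the void probability only sees the points in the
    window, which matters near the boundary of the window alone. Fubini in the
    position of the first point and the shape (ge0_integral_anchor) turns the
    integral into one over shapes, the window contributing its
    volume n up to smaller order. After division by n the integrand converges for
    almost every shape. Indeed the graph indicator depends on finitely many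
    comparisons of distances with the radius, and almost no tuple has a distance
    equal to s (lebesgue_mx_level_set). The void probability is continuous at s
    since, for almost every tuple of positive joint intensity, its Palm
    distribution has no point at distance exactly s: such a point would give a tuple with one more point in a
    null set (palm_on_boundary). As a connected graph confines the shape to a
    bounded set, on which the joint intensity is integrable, the convergence is
    dominated (window_average_cvg). For the fixed limit radius the joint intensity
    enters as it is, without any rescaling of its argument; the powers of beta in the
    limits come from a change of variables at the end (mu_limE, gamma_limE).

    For the positivity choose a tuple with the required graph, positive joint
    intensity and positive void probability, no distance of which equals s. These
    properties persist for all tuples in a product of small cubes around its points
    (exists_good_cubes). The process hits all these cubes with positive probability.
    Negative association suggests that, given this, the rest of a neighbourhood U
    of the balls is void with at least the probability p that U is void, but a cube
    may contain several points. Therefore the cubes are cut into cells of a fine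
    grid. Hitting one cell in each cube and one of these cells twice produces a tuple
    with an additional point near one of its points, and the expected number of
    such tuples tends to 0 with the mesh, as no two points of the process
    coincide. Hence for some choice of cells this event has probability less than
    p times the probability of hitting the cells (exists_uncrowded), whereas
    negative association gives at least this product to the event that the cells
    are hit and U is void outside them (hits_void_ge). With positive probability
    there is thus exactly one point in each cell and no other one in U. The
    tuple of these points is isolated, and the Campbell formula makes the integral
    for the limit positive (isolated_integral_gt0). *)

(** * Euclidean distance and translations *)

Section euclidean_distance.
Context {R : realType} {d : nat}.
Implicit Types x y z t : 'rV[R]_d.

Lemma euclid_dist_ge0 x y : 0 <= euclid_dist x y.
Proof. exact: sqrtr_ge0. Qed.

Lemma euclid_distC x y : euclid_dist x y = euclid_dist y x.
Proof.
by congr Num.sqrt; apply: eq_bigr => j _; rewrite -sqrrN opprB.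
Qed.

Lemma euclid_dist_eq0 x y : euclid_dist x y <= 0 -> x = y.
Proof.
rewrite /euclid_dist => xy0; apply/rowP => j.
have : \sum_j (x 0 j - y 0 j) ^+ 2 <= 0.
  by rewrite leNgt -sqrtr_gt0 -leNgt.
move/(le_trans _) => /(_ ((x 0 j - y 0 j) ^+ 2)).
rewrite (bigD1 j)//= lerDl sumr_ge0; last by move=> i _; exact: sqr_ge0.
by move=> /(_ isT); rewrite real_exprn_even_le0//= ?subr_eq0 ?num_real// => /eqP.
Qed.

Lemma euclid_distxx x : euclid_dist x x = 0.
Proof. by rewrite /euclid_dist big1 ?sqrtr0// => j _; rewrite subrr expr0n. Qed.

(** Lagrange's identity: the defect is half a sum of squares. *)
Lemma Cauchy_Schwarz_sum (a b : 'I_d -> R) :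
  (\sum_i a i * b i) ^+ 2 <= (\sum_i a i ^+ 2) * (\sum_i b i ^+ 2).
Proof.
have sE (u v : 'I_d -> R) :
    (\sum_i u i) * (\sum_i v i) = \sum_i \sum_j u i * v j.
  by rewrite mulr_suml; apply: eq_bigr => i _; rewrite mulr_sumr.
have : 0 <= \sum_i \sum_j (a i * b j - a j * b i) ^+ 2.
  by apply: sumr_ge0 => i _; apply: sumr_ge0 => j _; exact: sqr_ge0.
suff -> : \sum_i \sum_j (a i * b j - a j * b i) ^+ 2 =
    2 * ((\sum_i a i ^+ 2) * (\sum_i b i ^+ 2) - (\sum_i a i * b i) ^+ 2).
  by rewrite pmulr_rge0// subr_ge0.
rewrite mulrBr mulr_natl mulr2n.
rewrite {2}(mulrC (\sum_i a i ^+ 2)) expr2 !sE mulr_sumr -big_split/= -sumrB.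
apply: eq_bigr => i _; rewrite mulr_sumr -big_split/= -sumrB.
by apply: eq_bigr => j _; ring.
Qed.

Lemma euclid_dist_triangle y x z :
  euclid_dist x z <= euclid_dist x y + euclid_dist y z.
Proof.
pose a j := x 0 j - y 0 j; pose b j := y 0 j - z 0 j.
have A0 : 0 <= \sum_j a j ^+ 2 by apply: sumr_ge0 => j _; exact: sqr_ge0.
have B0 : 0 <= \sum_j b j ^+ 2 by apply: sumr_ge0 => j _; exact: sqr_ge0.
rewrite -[leRHS]ger0_norm ?addr_ge0 ?euclid_dist_ge0// -sqrtr_sqr.
rewrite ler_wsqrtr// sqrrD !sqr_sqrtr//.
have -> : \sum_j (x 0 j - z 0 j) ^+ 2 =
    \sum_j a j ^+ 2 + (\sum_j a j * b j) *+ 2 + \sum_j b j ^+ 2.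
  rewrite -mulr_natr mulr_suml -!big_split/=; apply: eq_bigr => j _.
  by rewrite /a /b; ring.
rewrite lerD2r lerD2l lerMn2r/=.
rewrite (le_trans (ler_norm _))// -sqrtr_sqr -sqrtrM// ler_wsqrtr//.
exact: Cauchy_Schwarz_sum.
Qed.

Lemma coord_le_euclid_dist x y j : `|x 0 j - y 0 j| <= euclid_dist x y.
Proof.
rewrite -sqrtr_sqr ler_wsqrtr// (bigD1 j)//= lerDl sumr_ge0// => i _.
exact: sqr_ge0.
Qed.

Lemma euclid_dist_le_sup x y (e : R) :
  (forall j, `|x 0 j - y 0 j| <= e) -> 0 <= e -> euclid_dist x y <= d%:R * e.
Proof.
move=> xye e0; rewrite -[leRHS]ger0_norm ?mulr_ge0// -sqrtr_sqr ler_wsqrtr//.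
apply: (@le_trans _ _ (\sum_(j < d) e ^+ 2)).
  by apply: ler_sum => j _; rewrite -real_normK ?num_real// lerXn2r ?nnegrE.
rewrite sumr_const card_ord exprMn -[e ^+ 2 *+ d]mulr_natl ler_wpM2r ?sqr_ge0//.
by rewrite -natrX ler_nat; case: (d) => // n; rewrite expnS leq_pmulr// expn_gt0.
Qed.

Lemma euclid_distZ (s : R) x y : 0 <= s ->
  euclid_dist (s *: x) (s *: y) = s * euclid_dist x y.
Proof.
move=> s0; rewrite -[X in X * _]ger0_norm// -sqrtr_sqr /euclid_dist.
rewrite -sqrtrM ?sqr_ge0//; congr Num.sqrt; rewrite mulr_sumr.
by apply: eq_bigr => j _; rewrite !mxE -mulrBr exprMn.
Qed.

Lemma euclid_dist_translate t x y :
  euclid_dist (translate t x) (translate t y) = euclid_dist x y.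
Proof.
congr Num.sqrt; apply: eq_bigr => j _; congr (_ ^+ 2).
by rewrite !mxE; ring.
Qed.

End euclidean_distance.

Section translations.
Context {R : realType} {d : nat}.
Implicit Types t : 'rV[R]_d.

Lemma translateE k t (x : 'M[R]_(k, d)) i j :
  translate t x i j = x i j + t 0 j.
Proof. by rewrite mxE. Qed.

Lemma row_translate k t (x : 'M[R]_(k, d)) i :
  row i (translate t x) = translate t (row i x).
Proof. by apply/rowP => j; rewrite !mxE. Qed.

Lemma translateK k t : cancel (@translate R k d t) (translate (- t)).
Proof. by move=> x; apply/matrixP => i j; rewrite !mxE addrK. Qed.

Lemma translate_inj k t : injective (@translate R k d t).
Proof. exact: can_inj (@translateK k t). Qed.

Lemma balls_translate k t (x : 'M[R]_(k, d)) r y :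
  balls (translate t x) r (translate t y) <-> balls x r y.
Proof.
by split=> -[i]; rewrite ?row_translate ?euclid_dist_translate => ri; exists i;
  rewrite ?row_translate ?euclid_dist_translate.
Qed.

Variable m : nat.

Lemma row_anchor0 (y : 'M[R]_(m, d)) : row ord0 (anchor y) = 0.
Proof.
rewrite /anchor (_ : ord0 = lshift m (ord0 : 'I_1)); last exact/val_inj.
by rewrite (@rowKu _ 1) row_id.
Qed.

Lemma row_anchorS (y : 'M[R]_(m, d)) i : row (lift ord0 i) (anchor y) = row i y.
Proof.
rewrite /anchor (_ : lift ord0 i = rshift 1 i); last exact/val_inj.
by rewrite (@rowKd _ 1).
Qed.

Lemma anchor0E (y : 'M[R]_(m, d)) j : anchor y ord0 j = 0.
Proof. by have /rowP/(_ j) := row_anchor0 y; rewrite !mxE. Qed.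

Lemma anchorSE (y : 'M[R]_(m, d)) i j : anchor y (lift ord0 i) j = y i j.
Proof. by have /rowP/(_ j) := row_anchorS y i; rewrite !mxE. Qed.

Lemma anchorZ s (y : 'M[R]_(m, d)) : anchor (s *: y) = s *: anchor y.
Proof.
apply/matrixP => i j; rewrite [RHS]mxE; case: (unliftP ord0 i) => [i' ->|->].
  by rewrite !anchorSE mxE.
by rewrite !anchor0E mulr0.
Qed.

End translations.

(** * Lebesgue measure on tuples *)

Section matrix_measurability.
Context {R : realType} {k d : nat}.

Lemma measurable_coord (i : 'I_k) (j : 'I_d) :
  measurable_fun setT (fun x : 'M[R]_(k, d) => x i j).
Proof.
move=> _ B mB; rewrite setTI; apply: sub_sigma_algebra.
by exists i, j, B.
Qed.

Lemma measurable_fun_mx d1 (X : measurableType d1) (f : X -> 'M[R]_(k, d)) :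
  (forall i j, measurable_fun setT (fun w => f w i j)) ->
  measurable_fun setT f.
Proof.
move=> mf; apply: (@measurability _ _ _ _ _ _ (@mx_coord_sets _ R k d)) => //.
move=> _ [_ [i [j [B [mB ->]]]] <-].
exact: (mf i j measurableT B mB).
Qed.

Definition mx_rect (B : 'I_k -> 'I_d -> set R) : set 'M[R]_(k, d) :=
  [set x | forall i j, B i j (x i j)].

Lemma measurable_mx_rect (B : 'I_k -> 'I_d -> set R) :
  (forall i j, measurable (B i j)) -> measurable (mx_rect B).
Proof.
move=> mB.
have -> : mx_rect B =
    \big[setI/setT]_i \big[setI/setT]_j [set x : 'M[R]_(k, d) | B i j (x i j)].
  apply/seteqP; split=> [x Bx|x].
    by rewrite -bigcap_seq => i _ /=; rewrite -bigcap_seq => j _; exact: Bx.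
  rewrite -bigcap_seq => + i j => /(_ i) /=; rewrite mem_index_enum.
  by rewrite -bigcap_seq => /(_ isT j) /=; rewrite mem_index_enum; exact.
apply: bigsetI_measurable => i _; apply: bigsetI_measurable => j _.
rewrite -[X in measurable X]setTI.
exact: measurable_coord.
Qed.

End matrix_measurability.

Section lebesgue_on_rectangles.
Context {R : realType}.

(** Each step of the recursive construction takes the product with
    one-dimensional Lebesgue measure. *)
Lemma lebesgue_tuple_rect n (B : 'I_n -> set R) :
  (forall i, measurable (B i)) ->
  lebesgue_tuple n [set t | forall i, B i (tnth t i)] =
  (\prod_(i < n) lebesgue_measure (B i))%E.
Proof.
elim: n B => [|n IH] B mB.
  rewrite big_ord0 /= diracE (_ : _ \in _ = true)//.
  by apply/mem_set => -[].
rewrite big_ord_recl -IH; last by move=> i; exact: mB.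
have E : @tuple_cons R n @^-1` [set t : n.+1.-tuple R | forall i, B i (tnth t i)] =
    B ord0 `*` [set t : n.-tuple R | forall i, B (lift ord0 i) (tnth t i)].
  apply/seteqP; split=> [[a t]/= Bat|[a t]/= [Ba Bt] i].
    split => [|i]; first by have := Bat ord0; rewrite (tnth_nth 0).
    by have := Bat (lift ord0 i); rewrite !(tnth_nth 0).
  rewrite (tnth_nth 0); case: (unliftP ord0 i) => [i' ->|->//].
  by have := Bt i'; rewrite (tnth_nth 0).
rewrite -product_measure1E; [by rewrite -E|exact: mB|].
have -> : [set t : n.-tuple R | forall i : 'I_n, B (lift ord0 i) (tnth t i)] =
    \big[setI/setT]_(i < n) [set t : n.-tuple R | B (lift ord0 i) (tnth t i)].
  apply/seteqP; split=> [t Bt|t]; first by rewrite -bigcap_seq => i _; exact: Bt.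
  by rewrite -bigcap_seq => + i => /(_ i) /=; rewrite mem_index_enum; apply.
apply: bigsetI_measurable => i _.
by rewrite -[X in measurable X]setTI; exact: measurable_tnth.
Qed.

Context {k d : nat}.

Lemma lebesgue_mx_rect (B : 'I_k -> 'I_d -> set R) :
  (forall i j, measurable (B i j)) ->
  lebesgue_mx k d (mx_rect B) =
  (\prod_(i < k) \prod_(j < d) lebesgue_measure (B i j))%E.
Proof.
move=> mB; have [g gK _] := curry_mxvec_bij k d.
have gE i j : g (mxvec_index i j) = (i, j) by have := gK (i, j); apply.
pose C (l : 'I_(k * d)) : set R := B (g l).1 (g l).2.
rewrite pair_big/= (eq_bigr (fun p : 'I_k * 'I_d =>
  lebesgue_measure (C (uncurry (@mxvec_index k d) p)))%E); last first.
  by move=> [i j] _; rewrite /= /C gE.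
transitivity (\prod_(l < k * d) lebesgue_measure (C l))%E; last first.
  exact: (reindex _ (curry_mxvec_bij k d)).
rewrite -lebesgue_tuple_rect; last by move=> l; exact: mB.
congr (lebesgue_tuple _ _); apply/seteqP; split=> t /= Bt.
  move=> l; case/mxvec_indexP: l => i j; rewrite /C gE.
  by have := Bt i j; rewrite mxE.
by move=> i j; rewrite mxE; have := Bt (mxvec_index i j); rewrite /C gE.
Qed.

(** Boxes that are half open in every coordinate are stable under intersection,
    so that a measure is determined by its values on them. *)
Definition mx_box (a b : 'M[R]_(k, d)) : set 'M[R]_(k, d) :=
  mx_rect (fun i j => `]a i j, b i j]%classic).

Lemma measurable_mx_box a b : measurable (mx_box a b).
Proof. by apply: measurable_mx_rect => i j; exact: measurable_itv. Qed.

Lemma lebesgue_mx_box (a b : 'M[R]_(k, d)) : (forall i j, a i j <= b i j) ->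
  lebesgue_mx k d (mx_box a b) =
  (\prod_(i < k) \prod_(j < d) (b i j - a i j))%:E.
Proof.
move=> ab; rewrite lebesgue_mx_rect; last by move=> i j; exact: measurable_itv.
rewrite -prodEFin; apply: eq_bigr => i _; rewrite -prodEFin; apply: eq_bigr => j _.
rewrite lebesgue_measure_itv/= lte_fin; case: ltP => //.
by move=> ba; rewrite (le_anti (introT andP (conj (ab i j) ba))) subrr.
Qed.

Lemma mx_box_cover :
  \bigcup_n mx_box (const_mx (- n%:R)) (const_mx n%:R) = [set: 'M[R]_(k, d)].
Proof.
apply/seteqP; split=> // x _.
pose M : R := \sum_i \sum_j `|x i j|.
have xM i j : `|x i j| <= M.
  rewrite /M (bigD1 i)//= (bigD1 j)//= -addrA lerDl addr_ge0 ?sumr_ge0// => i' _.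
  by rewrite sumr_ge0.
exists (Num.trunc M).+1 => // i j; rewrite /= !mxE in_itv/=.
have := le_lt_trans (xM i j) (truncnS_gt M).
by rewrite ltr_norml => /andP[-> /ltW].
Qed.

Lemma lebesgue_mx_cube_fin n :
  (lebesgue_mx k d (mx_box (const_mx (- (n%:R : R))%R) (const_mx n%:R)) < +oo)%E.
Proof.
by rewrite lebesgue_mx_box ?ltry// => i j; rewrite !mxE (@le_trans _ _ 0)// oppr_le0.
Qed.

Lemma lebesgue_mx_sigma_finite : sigma_finite setT (lebesgue_mx (R := R) k d).
Proof.
exists (fun n => mx_box (const_mx (- n%:R)) (const_mx n%:R)).
  by rewrite mx_box_cover.
by move=> n; split; [exact: measurable_mx_box|exact: lebesgue_mx_cube_fin].
Qed.

HB.instance Definition _ := Measure_isSigmaFinite.Build _ _ _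
  (lebesgue_mx (R := R) k d) lebesgue_mx_sigma_finite.

Lemma mx_boxI a b a' b' : mx_box a b `&` mx_box a' b' =
  mx_box (\matrix_(i, j) Num.max (a i j) (a' i j))
         (\matrix_(i, j) Num.min (b i j) (b' i j)).
Proof.
apply/seteqP; split=> x /= => [[xab xab'] i j|xab].
  have /andP[ax xb] := xab i j; have /andP[ax' xb'] := xab' i j.
  by rewrite /= !mxE in_itv/= gt_max le_min; apply/and3P; split => //; apply/andP.
split=> i j; have := xab i j; rewrite /= !mxE !in_itv/= gt_max le_min.
  by move=> /andP[/andP[-> _] /andP[-> _]].
by move=> /andP[/andP[_ ->] /andP[_ ->]].
Qed.

(** A half-space in one coordinate is a countable union of boxes. *)
Lemma measurable_mxE : @measurable _ 'M[R]_(k, d) =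
  <<s [set mx_box a b | a in setT & b in setT] >>.
Proof.
apply/seteqP; split; last first.
  apply: smallest_sub; first exact: sigma_algebra_measurable.
  by move=> _ [a _ [b _ <-]]; exact: measurable_mx_box.
apply: smallest_sub; first exact: smallest_sigma_algebra.
move=> _ [i [j [B [mB ->]]]].
pose G := [set mx_box a b | a in setT & b in setT].
have mij : measurable_fun [set: g_sigma_algebraType G]
    (fun x : g_sigma_algebraType G => (x : 'M[R]_(k, d)) i j).
  apply: (measurability _ (RGenOInfty.measurableE R)) => //.
  move=> _ [_ [c ->] <-]; rewrite setTI.
  have -> : (fun x : 'M[R]_(k, d) => x i j) @^-1` `]c, +oo[ = \bigcup_n
      mx_box (\matrix_(i', j') if (i' == i) && (j' == j) then c else - n%:R)
             (const_mx n%:R).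
    apply/seteqP; split=> [x /= cx|x [n _ /(_ i j)]/=]; last first.
      by rewrite !mxE !eqxx/= !in_itv/= andbT => /andP[].
    have [n _ xn] : (\bigcup_n mx_box (const_mx (- n%:R))
      (const_mx n%:R)) x by rewrite mx_box_cover.
    exists n => // i' j'; have := xn i' j'; rewrite /= !mxE !in_itv/=.
    case: (boolP ((i' == i) && (j' == j))) => [/andP[/eqP -> /eqP ->]|_ //].
    by move: cx; rewrite in_itv/= andbT => -> /andP[].
  apply: (@bigcupT_measurable _ (g_sigma_algebraType G)) => n.
  apply: sub_sigma_algebra; eexists; first by [].
  by eexists; [|reflexivity].
by have := mij measurableT B mB; rewrite setTI.
Qed.

Lemma lebesgue_mx_unique (mu : {measure set 'M[R]_(k, d) -> \bar R}) :
  (forall a b : 'M[R]_(k, d), (forall i j, a i j <= b i j) ->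
    mu (mx_box a b) = (\prod_(i < k) \prod_(j < d) (b i j - a i j))%:E) ->
  forall A, measurable A -> mu A = lebesgue_mx k d A.
Proof.
move=> mubox; apply: (measure_unique [set mx_box a b | a in setT & b in setT]
  (fun n => mx_box (const_mx (- n%:R)) (const_mx n%:R))).
- exact: measurable_mxE.
- move=> _ _ [a _ [b _ <-]] [a' _ [b' _ <-]].
  by rewrite mx_boxI; eexists; [|eexists; [|reflexivity]].
- by move=> n; eexists; [|eexists; [|reflexivity]].
- exact: mx_box_cover.
- move=> _ [a _ [b _ <-]].
  have [ab|/existsNP[i /existsNP[j /negP ab]]] :=
    pselect (forall i j, a i j <= b i j).
    by rewrite mubox//; exact/esym/lebesgue_mx_box.
  rewrite (_ : mx_box a b = set0) ?measure0//.
  apply/seteqP; split=> x //= /(_ i j); rewrite /= in_itv/= => /andP[ax xb].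
  by move: ab; rewrite (ltW (lt_le_trans ax xb)).
- move=> n; rewrite mubox ?ltry// => i j.
  by rewrite !mxE (@le_trans _ _ 0)// oppr_le0.
Qed.

End lebesgue_on_rectangles.

(** The pushforward bundled with its measure structure, for use where a measure is
    compared with Lebesgue measure. *)
Definition image_measure d1 d2 (X : measurableType d1) (Y : measurableType d2)
    (R : realType) (mu : {measure set X -> \bar R}) (f : X -> Y)
    (mf : measurable_fun setT f) : {measure set Y -> \bar R}.
Proof. pose m := [the measure Y R of pushforward mu f]; exact (m mf). Defined.

Section lebesgue_scaling.
Context {R : realType} {k d : nat}.

Lemma measurable_scalemx (s : R) :
  measurable_fun setT (fun x : 'M[R]_(k, d) => s *: x).
Proof.
apply: measurable_fun_mx => i j.
rewrite (_ : (fun _ => _) = (fun x : 'M[R]_(k, d) => s * x i j)); last first.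
  by apply/funext => x; rewrite mxE.
by apply: measurable_funM => //; exact: measurable_coord.
Qed.

Lemma lebesgue_mx_scale (s : R) A : 0 < s -> measurable A ->
  lebesgue_mx k d A =
  ((s ^+ (k * d))%:E * lebesgue_mx k d [set x | A (s *: x)])%E.
Proof.
move=> s0 mA.
have sk0 : 0 <= s ^+ (k * d) by rewrite exprn_ge0// ltW.
pose mu := mscale (NngNum sk0) (image_measure (lebesgue_mx k d)
  (measurable_scalemx s)).
suff mubox (a b : 'M[R]_(k, d)) : (forall i j, a i j <= b i j) ->
    mu (mx_box a b) = (\prod_(i < k) \prod_(j < d) (b i j - a i j))%:E.
  by rewrite -(lebesgue_mx_unique mubox mA).
move=> ab.
rewrite /mu/= /mscale/= /pushforward.
rewrite (_ : _ @^-1` _ = mx_box (s^-1 *: a) (s^-1 *: b)); last first.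
  apply/seteqP; split=> x xab i j; have := xab i j; rewrite /= !mxE !in_itv/=.
    by rewrite ltr_pdivrMl// ler_pdivlMl.
  by rewrite ltr_pdivrMl// ler_pdivlMl.
rewrite lebesgue_mx_box; last first.
  by move=> i j; rewrite !mxE ler_wpM2l// invr_ge0 ltW.
rewrite -EFinM; congr EFin.
rewrite mulnC exprM -[X in _ ^+ X]card_ord -prodr_const -big_split/=.
apply: eq_bigr => i _; rewrite -[X in _ ^+ X]card_ord -prodr_const -big_split/=.
by apply: eq_bigr => j _; rewrite !mxE -mulrBr mulrA divff ?gt_eqF// mul1r.
Qed.

Lemma ge0_integral_scale (s : R) (f : 'M[R]_(k, d) -> \bar R) : 0 < s ->
  measurable_fun setT f -> (forall x, 0 <= f x)%E ->
  (\int[lebesgue_mx k d]_x f x =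
   (s ^+ (k * d))%:E * \int[lebesgue_mx k d]_x f (s *: x))%E.
Proof.
move=> s0 mf f0.
have sk0 : 0 <= s ^+ (k * d) by rewrite exprn_ge0// ltW.
pose mu := mscale (NngNum sk0) (image_measure (lebesgue_mx k d)
  (measurable_scalemx s)).
rewrite (eq_measure_integral mu); last first.
  by move=> A mA _; exact: lebesgue_mx_scale.
rewrite ge0_integral_mscale//; congr (_ * _)%E.
exact: (@ge0_integral_pushforward _ _ _ _ _ _ (measurable_scalemx s)).
Qed.

End lebesgue_scaling.

Section lebesgue_anchor.
Context {R : realType} {m d : nat}.

(** The shear between a tuple and the pair of its first point and its shape, the
    tuple seen from this point. *)
Definition anchor_at (p : 'rV[R]_d * 'M[R]_(m, d)) : 'M[R]_(m.+1, d) :=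
  translate p.1 (anchor p.2).

Lemma measurable_anchor : measurable_fun setT (@anchor R d m).
Proof.
apply: measurable_fun_mx => i j; case: (unliftP ord0 i) => [i' ->|->].
  rewrite (_ : (fun _ => _) = (fun x : 'M[R]_(m, d) => x i' j)); last first.
    by apply/funext => x; rewrite anchorSE.
  exact: measurable_coord.
rewrite (_ : (fun _ => _) = cst 0)//.
by apply/funext => x; rewrite anchor0E.
Qed.

Lemma measurable_anchor_at : measurable_fun setT anchor_at.
Proof.
apply: measurable_fun_mx => i j.
rewrite (_ : (fun _ => _) = (fun p : 'rV[R]_d * 'M[R]_(m, d) =>
  anchor p.2 i j + p.1 0 j)); last by apply/funext => p; rewrite mxE.
apply: measurable_funD.
  apply: (measurableT_comp (measurable_coord i j)).
  by apply: (measurableT_comp measurable_anchor); exact: measurable_snd.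
by apply: (measurableT_comp (measurable_coord _ j)); exact: measurable_fst.
Qed.

Local Open Scope ereal_scope.

Let prod_measure : {measure set ('rV[R]_d * 'M[R]_(m, d)) -> \bar R} :=
  lebesgue_mx (R := R) 1 d \x lebesgue_mx (R := R) m d.

(** For a fixed first point t, the shapes of the tuples in a box form a box
    shifted by - t, of the same volume: the shear preserves Lebesgue measure. *)
Lemma lebesgue_mx_anchor A : measurable A ->
  lebesgue_mx m.+1 d A =
  (lebesgue_mx 1 d \x lebesgue_mx m d) (anchor_at @^-1` A).
Proof.
move=> mA; pose mu := image_measure prod_measure measurable_anchor_at.
suff mubox (a b : 'M[R]_(m.+1, d)) : (forall i j, a i j <= b i j)%R ->
    mu (mx_box a b) = (\prod_(i < m.+1) \prod_(j < d) (b i j - a i j))%R%:E.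
  by rewrite -(lebesgue_mx_unique mubox mA).
move=> ab; rewrite /mu /= /pushforward /product_measure1.
pose B : set 'rV[R]_d := mx_box (row ord0 a) (row ord0 b).
have mB : measurable B by exact: measurable_mx_box.
pose c : \bar R := (\prod_(i < m) \prod_(j < d)
  (b (lift ord0 i) j - a (lift ord0 i) j))%R%:E.
transitivity (\int[lebesgue_mx 1 d]_t ((\1_B t)%:E * c)).
  apply: eq_integral => t _ /=; rewrite indicE; have [tB|tB] := boolP (t \in B).
    rewrite mul1e (_ : xsection _ t = mx_box
      (\matrix_(i, j) (a (lift ord0 i) j - t ord0 j)%R)
      (\matrix_(i, j) (b (lift ord0 i) j - t ord0 j)%R)); last first.
      apply/seteqP; split=> z; rewrite /xsection/= ?inE.
        move=> zab i j; have := zab (lift ord0 i) j; rewrite /= translateE anchorSE.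
        by rewrite !mxE !in_itv/= ltrBlDr lerBrDr.
      move=> zab i j /=; rewrite translateE/=.
      case: (unliftP ord0 i) => [i' ->|->].
        by have := zab i' j; rewrite /= anchorSE !mxE !in_itv/= ltrBlDr lerBrDr.
      by rewrite anchor0E add0r; move: tB; rewrite inE => /(_ ord0 j); rewrite /= !mxE.
    rewrite [LHS]lebesgue_mx_box; last first.
      by move=> i j; rewrite !mxE lerD2r.
    congr EFin; apply: eq_bigr => i _; apply: eq_bigr => j _; rewrite !mxE.
    by rewrite opprB addrA subrK.
  rewrite mul0e (_ : xsection _ t = set0) ?measure0//.
  apply/seteqP; split=> z //=; rewrite /xsection/= inE => zab.
  move/negP: tB; apply; rewrite inE => i j; have := zab ord0 j.
  by rewrite /= translateE anchor0E add0r !mxE ord1.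
rewrite ge0_integralZr//; first last.
- by rewrite lee_fin; apply: prodr_ge0 => i _; apply: prodr_ge0 => j _; rewrite subr_ge0.
- exact/measurable_EFinP/measurable_indic.
rewrite integral_indic// setIT [X in X * _]lebesgue_mx_box; last first.
  by move=> i j; rewrite !mxE.
rewrite -EFinM big_ord1 big_ord_recl; congr (EFin (_ * _)%R).
by apply: eq_bigr => j _; rewrite !mxE.
Qed.

Lemma ge0_integral_anchor (f : 'M[R]_(m.+1, d) -> \bar R) :
  measurable_fun setT f -> (forall x, 0 <= f x) ->
  \int[lebesgue_mx m.+1 d]_x f x =
  \int[lebesgue_mx m d]_z \int[lebesgue_mx 1 d]_t f (translate t (anchor z)).
Proof.
move=> mf f0.
rewrite (eq_measure_integral (image_measure prod_measure measurable_anchor_at)).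
  transitivity (\int[prod_measure]_p (f \o anchor_at) p).
    exact: (@ge0_integral_pushforward _ _ _ _ _ _ measurable_anchor_at).
  rewrite fubini_tonelli2//; first exact: measurableT_comp measurable_anchor_at.
  by move=> p; exact: f0.
by move=> A mA _; exact: lebesgue_mx_anchor.
Qed.

Lemma measurable_integral_anchor (f : 'M[R]_(m.+1, d) -> \bar R) :
  measurable_fun setT f -> (forall x, 0 <= f x) ->
  measurable_fun setT (fun z =>
    \int[lebesgue_mx 1 d]_t f (translate t (anchor z))).
Proof.
move=> mf f0; apply: (@measurable_fun_fubini_tonelli_G _ _ _ _ _
  (lebesgue_mx (R := R) 1 d) (f \o anchor_at)).
  exact: measurableT_comp measurable_anchor_at.
by move=> p; exact: f0.
Qed.

End lebesgue_anchor.

Lemma measureS d1 (X : measurableType d1) (R : realType)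
    (mu : {measure set X -> \bar R}) (A B : set X) :
  measurable A -> measurable B -> A `<=` B -> (mu A <= mu B)%E.
Proof. by move=> mA mB AB; apply: le_measure; rewrite ?inE. Qed.

Section lebesgue_null_sets.
Context {R : realType}.

Lemma measurable_translate_anchor m d (t : 'rV[R]_d) :
  measurable_fun setT (fun z : 'M[R]_(m, d) => translate t (anchor z)).
Proof.
apply: (measurableT_comp (f := @anchor_at R m d) (g := fun z => (t, z))).
  exact: measurable_anchor_at.
exact: measurable_pair1.
Qed.

(** By Fubini almost every section of a null set is null, and a set of positive
    measure contains the base point of such a section. *)
Lemma exists_null_section m d (N : set 'M[R]_(m.+1, d)) (C : set 'rV[R]_d) :
  measurable N -> lebesgue_mx m.+1 d N = 0%E ->
  measurable C -> (0 < lebesgue_mx 1 d C)%E ->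
  exists2 t, C t &
    lebesgue_mx m d [set z | N (translate t (anchor z))] = 0%E.
Proof.
move=> mN N0 mC C0; apply: contrapT => /forall2NP Call.
pose A := @anchor_at R m d @^-1` N.
have mA : measurable A by rewrite -[A]setTI; exact: measurable_anchor_at.
pose phi t := lebesgue_mx m d (xsection A t).
have phiE t : phi t = lebesgue_mx m d [set z | N (translate t (anchor z))].
  by congr (lebesgue_mx m d _); apply/seteqP; split=> z;
    rewrite /xsection /A /anchor_at/= inE.
have mphi : measurable_fun setT phi by exact: measurable_fun_xsection.
have : (\int[lebesgue_mx 1 d]_t `|phi t| = 0)%E.
  rewrite -N0 lebesgue_mx_anchor// /product_measure1.
  by apply: eq_integral => t _; rewrite gee0_abs.
move/(ae_eq_integral_abs _ measurableT mphi) => [N' [mN' N'0 phiN']].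
have CN' : C `<=` N'.
  move=> t Ct; apply: phiN' => /= /(_ I); rewrite phiE => t0.
  by have [|] := Call t.
move: C0; rewrite ltNge => /negP; apply; rewrite -N'0.
exact: measureS.
Qed.

Lemma lebesgue_mx_setT_gt0 k d : (0 < lebesgue_mx k d [set: 'M[R]_(k, d)])%E.
Proof.
have : (lebesgue_mx k d (mx_box (const_mx 0%R) (const_mx 1%R)) <=
        lebesgue_mx k d [set: 'M[R]_(k, d)])%E.
  by apply: measureS => //; exact: measurable_mx_box.
apply: lt_le_trans; rewrite lebesgue_mx_box; last by move=> i j; rewrite !mxE.
by rewrite lte_fin; apply: prodr_gt0 => i _; apply: prodr_gt0 => j _; rewrite !mxE subr0.
Qed.

(** A translation invariant property of tuples is a property of their shapes: one
    null section of the exceptional set suffices. *)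
Lemma ae_anchor m d (Q : 'M[R]_(m.+1, d) -> Prop) :
  (forall t x, Q (translate t x) -> Q x) ->
  {ae lebesgue_mx m.+1 d, forall x, Q x} ->
  {ae lebesgue_mx m d, forall z, Q (anchor z)}.
Proof.
move=> Qt [N [mN N0 QN]].
have [t _ t0] := exists_null_section mN N0 measurableT (lebesgue_mx_setT_gt0 1 d).
exists [set z | N (translate t (anchor z))]; split => //.
  by rewrite -[X in measurable X]setTI; exact: measurable_translate_anchor.
move=> z /= Qz; apply: QN => /= Qtz; exact/Qz/Qt/Qtz.
Qed.

(** Scaling maps a level set to all other levels, so that a non-null one would
    give infinitely many disjoint sets of comparable measure in one cube. *)
Lemma lebesgue_mx_level_set k d (f : 'M[R]_(k, d) -> R) (c : R) :
  measurable_fun setT f -> (forall s x, 0 <= s -> f (s *: x) = s * f x) ->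
  c != 0 -> lebesgue_mx k d [set x | f x = c] = 0%E.
Proof.
move=> mf fh c0.
pose cube n : set 'M[R]_(k, d) := mx_box (const_mx (- n%:R)) (const_mx n%:R).
have mcube n : measurable (cube n) by exact: measurable_mx_box.
have mfc b : measurable [set x | f x = b].
  by rewrite -[X in measurable X]setTI; exact: mf (measurable_set1 b).
have level0 n : lebesgue_mx k d ([set x | f x = c] `&` cube n) = 0%E.
  pose v := lebesgue_mx k d ([set x | f x = c] `&` cube n).
  apply/eqP; rewrite -/v; apply: contraT => vN0.
  have v0 : (0 < v)%E by rewrite lt0e vN0 measure_ge0.
  have vfin : (v < +oo)%E.
    apply: le_lt_trans (lebesgue_mx_cube_fin n).
    apply: measureS; [|exact: mcube|exact: subIsetr].
    by apply: measurableI.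
  (* Infinitely many distinct factors, bounded away from 0 so that the volumes
     stay comparable, and at most 1 so that the scaled sets stay in the cube. *)
  pose l (j : nat) : R := (1 + j.+1%:R^-1) / 2.
  have l_ge j : 2^-1 <= l j by rewrite ler_pdivlMr// mulVf// lerDl invr_ge0.
  have l_gt0 j : 0 < l j by rewrite (lt_le_trans _ (l_ge j)).
  have l_le1 j : l j <= 1.
    have : j.+1%:R^-1 <= 1 :> R by rewrite invf_le1// ler1n.
    by rewrite /l; move: (j.+1%:R^-1) => a a1; lra.
  have l_inj i j : l i = l j -> i = j.
    move/(mulIf (invr_neq0 _)) => /(_ _)/addrI/invr_inj/eqP.
    by rewrite pnatr_eq0 eqr_nat => /(_ isT)/eqP[].
  pose E j := [set x | f x = l j * c] `&` cube n.
  have mE j : measurable (E j) by exact: measurableI.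
  have vE j : ((2^-1 ^+ (k * d))%:E * v <= lebesgue_mx k d (E j))%E.
    rewrite (lebesgue_mx_scale (l_gt0 j) (mE j)).
    apply: lee_pmul; rewrite ?lee_fin ?exprn_ge0 ?invr_ge0//; first exact: ltW.
      by rewrite lerXn2r ?nnegrE ?invr_ge0// ltW.
    apply: measureS; first exact: measurableI.
      by rewrite -[X in measurable X]setTI; exact: measurable_scalemx.
    move=> x [/= fx xn]; split => /=; first by rewrite fh ?fx// ltW.
    move=> i i'; have := xn i i'; rewrite /= !mxE !in_itv/= => /andP[nx xn'].
    apply/andP; split.
      have [x0|x0] := leP 0 (x i i').
        rewrite (@lt_le_trans _ _ 0)//; last by rewrite mulr_ge0// ltW.
        have : - n%:R < n%:R :> R by exact: lt_le_trans nx xn'.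
        by rewrite -subr_gt0 opprK -mulr2n pmulrn_lgt0// oppr_lt0.
      by rewrite (lt_le_trans nx)// ler_nMl.
    have [x0|x0] := leP 0 (x i i').
      by rewrite (le_trans _ xn')// ler_piMl.
    by rewrite (@le_trans _ _ 0)// mulr_ge0_le0// ltW.
  have tE : trivIset setT E.
    apply/trivIsetP => i j _ _ ij; apply/seteqP; split=> x //= -[[fi _] [fj _]].
    by move: (etrans (esym fj) fi) => /(mulIf c0)/l_inj/eqP; rewrite eq_sym (negbTE ij).
  pose w : R := 2^-1 ^+ (k * d) * fine v.
  have wE : w%:E = ((2^-1 ^+ (k * d))%:E * v)%E.
    by rewrite EFinM fineK// ge0_fin_numE ?ltW.
  have w0 : 0 < w by rewrite mulr_gt0 ?exprn_gt0 ?invr_gt0// fine_gt0// v0.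
  pose L : R := fine (lebesgue_mx k d (cube n)).
  have LE : L%:E = lebesgue_mx k d (cube n).
    by rewrite fineK// ge0_fin_numE ?measure_ge0// lebesgue_mx_cube_fin.
  have wL J : J%:R * w <= L.
    rewrite -lee_fin LE.
    apply: (@le_trans _ _ (lebesgue_mx k d (\big[setU/set0]_(j < J) E j))).
      rewrite measure_semi_additive_ord//; first last.
      - by apply: bigsetU_measurable => j _; exact: mE.
      - by move=> i j _ _ Eij; apply/val_inj; apply: tE Eij.
      rewrite mulr_natl -[X in _ *+ X]card_ord -sumr_const -sumEFin.
      by apply: lee_sum => j _; rewrite wE; exact: vE.
    apply: measureS => //.
      by apply: bigsetU_measurable => j _; exact: mE.
    by rewrite -bigcup_seq => x [j _ []].
  have := truncnS_gt (L / w); rewrite ltr_pdivrMr// => /lt_le_trans/(_ (wL _)).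
  by rewrite ltxx.
rewrite (_ : [set x | f x = c] = \bigcup_n ([set x | f x = c] `&` cube n)).
  apply/negligibleP.
    by apply: bigcupT_measurable => n; exact: measurableI.
  by apply: negligible_bigcup => n; apply/negligibleP;
    [exact: measurableI|exact: level0].
by rewrite -setI_bigcupr mx_box_cover setIT.
Qed.

End lebesgue_null_sets.

(** * Geometric graphs of tuples *)

Section distances_in_tuples.
Context {R : realType} {d : nat}.

Lemma measurable_row k (i : 'I_k) :
  measurable_fun setT (fun x : 'M[R]_(k, d) => row i x).
Proof.
apply: measurable_fun_mx => i' j.
rewrite (_ : (fun _ => _) = (fun x : 'M[R]_(k, d) => x i j)); last first.
  by apply/funext => x; rewrite mxE.
exact: measurable_coord.
Qed.

Lemma measurable_euclid_dist d1 (X : measurableType d1) (f g : X -> 'rV[R]_d) :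
  measurable_fun setT f -> measurable_fun setT g ->
  measurable_fun setT (fun w => euclid_dist (f w) (g w)).
Proof.
move=> mf mg.
have mj (u : X -> 'rV[R]_d) j : measurable_fun setT u ->
    measurable_fun setT (fun w => u w 0 j).
  by move=> mu; exact: measurableT_comp (measurable_coord 0 j) mu.
apply: (measurableT_comp (continuous_measurable_fun (@sqrt_continuous R))).
apply: measurable_sum => j; apply: measurable_funX.
by apply: measurable_funB; exact: mj.
Qed.

Lemma measurable_dist_le k (i j : 'I_k) (r : R) :
  measurable [set x : 'M[R]_(k, d) | euclid_dist (row i x) (row j x) <= r].
Proof.
have mf := measurable_euclid_dist (@measurable_row k i) (@measurable_row k j).
rewrite -[X in measurable X]setTI.
rewrite (_ : [set _ | _] = (fun x : 'M[R]_(k, d) =>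
  euclid_dist (row i x) (row j x)) @^-1` `]-oo, r]); last first.
  by apply/seteqP; split=> x /=; rewrite in_itv.
exact: mf.
Qed.

(** A distance between two rows is homogeneous of degree one. *)
Lemma lebesgue_mx_dist_eq k (i j : 'I_k) (s : R) : s != 0 ->
  lebesgue_mx k d [set x | euclid_dist (row i x) (row j x) = s] = 0%E.
Proof.
move=> s0; apply: lebesgue_mx_level_set => //.
  by apply: measurable_euclid_dist; exact: measurable_row.
move=> c x c0; rewrite -euclid_distZ//; congr (euclid_dist _ _);
  by apply/rowP => l; rewrite !mxE.
Qed.

Lemma ae_dist_neq k (s : R) : s != 0 ->
  {ae lebesgue_mx k d, forall x, forall i j,
    euclid_dist (row i x) (row j x) <> s}.
Proof.
move=> s0; apply: filter_forall => i; apply: filter_forall => j.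
exists [set x | euclid_dist (row i x) (row j x) = s]; split.
- have mf := measurable_euclid_dist (@measurable_row k i) (@measurable_row k j).
  by rewrite -[X in measurable X]setTI; exact: (mf measurableT _ (measurable_set1 s)).
- exact: lebesgue_mx_dist_eq.
- by move=> x /= /contrapT.
Qed.

End distances_in_tuples.

Section graph_indicator.
Context {R : realType} {d k : nat}.
Variable Gam : rel 'I_k.
Implicit Types (x : 'M[R]_(k, d)) (r : R).

(** The pattern of short distances in the tuple, and of coincidences, decides
    the isomorphism type of its geometric graph. *)
Lemma geom_graph_isoP r x :
  geom_graph_iso Gam (range (fun i => row i x)) r <->
  injective (fun i => row i x) /\
  exists s : {ffun 'I_k -> 'I_k}, injective s /\
    forall i j, Gam i j <-> i <> j /\ euclid_dist (row (s i) x) (row (s j) x) <= r.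
Proof.
split=> [[f [finj fV fG]]|[xinj [s [sinj sG]]]].
  have /choice[s sE] i : exists l, row l x = f i.
    have : range (fun i => row i x) (f i) by rewrite -fV; exists i.
    by move=> [l _ <-]; exists l.
  have sinj : injective s by move=> i j sij; apply: finj; rewrite -!sE sij.
  split.
    have /= [t st ts] := injF_bij sinj.
    by move=> i j /= xij; rewrite -(ts i) -(ts j) !sE in xij *; rewrite (finj _ _ xij).
  exists (finfun s); split=> [i j|i j]; first by rewrite !ffunE => /sinj.
  rewrite fG /geom_edge !ffunE !sE; split=> -[ij fij]; split => //.
    by move=> ij'; apply: ij; rewrite ij'.
  by move=> /finj.
exists (fun i => row (s i) x); split.
- by move=> i j /xinj/sinj.
- have [t st ts] := injF_bij sinj.
  apply/seteqP; split=> [_ [i _ <-]|_ [i _ <-]]; first by exists (s i).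
  by exists (t i) => //; rewrite ts.
- move=> i j; rewrite sG; split=> -[ij xij]; split => //.
    by move=> /xinj/sinj.
  by move=> ij'; apply: ij; rewrite ij'.
Qed.

Lemma h_graphE r x : h_graph Gam r x =
  (`[< injective (fun i => row i x) /\
  exists s : {ffun 'I_k -> 'I_k}, injective s /\
    forall i j, Gam i j <->
      i <> j /\ euclid_dist (row (s i) x) (row (s j) x) <= r >])%:R.
Proof. by congr (nat_of_bool _)%:R; apply: asbool_equiv_eq; exact: geom_graph_isoP. Qed.

Lemma h_graph_ge0 r x : 0 <= h_graph Gam r x.
Proof. exact: ler0n. Qed.

Lemma h_graph_le1 r x : h_graph Gam r x <= 1.
Proof. by rewrite /h_graph; case: asboolP. Qed.

Lemma h_graph_neq0 r x : h_graph Gam r x != 0 -> h_graph Gam r x = 1.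
Proof. by rewrite /h_graph; case: asboolP; rewrite ?eqxx. Qed.

Lemma h_graph_inj r x : h_graph Gam r x != 0 -> injective (fun i => row i x).
Proof. by rewrite h_graphE; case: asboolP => [[]//|_]; rewrite eqxx. Qed.
End graph_indicator.

Section graph_indicator_theory.
Context {R : realType} {d d' k : nat}.
Variable Gam : rel 'I_k.

(** Dimension and radius may differ on both sides, so that one lemma gives the
    invariance under translations and scalings, the dependence on the radius, and
    measurability. *)
Lemma h_graph_ext (r r' : R) (x : 'M[R]_(k, d)) (x' : 'M[R]_(k, d')) :
  (forall i j, row i x = row j x <-> row i x' = row j x') ->
  (forall i j, i <> j -> (euclid_dist (row i x) (row j x) <= r <->
                          euclid_dist (row i x') (row j x') <= r')) ->
  h_graph Gam r x = h_graph Gam r' x'.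
Proof.
move=> xx' rr'; rewrite !h_graphE; congr (nat_of_bool _)%:R.
apply: asbool_equiv_eq; split=> -[xinj [s [sinj sG]]].
  split; first by move=> i j /xx'/xinj.
  exists s; split => // i j; rewrite sG.
  by split=> -[ij xij]; split => //; apply/rr' => // /sinj.
split; first by move=> i j /xx'/xinj.
exists s; split => // i j; rewrite sG.
by split=> -[ij xij]; split => //; apply/rr' => // /sinj.
Qed.

End graph_indicator_theory.

Section graph_indicator_corollaries.
Context {R : realType} {d k : nat}.
Variable Gam : rel 'I_k.
Implicit Types (x : 'M[R]_(k, d)) (r : R).

Lemma row_mxZ (s : R) x i : row i (s *: x) = s *: row i x.
Proof. by apply/rowP => j; rewrite !mxE. Qed.

Lemma h_graph_translate t r x : h_graph Gam r (translate t x) = h_graph Gam r x.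
Proof.
apply: h_graph_ext => i j; rewrite !row_translate ?euclid_dist_translate//.
by split=> [/translate_inj//|->].
Qed.

Lemma h_graph_scale (s r : R) x : 0 < s ->
  h_graph Gam (s * r) (s *: x) = h_graph Gam r x.
Proof.
move=> s0; apply: h_graph_ext => i j; rewrite !row_mxZ.
  by split=> [/scalerI|->//]; apply; rewrite gt_eqF.
by rewrite euclid_distZ ?ler_pM2l// ltW.
Qed.

Lemma measurable_h_graph r :
  measurable_fun setT (fun x : 'M[R]_(k, d) => h_graph Gam r x).
Proof.
pose A : set 'M[R]_(k, d) := [set x | h_graph Gam r x = 1].
suff mA : measurable A.
  rewrite (_ : (fun x => _) = \1_A); first exact: measurable_indic.
  apply/funext => x; rewrite indicE; have [|hx] := boolP (x \in A).
    by rewrite inE.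
  apply/eqP; apply: contraNT hx => /h_graph_neq0 hx.
  by rewrite inE.
(* The indicator factors through finitely many truth values of closed conditions
   on the distances, distance at most 0 standing for coincidence of rows. *)
pose b x : {ffun 'I_k * 'I_k -> bool * bool} :=
  [ffun p => (euclid_dist (row p.1 x) (row p.2 x) <= r,
              euclid_dist (row p.1 x) (row p.2 x) <= 0)].
have bh x y : b x = b y -> h_graph Gam r x = h_graph Gam r y.
  move=> /ffunP bxy; apply: h_graph_ext => i j.
    have := bxy (i, j); rewrite !ffunE/= => -[_ xy]; split=> ij.
      by apply: euclid_dist_eq0; rewrite -xy ij euclid_distxx.
    by apply: euclid_dist_eq0; rewrite xy ij euclid_distxx.
  by have := bxy (i, j); rewrite !ffunE/= => -[-> _].
have -> : A = \bigcup_(c in b @` A) \bigcap_(p : 'I_k * 'I_k)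
    [set x | b x p = c p].
  apply/seteqP; split=> [x Ax|x [_ [y Ay <-]] bxy].
    by exists (b x); [exists x|].
  by rewrite /A/= (bh x y)//; apply/ffunP => p; exact: bxy.
apply: fin_bigcup_measurable => // c _.
apply: fin_bigcap_measurable => // -[i j] _.
rewrite (_ : mkset _ =
  (if (c (i, j)).1 then [set x | euclid_dist (row i x) (row j x) <= r]
   else ~` [set x | euclid_dist (row i x) (row j x) <= r]) `&`
  (if (c (i, j)).2 then [set x | euclid_dist (row i x) (row j x) <= 0]
   else ~` [set x | euclid_dist (row i x) (row j x) <= 0])).
  by apply: measurableI; case: ifP => _;
    (try apply: measurableC); exact: measurable_dist_le.
apply/seteqP; split=> x /=; rewrite ffunE/=.
  by move=> <-/=; split; case: ifPn => //= /negP.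
case: (c (i, j)) => c1 c2 /=; case: c1; case: c2 => /= -[c1 c2]; congr pair;
  by [exact: c1|exact: c2|apply/negbTE/negP; exact: c1|apply/negbTE/negP; exact: c2].
Qed.

(** Along a path of the graph each edge moves a point by at most r. *)
Lemma h_graph_diam r x i j : connected_graph Gam ->
  h_graph Gam r x != 0 -> 0 <= r ->
  euclid_dist (row i x) (row j x) <= r * k.-1%:R.
Proof.
move=> [Gsym Girr Gcon]; rewrite h_graphE; case: asboolP; last by rewrite eqxx.
move=> [xinj [s [sinj sG]]] _ r0.
have [t st ts] := injF_bij sinj.
have dist_path a p : path Gam a p ->
    euclid_dist (row (s a) x) (row (s (last a p)) x) <= r * (size p)%:R.
  elim: p a => [|b p IH] a /=; first by rewrite euclid_distxx mulr0.
  move=> /andP[/sG[_ ab] /IH bp].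
  rewrite -natr1 mulrDr mulr1 addrC.
  by rewrite (le_trans (euclid_dist_triangle (row (s b) x) _ _))// lerD.
have /connectP[p0 pth0 jl0] := Gcon (t i) (t j).
have [p pth [up jl]] : exists2 p, path Gam (t i) p &
    uniq (t i :: p) /\ t j = last (t i) p.
  by move: jl0; case: (shortenP pth0) => p pth up _ jl; exists p.
rewrite -(ts i) -(ts j) jl (le_trans (dist_path _ _ pth))//.
rewrite ler_wpM2l// ler_nat.
have szp : (size p < k)%N.
  by have := max_card (mem (t i :: p)); rewrite card_ord (card_uniqP up).
by rewrite -ltnS prednK// (leq_ltn_trans _ szp).
Qed.

End graph_indicator_corollaries.

(** * Counting points in balls *)

Section counting_theory.
Context {R : realType}.
Local Open Scope ereal_scope.

Lemma counting_esum (T : choiceType) (A : set T) :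
  counting A = \esum_(x in A) (1 : \bar R).
Proof.
have cardE (F : set T) : finite_set F ->
    \sum_(x \in F) (1 : \bar R) = (#|` fset_set F|)%:R%:E.
  move=> finF; rewrite fsbig_finite//= big_seq_fsetE/= sumEFin.
  by rewrite sumr_const cardfE.
have [finA|infA] := pselect (finite_set A).
  by rewrite /counting asboolT// -cardE// esum_fset.
rewrite /counting asboolF//; apply/esym/eq_infty.
move=> t; have [B BA tB] := infinite_set_fset (Num.trunc t).+1 infA.
apply: esum_ge; exists [set` B] => //.
rewrite cardE// set_fsetK lee_fin.
by rewrite (le_trans (ltW (truncnS_gt t)))// ler_nat.
Qed.

Lemma counting_le (T : choiceType) (A B : set T) :
  A `<=` B -> counting A <= counting B :> \bar R.
Proof.
move=> AB; rewrite !counting_esum [leLHS]esum_mkcond [leRHS]esum_mkcond.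
apply: le_esum => x _; have [xA|xA] := boolP (x \in A).
  by rewrite (mem_set (AB x (set_mem xA))).
by case: ifP.
Qed.

Lemma counting_image (T T' : choiceType) (A : set T) (f : T -> T') :
  set_inj A f -> counting (f @` A) = counting A :> \bar R.
Proof. by move=> fA; rewrite !counting_esum esum_image. Qed.

Lemma countingU (T : choiceType) (A B : set T) :
  A `&` B = set0 -> counting (A `|` B) = counting A + counting B :> \bar R.
Proof.
move=> AB; rewrite !counting_esum (esumID A)//.
rewrite setIUl setIid (setIC B) AB setU0 setIUl setICr set0U.
by rewrite [B `&` _]setIidl//; apply/disjoints_subset; rewrite setIC.
Qed.

Lemma ge0_esumZl (T : choiceType) (A : set T) (a : T -> \bar R) (c : R) :
  (0 <= c)%R -> (forall x, 0 <= a x) ->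
  \esum_(x in A) (c%:E * a x) = c%:E * \esum_(x in A) a x.
Proof.
rewrite le_eqVlt => /predU1P[<- a0|c0 a0].
  by rewrite mul0e esum1// => x _; rewrite mul0e.
have half (e : R) (b : T -> \bar R) : (0 < e)%R -> (forall x, 0 <= b x) ->
    \esum_(x in A) (e%:E * b x) <= e%:E * \esum_(x in A) b x.
  move=> e0 b0; rewrite ge_ereal_sup// => _ [F FA <-].
  rewrite -ge0_mule_fsumr// lee_pmul2l// ?lte_fin//.
  by apply: ereal_sup_ubound; exists F.
apply/eqP; rewrite eq_le half//=.
rewrite -lee_pdivlMl//.
have := half c^-1%R (fun x => c%:E * a x).
rewrite invr_gt0 => /(_ c0 _); under eq_esum do rewrite muleA -EFinM mulVf ?gt_eqF// mul1e.
by apply => x; rewrite mule_ge0// lee_fin ltW.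
Qed.

End counting_theory.

Section point_counts.
Context {R : realType} {d : nat}.
Implicit Types (B : set 'rV[R]_d) (phi : config R d).
Local Open Scope ereal_scope.

Lemma npoints_le (phi : set 'rV[R]_d) B B' :
  B `<=` B' -> npoints phi B <= npoints phi B'.
Proof. by move=> BB'; apply: counting_le; exact: setIS. Qed.

Lemma npoints_eq0 (phi : set 'rV[R]_d) B :
  npoints phi B = 0 <-> phi `&` B = set0.
Proof.
split; last by rewrite /npoints => ->; exact: measure0.
rewrite /npoints /counting; case: asboolP => // finB [/eqP].
by rewrite pnatr_eq0 finmap.cardfs_eq0 => /eqP /fset_set_set0; apply.
Qed.

Lemma npoints_bounded phi B : bounded_mx B ->
  exists n : nat, npoints phi B = n%:R%:E.
Proof.
move=> bB; rewrite /npoints /counting asboolT; last first.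
  exact: points_locally_finite.
by eexists.
Qed.

Lemma npointsP (phi : set 'rV[R]_d) B :
  npoints phi B = +oo \/ exists n : nat, npoints phi B = n%:R%:E.
Proof.
by rewrite /npoints /counting; case: asboolP => _; [right; eexists|left].
Qed.

Lemma npoints_setD phi B B' : bounded_mx B' -> B `<=` B' ->
  npoints phi B = npoints phi B' -> phi `&` B' `<=` B.
Proof.
move=> bB' BB' NBB'.
have : npoints phi B' = npoints phi B + npoints phi (B' `\` B).
  rewrite /npoints -countingU.
    by rewrite -setIUr setDUK.
  by apply/seteqP; split => y //= [[_ By] [_ [_ nBy]]].
have [n Nn] := npoints_bounded phi bB'.
have bD : bounded_mx (B' `\` B) by have [M BM] := bB'; exists M => x [/BM].
have [n' Nn'] := npoints_bounded phi bD.
rewrite NBB' Nn Nn' => -[/eqP]; rewrite -subr_eq0 opprD addNKr oppr_eq0 => /eqP n'0.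
have /npoints_eq0 D0 : npoints phi (B' `\` B) = 0 by rewrite Nn' n'0.
move=> y [phiy By]; apply: contrapT => nBy.
by have : (points phi `&` (B' `\` B)) y by []; rewrite D0.
Qed.

Lemma measurable_npoints_eq B (n : nat) : measurable B ->
  measurable [set phi : config R d | npoints phi B = n%:R%:E].
Proof. by move=> mB; apply: sub_sigma_algebra; exists B, n. Qed.

Lemma measurable_npoints_le B (n : nat) : measurable B ->
  measurable [set phi : config R d | npoints phi B <= n%:R%:E].
Proof.
move=> mB; rewrite (_ : [set _ | _] = \bigcup_(i in `I_n.+1)
    [set phi : config R d | npoints phi B = i%:R%:E]); last first.
  apply/seteqP; split=> phi /=; last first.
    by move=> [i /= + ->]; rewrite ltnS lee_fin ler_nat.
  have [->|[i Ni]] := npointsP phi B; first by rewrite leye_eq.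
  by rewrite Ni lee_fin ler_nat => ni; exists i.
by apply: bigcup_measurable => i _; exact: measurable_npoints_eq.
Qed.

End point_counts.

Section balls_theory.
Context {R : realType} {d k : nat}.
Implicit Types (x : 'M[R]_(k, d)) (r : R) (phi : config R d).

Lemma measurable_balls x r : measurable (balls x r).
Proof.
rewrite (_ : balls x r = \bigcup_(i : 'I_k)
    [set y | euclid_dist (row i x) y <= r]); last first.
  by apply/seteqP; split=> [y [i xy]|y [i _ xy]]; [exists i|exists i].
apply: fin_bigcup_measurable => // i _.
have mf : measurable_fun setT (fun y : 'rV[R]_d => euclid_dist (row i x) y).
  by apply: measurable_euclid_dist => //; exact: measurable_cst.
rewrite -[X in measurable X]setTI.
rewrite (_ : [set _ | _] = (fun y => euclid_dist (row i x) y) @^-1` `]-oo, r]).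
  exact: mf.
by apply/seteqP; split=> y /=; rewrite in_itv.
Qed.

Lemma bounded_balls x r : bounded_mx (balls x r).
Proof.
exists (r + \sum_i \sum_j `|x i j|) => y [i xy] i' j.
rewrite ord1 (_ : y 0 j = x i j - (row i x 0 j - y 0 j)); last by rewrite mxE subKr.
rewrite [leRHS]addrC (le_trans (ler_normB _ _))// lerD//; last first.
  exact: le_trans (coord_le_euclid_dist _ _ j) xy.
rewrite (bigD1 i)//= (bigD1 j)//= -addrA lerDl addr_ge0 ?sumr_ge0// => i2 _.
exact: sumr_ge0.
Qed.

Lemma balls_le x r r' : r <= r' -> balls x r `<=` balls x r'.
Proof. by move=> rr' y [i xy]; exists i; exact: le_trans rr'. Qed.

Lemma balls_near x x' r e : (forall i, euclid_dist (row i x) (row i x') <= e) ->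
  balls x r `<=` balls x' (r + e).
Proof.
move=> xx' y [i xy]; exists i.
by rewrite [leRHS]addrC (le_trans (euclid_dist_triangle (row i x) _ _))// lerD// euclid_distC.
Qed.

(** A configuration has no accumulation point, so closed balls around the tuple
    can be enlarged a little without catching further points. *)
Lemma balls_enlarge phi x r :
  exists2 e : R, 0 < e & phi `&` balls x (r + e) `<=` balls x r.
Proof.
have /finite_seqP[s sE] := points_locally_finite phi (bounded_balls x (r + 1)).
have [e e0 es] : exists2 e : R, 0 < e &
    forall y, y \in s -> balls x (r + e) y -> balls x r y.
  elim: {sE} s => [|y s [e e0 es]]; first by exists 1.
  have [y1|y1] := pselect (balls x r y).
    by exists e => // y' /[!inE] /predU1P[->//|]; exact: es.
  have [f f0 yf] : exists2 f : R, 0 < f & ~ balls x (r + f) y.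
    pose f := \big[Num.min/1]_i (euclid_dist (row i x) y - r).
    have f0 : 0 < f.
      apply: lt_bigmin => // i _; rewrite subr_gt0 ltNge.
      by apply/negP => iy; apply: y1; exists i.
    exists (f / 2); first by rewrite divr_gt0.
    move=> [i]; apply/negP; rewrite -ltNge -ltrBrDl.
    rewrite (@lt_le_trans _ _ f)//; last exact: bigmin_le_cond.
    by rewrite ltr_pdivrMr// ltr_pMr// ltr1n.
  exists (Num.min e f); first by rewrite lt_min e0.
  move=> y' /[!inE] /predU1P[->|y's] yef; last first.
    by apply: (es _ y's); apply: balls_le yef; rewrite lerD2l ge_min lexx.
  by exfalso; apply: yf; apply: balls_le yef; rewrite lerD2l ge_min lexx orbT.
exists (Num.min e 1); first by rewrite lt_min e0/=.
move=> y [phiy ye]; apply: (es y); last first.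
  by apply: balls_le ye; rewrite lerD2l ge_min lexx.
suff : [set` s] y by [].
rewrite -sE; split => //; apply: balls_le ye.
by rewrite lerD2l ge_min lexx orbT.
Qed.

End balls_theory.

Section joint_measurability.
Context {R : realType} {d k : nat}.
Implicit Types (x : 'M[R]_(k, d)) (r : R) (W : set 'rV[R]_d).

Lemma rat_mx_near x (e : R) : 0 < e -> exists q : 'M[rat]_(k, d),
  forall i, euclid_dist (row i x) (row i (map_mx ratr q)) <= e.
Proof.
move=> e0; have e'0 : 0 < e / d.+1%:R by rewrite divr_gt0.
have /choice[q qP] (p : 'I_k * 'I_d) :
    exists q : rat, `|x p.1 p.2 - ratr q| <= e / d.+1%:R.
  have /rat_in_itvoo[q] : x p.1 p.2 - e / d.+1%:R < x p.1 p.2 + e / d.+1%:R.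
    by rewrite ltrD2l gt0_cp.
  rewrite in_itv/= => /andP[q1 q2]; exists q.
  by rewrite ler_norml lerBrDr addrC -lerBrDr opprK (ltW q2)/= lerBlDr -lerBlDl ltW.
exists (\matrix_(i, j) q (i, j)) => i.
rewrite (le_trans (euclid_dist_le_sup (e := e / d.+1%:R) _ (ltW e'0)))//.
  by move=> j; rewrite !mxE; exact: (qP (i, j)).
by rewrite mulrCA ler_piMr ?(ltW e0)// ler_pdivrMr// mul1r ler_nat.
Qed.

(** The number of points in closed balls is upper semicontinuous in the centres,
    hence bounded by n exactly when it is so for some slightly larger balls with
    rational centres and radius. *)
Lemma measurable_npoints_balls_le W r (n : nat) : measurable W ->
  measurable [set z : config R d * 'M[R]_(k, d) |
    (npoints z.1 (W `&` balls z.2 r) <= n%:R%:E)%E].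
Proof.
move=> mW.
pose Q (p : 'M[rat]_(k, d) * rat) : set (config R d * 'M[R]_(k, d)) :=
  [set phi : config R d |
    (npoints phi (W `&` balls (map_mx ratr p.1) (ratr p.2)) <= n%:R%:E)%E] `*`
  [set x | forall i,
    euclid_dist (row i x) (row i (map_mx ratr p.1)) <= ratr p.2 - r].
rewrite (_ : [set _ | _] = \bigcup_p Q p); last first.
  apply/seteqP; split=> -[phi x] /=; last first.
    move=> [[q r'] _ [/= Nq xq]]; apply: le_trans Nq; apply: npoints_le.
    by apply: setIS; have := balls_near (r := r) xq; rewrite addrC subrK.
  move=> Nx; have [e e0 xe] := balls_enlarge phi x r.
  have [q xq] := rat_mx_near x (divr_gt0 e0 (ltr0n R 4)).
  have /rat_in_itvoo[r'] : r + e / 4 < r + e / 2.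
    by rewrite ltrD2l ltr_pM2l// ltf_pV2 ?posrE// ltr_nat.
  rewrite in_itv/= => /andP[r'1 r'2]; exists (q, r') => //; split => /=.
    apply: le_trans Nx; apply: counting_le => y [phiy [Wy qy]].
    split => //; split => //; apply: xe; split => //.
    apply: balls_le (balls_near _ qy); last by move=> i; rewrite euclid_distC.
    by have := ltW r'2; lra.
  by move=> i; rewrite (le_trans (xq i))// lerBrDl ltW.
apply: countable_bigcupT_measurable => [|[q r']]; first exact: countableP.
apply: measurableX.
  by apply: measurable_npoints_le; apply: measurableI => //; exact: measurable_balls.
rewrite (_ : mkset _ = \bigcap_(i : 'I_k) [set x : 'M[R]_(k, d) |
  euclid_dist (row i x) (row i (map_mx ratr q)) <= ratr r' - r]); last first.
  by apply/seteqP; split=> x /= xq i; [move=> _|]; exact: xq.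
apply: fin_bigcap_measurable => // i _.
have mf : measurable_fun setT
    (fun x : 'M[R]_(k, d) => euclid_dist (row i x) (row i (map_mx ratr q))).
  by apply: measurable_euclid_dist; [exact: measurable_row|exact: measurable_cst].
rewrite -[X in measurable X]setTI (_ : [set _ | _] = (fun x : 'M[R]_(k, d) =>
  euclid_dist (row i x) (row i (map_mx ratr q))) @^-1` `]-oo, ratr r' - r]).
  exact: mf.
by apply/seteqP; split=> x /=; rewrite in_itv.
Qed.

Lemma measurable_npoints_balls_eq W r (n : nat) : measurable W ->
  measurable [set z : config R d * 'M[R]_(k, d) |
    npoints z.1 (W `&` balls z.2 r) = n%:R%:E].
Proof.
move=> mW; case: n => [|n].
  rewrite (_ : [set _ | _] = [set z : config R d * 'M[R]_(k, d) |
      (npoints z.1 (W `&` balls z.2 r) <= 0%:R%:E)%E]).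
    exact: measurable_npoints_balls_le.
  apply/seteqP; split=> z /= => [->//|z0]; apply/eqP; rewrite eq_le z0/=.
  by have [->|[i ->]] := npointsP z.1 (W `&` balls z.2 r); rewrite ?leey ?lee_fin.
rewrite (_ : [set _ | _] =
    [set z : config R d * 'M[R]_(k, d) |
      (npoints z.1 (W `&` balls z.2 r) <= n.+1%:R%:E)%E] `\`
    [set z : config R d * 'M[R]_(k, d) |
      (npoints z.1 (W `&` balls z.2 r) <= n%:R%:E)%E]).
  by apply: measurableD; exact: measurable_npoints_balls_le.
apply/seteqP; split=> z /=.
  by move=> ->; rewrite !lee_fin !ler_nat ltnn.
have [->|[i ->]] := npointsP z.1 (W `&` balls z.2 r); first by rewrite !leye_eq => -[].
by rewrite !lee_fin !ler_nat => -[iSn /negP]; rewrite -ltnNge => ni;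
  congr (_%:R%:E); apply/eqP; rewrite eqn_leq iSn.
Qed.

(** For a locally finite configuration this says that a point lies in the balls at
    distance at least s from all centres; the formulation with shells compares
    counts in balls, whose joint measurability is known. *)
Definition on_boundary (s : R) : set (config R d * 'M[R]_(k, d)) :=
  [set z | forall n : nat, exists y,
    [/\ points z.1 y, balls z.2 s y & ~ balls z.2 (s - n.+1%:R^-1) y]].

Lemma measurable_on_boundary s : measurable (on_boundary s).
Proof.
pose E (r : R) (j : nat) : set (config R d * 'M[R]_(k, d)) :=
  [set z : config R d * 'M[R]_(k, d) |
    npoints z.1 (setT `&` balls z.2 r) = j%:R%:E].
rewrite (_ : on_boundary s =
    ~` \bigcup_n \bigcup_j (E s j `&` E (s - n.+1%:R^-1) j)).
  apply: measurableC; apply: bigcupT_measurable => n.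
  apply: bigcupT_measurable => j.
  by apply: measurableI; exact: measurable_npoints_balls_eq.
have s_le n : s - n.+1%:R^-1 <= s by rewrite gerBl.
apply/seteqP; split=> -[phi x] /=.
  move=> bd [n _ [j _ [/= E1 E2]]]; have [y [phiy sy nsy]] := bd n; apply: nsy.
  move: E1 E2; rewrite /E/= !setTI => E1 E2.
  have NE : npoints phi (balls x (s - n.+1%:R^-1)) = npoints phi (balls x s).
    by rewrite E2; apply/esym.
  by apply: (npoints_setD (bounded_balls x s) _ NE); [exact: balls_le|split].
move=> nE n; apply: contrapT => /forallNP ny; apply: nE; exists n => //.
have [j Nj] := npoints_bounded phi (bounded_balls x s); exists j => //.
split; rewrite /E/= setTI// -Nj; congr counting.
apply/seteqP; split=> y [phiy yb]; split => //; first exact: balls_le yb.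
by apply: contrapT => nyb; apply: (ny y).
Qed.

End joint_measurability.

(** * Integrals of possibly nonmeasurable functions *)

Section lower_integral.
Context d1 (X : measurableType d1) (R : realType).
Variable mu : {measure set X -> \bar R}.
Local Open Scope ereal_scope.

(** The integral of a nonnegative function is a supremum over the simple
    functions below it, hence monotone even without measurability; the counting
    functionals of a point process are compared in this way. *)
Lemma ge0_le_lower_integral (f g : X -> \bar R) :
  (forall x, 0 <= f x) -> (forall x, f x <= g x) ->
  \int[mu]_x f x <= \int[mu]_x g x.
Proof.
move=> f0 fg; have g0 x : 0 <= g x := le_trans (f0 x) (fg x).
rewrite !ge0_integralTE//; apply: ge_ereal_sup => _ [h hf <-].
by apply: ereal_sup_ubound; exists h => // x; exact: le_trans (hf x) (fg x).
Qed.

(** On a null set f may fail to be measurable, but it lies between the measurable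
    functions obtained from g by the values 0 and +oo there. *)
Lemma ge0_ae_eq_lower_integral (f g : X -> \bar R) :
  (forall x, 0 <= f x) -> (forall x, 0 <= g x) -> measurable_fun setT g ->
  {ae mu, forall x, f x = g x} -> \int[mu]_x f x = \int[mu]_x g x.
Proof.
move=> f0 g0 mg [N [mN N0 fgN]].
pose h (c : \bar R) x := if x \in N then c else g x.
have mh c : measurable_fun setT (h c).
  apply: measurable_fun_ifT => //; apply: (measurable_fun_bool true).
  rewrite setTI (_ : _ @^-1` _ = N)//.
  by apply/seteqP; split=> x /= => [/set_mem|/mem_set].
have hg c : 0 <= c -> \int[mu]_x h c x = \int[mu]_x g x.
  move=> c0; apply: ge0_ae_eq_integral => //.
    by move=> x _; rewrite /h; case: ifP.
  exists N; split => // x /= /not_implyP[_ hx].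
  apply: contrapT => Nx; apply: hx; rewrite /h memNset//.
have fg x : ~ N x -> f x = g x.
  by move=> Nx; apply: contrapT => fgx; apply: Nx; exact: fgN.
apply/eqP; rewrite eq_le -{1}(hg +oo)// -(hg 0)//; apply/andP; split.
  apply: ge0_le_lower_integral => // x; rewrite /h; case: ifP => [_|/negbT xN].
    by rewrite leey.
  by rewrite fg// => Nx; rewrite mem_set in xN.
apply: ge0_le_lower_integral => x; rewrite /h; case: ifP => // /negbT xN.
by rewrite fg// => Nx; rewrite mem_set in xN.
Qed.

Lemma ge0_integral0_ae (D : set X) (f : X -> \bar R) :
  measurable D -> measurable_fun D f -> (forall x, 0 <= f x) ->
  \int[mu]_(x in D) f x = 0 -> {ae mu, forall x, D x -> f x = 0}.
Proof.
move=> mD mf f0 I0; apply/(ae_eq_integral_abs mu mD mf); rewrite -I0.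
by apply: eq_integral => x _; rewrite gee0_abs.
Qed.

End lower_integral.

Section full_measure.
Context d1 (X : measurableType d1) (R : realType).
Variable mu : {measure set X -> \bar R}.

Lemma eq_measure_full (A B F : set X) : mu setT = 1%E ->
  measurable A -> measurable B -> measurable F -> mu F = 1%E ->
  A `&` F = B `&` F -> mu A = mu B.
Proof.
move=> mu1 mA mB mF muF AB.
have F0 : mu (~` F) = 0%E.
  have : (mu setT = mu F + mu (~` F))%E.
    rewrite -measureU ?setUCr//; first exact: measurableC.
    exact: setICr.
  rewrite mu1 muF; case: (mu _) => [r| |]//; rewrite -EFinD => -[/eqP].
  by rewrite -{1}(addr0 1%R) (inj_eq (addrI _)) => /eqP <-.
have EF C : measurable C -> mu C = mu (C `&` F).
  move=> mC; rewrite (measureDI mu mC mF).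
  rewrite [X in (X + _)%E](_ : _ = 0%E) ?add0e//.
  apply/eqP; rewrite eq_le measure_ge0 andbT -F0.
  by apply: measureS; [exact: measurableD|exact: measurableC|exact: subIsetr].
by rewrite EF// AB -EF.
Qed.

End full_measure.

(** * Cubes of tuples and counts of their points *)

Section matrix_cubes.
Context {R : realType} {k d : nat}.

Definition mx_cube (C : R) : set 'M[R]_(k, d) :=
  [set x | forall i j, `|x i j| <= C].

Lemma measurable_mx_cube C : measurable (mx_cube C).
Proof.
rewrite (_ : mx_cube C = mx_rect (fun _ _ => `[- C, C]%classic)).
  by apply: measurable_mx_rect => i j; exact: measurable_itv.
by apply/seteqP; split=> x xC i j; have := xC i j; rewrite /= in_itv/= ler_norml.
Qed.

Lemma bounded_mx_cube C : bounded_mx (mx_cube C).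
Proof. by exists C. Qed.

Lemma compact_mx_cube C : compact (mx_cube C).
Proof.
have [g gK _] := curry_mxvec_bij k d.
have gE i j : g (mxvec_index i j) = (i, j) by have := gK (i, j); apply.
rewrite (_ : mx_cube C = vec_mx @`
    [set v : 'rV[R]_(k * d) | forall l, `[- C, C]%classic (v ord0 l)]).
  apply: continuous_compact; last first.
    exact: (@rV_compact R _ (fun=> `[- C, C]%classic) (fun=> @segment_compact _ _ _)).
  apply: continuous_subspaceT => v A [P vP PA].
  exists (fun _ l => P (g l).1 (g l).2) => [i l|w wP].
    case/mxvec_indexP: l => i' j; rewrite gE/= ord1.
    by have := vP i' j; rewrite mxE.
  by apply: (PA (vec_mx w)) => i j; rewrite mxE; have := wP ord0 (mxvec_index i j); rewrite gE.
apply/seteqP; split=> [x xC|_ [v vC <-] i j].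
  exists (mxvec x); last by rewrite mxvecK.
  by move=> l; case/mxvec_indexP: l => i j; rewrite mxvecE /= in_itv/= -ler_norml.
by rewrite mxE ler_norml; have := vC (mxvec_index i j); rewrite /= in_itv.
Qed.

Lemma lebesgue_mx_cube (C : R) : 0 <= C ->
  lebesgue_mx k d (mx_cube C) = ((2 * C) ^+ (k * d))%:E.
Proof.
move=> C0; rewrite (_ : mx_cube C = mx_rect (fun _ _ => `[- C, C]%classic)).
  rewrite lebesgue_mx_rect; last by move=> i j; exact: measurable_itv.
  have -> : lebesgue_measure `[- C, C]%classic = (2 * C)%:E.
    rewrite lebesgue_measure_itv/= lte_fin; case: ltP => [_|CC].
      by rewrite -EFinD opprK mulr_natl mulr2n.
    have -> : C = 0 by lra.
    by rewrite mulr0.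
  under eq_bigr do rewrite prodEFin prodr_const card_ord.
  by rewrite prodEFin prodr_const card_ord -exprM mulnC.
by apply/seteqP; split=> x xC i j; have := xC i j; rewrite /= in_itv/= ler_norml.
Qed.

End matrix_cubes.

Section counting_tuples.
Context {R : realType} {d k : nat}.
Implicit Types (phi : config R d) (x : 'M[R]_(k, d)).

Lemma counting_rows x : injective (fun i => row i x) ->
  counting (range (fun i => row i x)) = k%:R%:E :> \bar R.
Proof.
move=> xI; rewrite counting_image; last by move=> i j _ _; exact: xI.
rewrite /counting asboolT; last exact: finite_finset.
by rewrite (card_fset_set (n := k))// card_eq_sym; exact: card_II.
Qed.

Lemma npoints_add_eq (phi : set 'rV[R]_d) x (S : set 'rV[R]_d) :
  injective (fun i => row i x) -> range (fun i => row i x) `<=` S ->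
  (npoints (phi `|` range (fun i => row i x)) S = k%:R%:E) <->
  npoints phi (S `\` range (fun i => row i x)) = 0%E.
Proof.
move=> xI; set X := range (fun i => row i x) => xS.
have -> : npoints (phi `|` X) S = (k%:R%:E + npoints phi (S `\` X))%E.
  rewrite /npoints -(counting_rows xI) -/X -countingU; last first.
    by apply/seteqP; split=> y //= [Xy [_ []]].
  congr counting; apply/seteqP; split=> y /=.
    move=> [[phiy|Xy] Sy]; last by left.
    by have [Xy|nXy] := pselect (X y); [left|right].
  by move=> [Xy|[phiy [Sy _]]]; split; [right|exact: xS|left|].
have [->|[n ->]] := npointsP phi (S `\` X); first by split.
rewrite -EFinD; split=> -[n0]; last by rewrite n0 addr0.
by congr EFin; apply: (@addrI _ k%:R); rewrite addr0.
Qed.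

End counting_tuples.

(** * The Campbell formula for isolated tuples *)

Section campbell.
Context {dT : measure_display} {T : measurableType dT} {R : realType}.
Context {d k : nat}.
Variables (P : probability T R) (Phi : {mfun T >-> config R d}).
Variable rho : 'M[R]_(k, d) -> R.
Variable palm : R.-pker 'M[R]_(k, d) ~> config R d.
Hypothesis mrho : measurable_fun setT rho.
Hypothesis rho_ge0 : forall x, 0 <= rho x.
Hypothesis palm_campbell : campbell_formula P Phi rho palm.

Definition void_prob (W : set 'rV[R]_d) (r : R) (x : 'M[R]_(k, d)) : \bar R :=
  palm x [set phi | npoints phi (W `&` balls x r) = 0%E].

Lemma measurable_void_set W r (x : 'M[R]_(k, d)) : measurable W ->
  measurable [set phi : config R d | npoints phi (W `&` balls x r) = 0%E].
Proof.
move=> mW; apply: (@measurable_npoints_eq _ _ _ 0%N).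
by apply: measurableI => //; exact: measurable_balls.
Qed.

Lemma void_prob_ge0 W r x : (0 <= void_prob W r x)%E.
Proof. exact: measure_ge0. Qed.

Lemma palm_le1 x A : measurable A -> (palm x A <= 1)%E.
Proof.
by move=> mA; rewrite -(prob_kernel (s := palm) x); apply: measureS.
Qed.

Lemma measurable_palm_section (A : set (config R d * 'M[R]_(k, d))) :
  measurable A -> measurable_fun setT (fun x => palm x [set phi | A (phi, x)]).
Proof.
move=> mA; pose B : set ('M[R]_(k, d) * config R d) := [set z | A (z.2, z.1)].
have mB : measurable B.
  have mf := measurable_fun_pair (@measurable_snd _ _ 'M[R]_(k, d) (config R d))
    (@measurable_fst _ _ 'M[R]_(k, d) (config R d)).
  by rewrite -[B]setTI; exact: (mf measurableT _ mA).
have -> : (fun x => palm x [set phi | A (phi, x)]) =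
    (fun x => palm x (xsection B x)).
  apply/funext => x; congr (palm x _); apply/seteqP.
  by split=> phi; rewrite /xsection/= ?inE.
exact: (measurable_fun_xsection_finite_kernel palm (mem_set mB)).
Qed.

Lemma measurable_void_prob W r : measurable W ->
  measurable_fun setT (void_prob W r).
Proof.
move=> mW; apply: (measurable_palm_section (A := [set z : config R d * 'M[R]_(k, d) |
  npoints z.1 (W `&` balls z.2 r) = 0%E])).
exact: (@measurable_npoints_balls_eq _ _ _ _ _ 0%N).
Qed.

Hypothesis palm_reduced : {ae lebesgue_mx k d, forall x, 0 < rho x ->
  palm x [set phi | forall i, ~ points phi (row i x)] = 1%E}.

Let no_rows (x : 'M[R]_(k, d)) : set (config R d) :=
  [set phi : config R d | forall i, ~ points phi (row i x)].

Let measurable_no_rows x : measurable (no_rows x).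
Proof.
rewrite (_ : no_rows x = [set phi : config R d | npoints phi (setT `&` balls x 0) = 0%E]).
  exact: measurable_void_set.
apply/seteqP; split=> phi /=.
  move=> nphi; apply/npoints_eq0; apply/seteqP; split=> y //= [phiy [_ [i]]].
  by move=> /euclid_dist_eq0 iy; apply: (nphi i); rewrite iy.
move=> /npoints_eq0 phi0 i phii.
have : (points phi `&` (setT `&` balls x 0)) (row i x).
  by split => //; split => //; exists i; rewrite euclid_distxx.
by rewrite phi0.
Qed.

(** Under the hypothesis on the tuple, the events that the balls contain no point,
    and no point apart from the tuple, differ by a null event. *)
Lemma palm_isolated W r x : measurable W -> 0 <= r -> injective (fun i => row i x) ->
  (forall i, W (row i x)) -> palm x (no_rows x) = 1%E ->
  measurable [set phi : config R d |
    npoints (config_add phi x) (W `&` balls x r) = k%:R%:E] /\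
  palm x [set phi : config R d |
    npoints (config_add phi x) (W `&` balls x r) = k%:R%:E] = void_prob W r x.
Proof.
move=> mW r0 xI xW px1; set S := W `&` balls x r.
pose X := range (fun i => row i x).
have XS : X `<=` S.
  by move=> _ [i _ <-]; split => //; exists i; rewrite euclid_distxx.
have mX : measurable X.
  rewrite (_ : X = balls x 0); first exact: measurable_balls.
  apply/seteqP; split=> [_ [i _ <-]|y [i /euclid_dist_eq0 <-]]; last by exists i.
  by exists i; rewrite euclid_distxx.
have mS : measurable S by apply: measurableI => //; exact: measurable_balls.
have E : [set phi : config R d | npoints (config_add phi x) S = k%:R%:E] =
    [set phi : config R d | npoints phi (S `\` X) = 0%:R%:E].
  by apply/seteqP; split=> phi /= /(npoints_add_eq phi xI XS).
have mE : measurable [set phi : config R d | npoints phi (S `\` X) = 0%:R%:E].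
  by apply: measurable_npoints_eq; exact: measurableD.
split; first by rewrite E.
rewrite E; apply: (eq_measure_full (F := no_rows x)) => //.
- exact: prob_kernel.
- exact: measurable_void_set.
apply/seteqP; split=> phi /= [/npoints_eq0 phi0 nphi]; split => //.
  apply/npoints_eq0; apply/seteqP; split=> y //= [phiy Sy].
  suff : (points phi `&` (S `\` X)) y by rewrite phi0.
  by split => //; split => // -[i _ iy]; apply: (nphi i); rewrite iy.
apply/npoints_eq0; apply/seteqP; split=> y //= [phiy [Sy _]].
by have : (points phi `&` S) y by []; rewrite phi0.
Qed.

(** The Campbell formula adds the points of x to the configuration. They account
    for k points in the balls, and the reduced Palm distribution contains none of
    them, so that the count is k exactly when the other points avoid the balls. *)
Lemma campbell_isolated W r (g : 'M[R]_(k, d) -> R) (M C : R) :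
  measurable W -> 0 <= r -> measurable_fun setT g ->
  (forall x, 0 <= g x <= M) -> (forall x, g x != 0 -> mx_cube C x) ->
  (forall x, g x != 0 -> injective (fun i => row i x) /\ forall i, W (row i x)) ->
  (\int[P]_w (\esum_(x in distinct_tuples (Phi w))
     (g x * (npoints (Phi w) (W `&` balls x r) == k%:R%:E)%:R)%:E) =
   \int[lebesgue_mx k d]_x ((g x * rho x)%:E * void_prob W r x))%E.
Proof.
move=> mW r0 mg gM gC gW.
have g0 x : 0 <= g x by have /andP[] := gM x.
pose A : set (config R d * 'M[R]_(k, d)) :=
  [set z : config R d * 'M[R]_(k, d) |
    npoints z.1 (W `&` balls z.2 r) = k%:R%:E].
have mA : measurable A by exact: measurable_npoints_balls_eq.
pose u (z : config R d * 'M[R]_(k, d)) : R := g z.2 * \1_A z.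
have AE (z : config R d * 'M[R]_(k, d)) : (npoints (points z.1) (W `&` balls z.2 r) == k%:R%:E)%:R = \1_A z :> R.
  by rewrite indicE; congr (nat_of_bool _)%:R; apply/eqP/idP => [?|/set_mem//]; apply/mem_set.
transitivity (\int[P]_w (\esum_(x in distinct_tuples (Phi w)) (u (Phi w, x))%:E))%E.
  apply: eq_integral => w _; apply: eq_esum => x _.
  by rewrite /u -(AE (Phi w, x)).
rewrite palm_campbell; first last.
- exists (mx_cube C); first exact: compact_mx_cube.
  move=> phi x nK; rewrite /u/=; have [->|/gC//] := eqVneq (g x) 0.
  by rewrite mul0r.
- exists M => z; have /andP[_ gMz] := gM z.2; rewrite /u indicE.
  by case: (_ \in _); rewrite ?mulr1// mulr0 (le_trans (g0 z.2)).
- by move=> z; rewrite /u mulr_ge0// indicE.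
- apply: measurable_funM; last exact: measurable_indic.
  by apply: measurableT_comp => //; exact: measurable_snd.
apply: ge0_ae_eq_lower_integral.
- move=> x; rewrite mule_ge0 ?lee_fin//; apply: integral_ge0 => phi _.
  by rewrite lee_fin mulr_ge0// indicE.
- by move=> x; rewrite mule_ge0 ?void_prob_ge0// lee_fin mulr_ge0.
- apply: emeasurable_funM; last exact: measurable_void_prob.
  by apply/measurable_EFinP; exact: measurable_funM.
apply: filterS palm_reduced => x px.
have [gx0|gx0] := eqVneq (g x) 0.
  rewrite /u /= gx0 mul0r mul0e integral0_eq ?mul0e// => phi _.
  by rewrite mul0r.
have [rx0|rx0] := eqVneq (rho x) 0; first by rewrite rx0 mule0 mulr0 mul0e.
have {}px : palm x (no_rows x) = 1%E by apply: px; rewrite lt0r rx0 rho_ge0.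
have [xI xW] := gW x gx0.
have [mE <-] := palm_isolated mW r0 xI xW px.
rewrite (eq_integral (fun phi => (g x)%:E * (\1_[set phi : config R d |
    npoints (config_add phi x) (W `&` balls x r) = k%:R%:E] phi)%:E)%E); last first.
  by move=> phi _; rewrite /u/= EFinM.
rewrite ge0_integralZl_EFin//; last first.
  by apply/measurable_EFinP; exact: measurable_indic.
by rewrite integral_indic// setIT EFinM muleAC.
Qed.

Lemma campbell_tuples (g : 'M[R]_(k, d) -> R) (M C : R) :
  measurable_fun setT g ->
  (forall x, 0 <= g x <= M) -> (forall x, g x != 0 -> mx_cube C x) ->
  (\int[P]_w (\esum_(x in distinct_tuples (Phi w)) (g x)%:E) =
   \int[lebesgue_mx k d]_x (g x * rho x)%:E)%E.
Proof.
move=> mg gM gC; have g0 x : 0 <= g x by have /andP[] := gM x.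
pose u (z : config R d * 'M[R]_(k, d)) : R := g z.2.
transitivity (\int[P]_w (\esum_(x in distinct_tuples (Phi w)) (u (Phi w, x))%:E))%E.
  by [].
rewrite palm_campbell; first last.
- exists (mx_cube C); first exact: compact_mx_cube.
  by move=> phi x nK; rewrite /u/=; have [->|/gC] := eqVneq (g x) 0.
- by exists M => z; have /andP[_ gMz] := gM z.2.
- by move=> z; exact: g0.
- by apply: measurableT_comp => //; exact: measurable_snd.
apply: eq_integral => x _; rewrite /u/= integral_cst// EFinM.
by rewrite prob_kernel mule1.
Qed.

End campbell.

(** * Points on the boundary of the balls *)

Section boundary.
Context {R : realType} {d k : nat}.

(** A configuration with points on ever thinner shells below the radius has,
    being locally finite, a point at exactly this distance. *)
Lemma on_boundary_point (s : R) (phi : config R d) (x : 'M[R]_(k, d)) :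
  on_boundary s (phi, x) -> exists y, [/\ points phi y, balls x s y &
    forall i, s <= euclid_dist (row i x) y].
Proof.
move=> bd; apply: contrapT => /forallNP ny.
have /finite_seqP[l lE] := points_locally_finite phi (bounded_balls x s).
have lP y : y \in l -> points phi y /\ balls x s y.
  by move=> yl; have : [set` l] y by []; rewrite -lE.
have [n ln] : exists n : nat, forall y, y \in l -> balls x (s - n.+1%:R^-1) y.
  elim: {lE} l lP => [|y l IH] lP; first by exists 0%N.
  have [y' yl|n ln] := IH; first by apply: lP; rewrite inE yl orbT.
  have [i iy] : exists i, euclid_dist (row i x) y < s.
    apply: contrapT => /forallNP iy; apply: (ny y).
    have [phiy yb] := lP y (mem_head _ _); split => // i.
    by rewrite leNgt; apply/negP/iy.
  pose n' := Num.trunc (s - euclid_dist (row i x) y)^-1.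
  have n'P : n'.+1%:R^-1 <= s - euclid_dist (row i x) y.
    rewrite -[leRHS]invrK lef_pV2 ?posrE ?invr_gt0 ?subr_gt0//.
    by rewrite ltW// truncnS_gt.
  exists (maxn n n') => y'; rewrite inE => /predU1P[->|/ln].
    exists i; rewrite lerBrDl -lerBrDr (le_trans _ n'P)//.
    by rewrite lef_pV2 ?posrE// ler_nat ltnS leq_maxr.
  apply: balls_le; rewrite lerD2l lerN2.
  by rewrite lef_pV2 ?posrE// ler_nat ltnS leq_maxl.
have [y [phiy yb nyb]] := bd n; apply: nyb; apply: ln.
have : [set` l] y by rewrite -lE.
by [].
Qed.

Definition cons_mx (y : 'rV[R]_d) (x : 'M[R]_(k, d)) : 'M[R]_(k.+1, d) :=
  col_mx y x.

Lemma row_cons0 y x : row ord0 (cons_mx y x) = y.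
Proof.
rewrite /cons_mx (_ : ord0 = lshift k (ord0 : 'I_1)); last exact/val_inj.
by rewrite (@rowKu _ 1) row_id.
Qed.

Lemma row_consS y x i : row (lift ord0 i) (cons_mx y x) = row i x.
Proof.
rewrite /cons_mx (_ : lift ord0 i = rshift 1 i); last exact/val_inj.
by rewrite (@rowKd _ 1).
Qed.

Lemma cons_mx_inj y y' x x' : cons_mx y x = cons_mx y' x' -> x = x'.
Proof.
by move=> xx'; apply/row_matrixP => i; rewrite -(row_consS y) xx' row_consS.
Qed.

Lemma distinct_tuples_cons (A : set 'rV[R]_d) y x :
  distinct_tuples A x -> A y -> (forall i, row i x <> y) ->
  distinct_tuples A (cons_mx y x).
Proof.
move=> [Ax xI] Ay xy; split=> [i|i j].
  by case: (unliftP ord0 i) => [i' ->|->]; rewrite ?row_consS ?row_cons0.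
case: (unliftP ord0 i) => [i' ->|->]; case: (unliftP ord0 j) => [j' ->|->] //;
  rewrite ?row_consS ?row_cons0.
- by move=> /xI ->.
- by move=> /xy.
- by move=> /esym/xy.
Qed.

(** A choice of one extension for each tuple is injective. *)
Lemma counting_extend (A : set 'M[R]_(k, d)) (B : set 'M[R]_(k.+1, d)) :
  (forall x, A x -> exists y, B (cons_mx y x)) ->
  (counting A <= counting B :> \bar R)%E.
Proof.
move=> AB; have /choice[f fP] x : exists y, A x -> B (cons_mx y x).
  by have [/AB[y ?]|nAx] := pselect (A x); [exists y|exists 0].
rewrite -(@counting_image _ _ _ A (fun x => cons_mx (f x) x)); last first.
  by move=> x x' _ _; exact: cons_mx_inj.
by apply: counting_le => _ [x Ax <-]; exact: fP.
Qed.

End boundary.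

Section palm_boundary.
Context {dT : measure_display} {T : measurableType dT} {R : realType}.
Context {d k : nat}.
Variables (P : probability T R) (Phi : {mfun T >-> config R d}).
Variables (rho : 'M[R]_(k, d) -> R) (rho' : 'M[R]_(k.+1, d) -> R).
Variable palm : R.-pker 'M[R]_(k, d) ~> config R d.
Hypothesis mrho : measurable_fun setT rho.
Hypothesis rho_ge0 : forall x, 0 <= rho x.
Hypothesis palm_campbell : campbell_formula P Phi rho palm.
Hypothesis rho'P : joint_intensity P Phi rho'.

Lemma alpha_null (N : set 'M[R]_(k.+1, d)) : measurable N ->
  lebesgue_mx k.+1 d N = 0%E -> alpha P Phi N = 0%E.
Proof.
move=> mN N0; have [mrho' rho'0 _ ->//] := rho'P.
apply: null_set_integral => //.
by apply: measurable_funTS; exact/measurable_EFinP.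
Qed.

(** A point of the process at distance exactly s from a point of a tuple extends it
    to a tuple in a Lebesgue null set, which the next joint intensity does not
    charge; the Campbell formula transfers this to the Palm distributions. *)
Lemma palm_on_boundary (s : R) : 0 < s ->
  {ae lebesgue_mx k d, forall x, 0 < rho x ->
    palm x [set phi | on_boundary s (phi, x)] = 0%E}.
Proof.
move=> s0; pose N : set 'M[R]_(k.+1, d) :=
  \bigcup_(i : 'I_k) [set x | euclid_dist (row (lift ord0 i) x) (row ord0 x) = s].
have mN : measurable N.
  apply: fin_bigcup_measurable => // i _.
  have mf := measurable_euclid_dist (@measurable_row R d _ (lift ord0 i))
    (@measurable_row R d k.+1 ord0).
  by rewrite -[X in measurable X]setTI; exact: (mf measurableT _ (measurable_set1 s)).
have alphaN : alpha P Phi N = 0%E.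
  apply: alpha_null => //; apply: measure_negligible => //.
  have := ae_dist_neq (R := R) (d := d) k.+1 (lt0r_neq0 s0).
  by apply: negligibleS => x [i _ /= xs] /(_ (lift ord0 i) ord0).
pose D : set (config R d * 'M[R]_(k, d)) := on_boundary s.
have mD : measurable D by exact: measurable_on_boundary.
pose q x := palm x [set phi | D (phi, x)].
have mq : measurable_fun setT q by exact: measurable_palm_section.
(* The Campbell formula applies to test functions of compact support. *)
have cubes0 (C : nat) : {ae lebesgue_mx k d, forall x,
    ((\1_(mx_cube C%:R) x * rho x)%:E * q x)%E = 0%E}.
  pose u (z : config R d * 'M[R]_(k, d)) : R := \1_(mx_cube C%:R) z.2 * \1_D z.
  have u0 z : 0 <= u z by rewrite mulr_ge0// indicE.
  have mQ : measurable_fun setT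
      (fun x => (\1_(mx_cube C%:R) x * rho x)%:E * q x)%E.
    apply: emeasurable_funM => //; apply/measurable_EFinP.
    by apply: measurable_funM => //; apply: measurable_indic; exact: measurable_mx_cube.
  have Q0 x : (0 <= (\1_(mx_cube C%:R) x * rho x)%:E * q x)%E.
    by rewrite mule_ge0 ?measure_ge0// lee_fin mulr_ge0// indicE.
  suff I0 : (\int[lebesgue_mx k d]_x
      ((\1_(mx_cube C%:R) x * rho x)%:E * q x) <= 0)%E.
    have : (\int[lebesgue_mx k d]_x
        `|(\1_(mx_cube C%:R) x * rho x)%:E * q x| = 0)%E.
      apply/eqP; rewrite eq_le integral_ge0// andbT.
      by under eq_integral do rewrite gee0_abs//.
    move/(ae_eq_integral_abs _ measurableT mQ); apply: filterS => x; exact.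
  rewrite -alphaN.
  apply: (@le_trans _ _ (\int[lebesgue_mx k d]_x
      ((\int[palm x]_phi (u (config_add phi x, x))%:E) * (rho x)%:E))%E).
    apply: ge0_le_lower_integral => // x; rewrite EFinM muleAC.
    apply: lee_wpmul2r; first by rewrite lee_fin.
    apply: (@le_trans _ _ (\int[palm x]_phi (u (phi, x))%:E)%E).
      rewrite /u /= (eq_integral (fun phi => (\1_(mx_cube C%:R) x)%:E *
        (\1_[set phi | D (phi, x)] phi)%:E)%E); last first.
        by move=> phi _; rewrite EFinM.
      have mDx : measurable [set phi | D (phi, x)].
        rewrite -[X in measurable X]setTI.
        have mf := measurable_fun_pair (@measurable_id _ (config R d) setT)
          (@measurable_cst _ _ (config R d) _ setT x).
        exact: (mf measurableT _ mD).
      rewrite ge0_integralZl_EFin//; last first.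
        by apply/measurable_EFinP; exact: measurable_indic.
      by rewrite integral_indic// setIT.
    apply: ge0_le_lower_integral => phi; rewrite lee_fin// ler_wpM2l//.
    rewrite !indicE ler_nat; have [phiD|//] := boolP ((phi, x) \in D).
    rewrite mem_set// => n; have [y [phiy yb nyb]] := set_mem phiD n.
    by exists y; split => //; left.
  rewrite -palm_campbell//; first last.
  - exists (mx_cube C%:R); first exact: compact_mx_cube.
    by move=> phi x nK; rewrite /u/= indicE memNset// mul0r.
  - exists 1 => z; rewrite /u !indicE; case: (_ \in _); case: (_ \in _);
      by rewrite ?mulr1 ?mulr0.
  - apply: measurable_funM; last exact: measurable_indic.
    apply: measurableT_comp; last exact: measurable_snd.
    by apply: measurable_indic; exact: measurable_mx_cube.
  apply: ge0_le_lower_integral => w.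
    by apply: esum_ge0 => x _; rewrite lee_fin.
  pose S := [set x | D (Phi w, x)].
  apply: (@le_trans _ _ (counting (distinct_tuples (Phi w) `&` S))).
    rewrite counting_esum [leRHS]esum_mkcondr; apply: le_esum => x _.
    rewrite /u/= !indicE /S; case: ifPn => xS.
      by rewrite lee_fin; case: (_ \in _); case: (_ \in _); rewrite ?mulr1 ?mulr0.
    rewrite [in X in (X <= _)%E](_ : (_, x) \in D = false) ?mulr0//.
    by apply/negbTE; apply: contraNN xS => /set_mem ?; apply/mem_set.
  apply: counting_extend => x [xdt /on_boundary_point[y [phiy [i iy] yge]]].
  exists y; split.
    apply: distinct_tuples_cons => // j jy.
    by have := yge j; rewrite jy euclid_distxx leNgt s0.
  exists i => //=; rewrite row_consS row_cons0.
  by apply/eqP; rewrite eq_le iy yge.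
have : {ae lebesgue_mx k d, forall x, forall C : nat,
    ((\1_(mx_cube C%:R) x * rho x)%:E * q x)%E = 0%E} by exact: ae_foralln.
apply: filterS => x xC rx0.
have [C _ Cx] : (\bigcup_n mx_box (const_mx (- n%:R)) (const_mx n%:R)) x.
  by rewrite mx_box_cover.
have /eqP := xC C; rewrite indicE mem_set ?mul1r; last first.
  move=> i j; have := Cx i j; rewrite /= !mxE in_itv/= ler_norml.
  by move=> /andP[/ltW -> ->].
by rewrite mule_eq0 eqe gt_eqF//= => /eqP.
Qed.

End palm_boundary.

(** * Observation windows *)

Section windows.
Context {R : realType} {d : nat}.
Hypothesis d_gt0 : (0 < d)%N.

Definition window_side (n : nat) : R := n%:R `^ (d%:R^-1).

Lemma root_exprn (a : R) : 0 <= a -> (a `^ (d%:R^-1)) ^+ d = a.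
Proof.
move=> a0; rewrite -powR_mulrn ?powR_ge0// -powRrM mulVf ?powRr1//.
by rewrite pnatr_eq0 -lt0n.
Qed.

Lemma exprn_root (a : R) : 0 <= a -> (a ^+ d) `^ (d%:R^-1) = a.
Proof.
move=> a0; rewrite -powR_mulrn// -powRrM divff ?powRr1//.
by rewrite pnatr_eq0 -lt0n.
Qed.

Lemma windowE n : (window n : set 'rV[R]_d) =  mx_cube (k := 1) (window_side n / 2).
Proof. by apply/seteqP; split=> x xn => [i|] j; rewrite ?ord1; exact: xn. Qed.

Lemma window_side_ge0 n : 0 <= window_side n.
Proof. exact: powR_ge0. Qed.

Lemma lebesgue_window n : lebesgue_mx 1 d (window n : set 'rV[R]_d) = n%:R%:E.
Proof.
rewrite windowE lebesgue_mx_cube; last by rewrite divr_ge0 ?window_side_ge0.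
by rewrite mulrC divfK// mul1n root_exprn.
Qed.

Lemma cvg_window_side : (fun n => window_side n) @ \oo --> +oo.
Proof.
apply/cvgryPge => A; exists (Num.trunc (`|A| ^+ d)).+1 => // n /= An.
rewrite (le_trans (ler_norm A))// -[leLHS]exprn_root//.
rewrite ge0_ler_powR ?invr_ge0// ?nnegrE ?exprn_ge0//.
by rewrite (le_trans (ltW (truncnS_gt _)))// ler_nat.
Qed.

(** The side of the window tends to infinity, so that a boundary layer of fixed
    width is a vanishing fraction of it. *)
Lemma inner_window_ratio (c : R) : exists2 i_ : nat -> R,
  i_ @ \oo --> (1 : R) & \forall n \near \oo, 0 <= window_side n / 2 - c /\
    lebesgue_mx (R := R) 1 d (mx_cube (window_side n / 2 - c)) = (i_ n * n%:R)%:E.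
Proof.
exists (fun n => (1 - 2 * c * (window_side n)^-1) ^+ d).
  have L0 : (fun n => (window_side n)^-1) @ \oo --> (0 : R).
    apply/gtr0_cvgV0; last exact: cvg_window_side.
    by exists 1%N => // n /= n1; rewrite powR_gt0// ltr0n.
  have lin : (fun n => 1 - 2 * c * (window_side n)^-1) @ \oo --> (1 : R).
    rewrite -[X in _ --> X]subr0 -[X in 1 - X](mulr0 (2 * c)).
    by apply: cvgB; [exact: cvg_cst|exact: cvgMl_tmp].
  have := cvg_comp _ _ lin (@exprn_continuous R d 1).
  by rewrite expr1n.
have /cvgryPge/(_ (2 * `|c| + 1)) := cvg_window_side.
apply: filterS => n Ln; have := ler_norm c => cc.
have L0 : 0 < window_side n by have := normr_ge0 c; lra.
split; first by lra.
rewrite lebesgue_mx_cube; last by lra.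
rewrite mul1n; congr EFin.
rewrite -[X in _ = _ * X](@root_exprn n%:R)// -exprMn; congr (_ ^+ _).
rewrite mulrBl mul1r -/(window_side n) divfK ?gt_eqF//.
by rewrite mulrBr [2 * (_ / 2)]mulrC divfK.
Qed.

Lemma cvg_radius (r : nat -> R) (beta : R) : (forall n, 0 < r n) -> 0 < beta ->
  (fun n => r n ^+ d) @ \oo --> beta -> r @ \oo --> beta `^ (d%:R^-1).
Proof.
move=> r0 b0 rb; rewrite (_ : r = (fun a => expR (d%:R^-1 * ln a)) \o
    (fun n => r n ^+ d)); last first.
  apply/funext => n /=; rewrite -[LHS]exprn_root ?ltW// /powR.
  by rewrite gt_eqF// exprn_gt0.
have -> : beta `^ (d%:R^-1) = expR (d%:R^-1 * ln beta).
  by rewrite /powR gt_eqF.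
apply: cvg_comp rb _; apply: (@cvg_comp _ _ _ (fun a => d%:R^-1 * ln a) expR).
  by apply: cvgMl_tmp; exact: continuous_ln.
exact: continuous_expR.
Qed.

End windows.

Arguments window_side {R} d n.

(** * Averages over the window *)

Section window_average.
Context {R : realType} {d m : nat}.
Hypothesis d_gt0 : (0 < d)%N.
Variables (rho : 'M[R]_(m.+1, d) -> R) (Gam : rel 'I_m.+1).
Hypothesis mrho : measurable_fun setT rho.
Hypothesis rho_ge0 : forall x, 0 <= rho x.
Hypothesis rho_translate : forall t x, rho (translate t x) = rho x.
Hypothesis rho_loc : forall B : set 'M[R]_(m.+1, d), measurable B -> bounded_mx B ->
  (\int[lebesgue_mx m.+1 d]_(x in B) (rho x)%:E < +oo)%E.
Hypothesis Gam_connected : connected_graph Gam.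

Lemma measurable_comp_anchor (f : 'M[R]_(m.+1, d) -> R) :
  measurable_fun setT f -> measurable_fun setT (fun z => f (anchor z)).
Proof. by move=> mf; exact: measurableT_comp mf measurable_anchor. Qed.

(** Translating a tuple with first point in a unit cube averages local
    integrability over the position of this point. *)
Lemma integrable_rho_anchor (C : R) : 0 <= C ->
  (lebesgue_mx m d).-integrable setT
    (fun z => (\1_(mx_cube C) z * rho (anchor z))%:E).
Proof.
move=> C0; pose g z : \bar R := (\1_(mx_cube C) z * rho (anchor z))%:E.
have g0 z : (0 <= g z)%E by rewrite lee_fin mulr_ge0// indicE.
have mg : measurable_fun setT g.
  apply/measurable_EFinP; apply: measurable_funM.
    by apply: measurable_indic; exact: measurable_mx_cube.
  exact: measurable_comp_anchor.
apply/integrableP; split => //.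
rewrite (eq_integral g); last by move=> z _; rewrite gee0_abs// g0.
pose K : set 'M[R]_(m.+1, d) := mx_cube (C + 1).
have mK : measurable K by exact: measurable_mx_cube.
pose f : 'M[R]_(m.+1, d) -> \bar R := (fun x => (rho x)%:E) \_ K.
have : (\int[lebesgue_mx m.+1 d]_x f x < +oo)%E.
  by rewrite -integral_mkcond; exact: rho_loc mK (bounded_mx_cube _).
have f0 x : (0 <= f x)%E by rewrite /f patchE; case: ifP => //; rewrite lee_fin.
have mf : measurable_fun setT f.
  apply/(measurable_restrictT _ mK); apply: measurable_funTS.
  exact/measurable_EFinP.
rewrite (ge0_integral_anchor mf f0).
apply: le_lt_trans.
have m1 : measurable (mx_cube 1 : set 'rV[R]_d) by exact: measurable_mx_cube.
apply: ge0_le_lower_integral => // z.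
rewrite -[leLHS]mule1.
apply: (@le_trans _ _ (g z * lebesgue_mx 1 d (mx_cube 1))%E).
  rewrite lee_wpmul2l// lebesgue_mx_cube// mul1n mulr1 lee_fin exprn_ege1//.
  by rewrite ler1n.
have -> : lebesgue_mx 1 d (mx_cube 1) =
    (\int[lebesgue_mx (R := R) 1 d]_t (\1_(mx_cube 1) t)%:E)%E.
  by rewrite integral_indic// setIT.
rewrite -ge0_integralZl//; last first.
  by apply/measurable_EFinP; exact: measurable_indic.
apply: ge0_le_lower_integral => t; first by rewrite mule_ge0// lee_fin indicE.
rewrite /f patchE rho_translate /g -EFinM !indicE.
have [tC|_] := boolP (t \in _); last by rewrite mulr0; case: ifP => // _; rewrite lee_fin.
have [zC|_] := boolP (z \in _); last by rewrite !mul0r; case: ifP => // _; rewrite lee_fin.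
rewrite mulr1 mul1r ifT//; apply/mem_set => i j.
rewrite translateE (le_trans (ler_normD _ _))// lerD//; last exact: (set_mem tC).
case: (unliftP ord0 i) => [i' ->|->]; first by rewrite anchorSE; exact: (set_mem zC).
by rewrite anchor0E normr0.
Qed.

Variables (r : nat -> R) (s : R).
Hypothesis r_gt0 : forall n, 0 < r n.
Hypothesis s_gt0 : 0 < s.
Hypothesis r_cvg : r @ \oo --> s.

(** Closed and open conditions on finitely many distances are eventually constant
    when no distance equals the limit radius. *)
Lemma h_graph_cvg k (G : rel 'I_k) (x : 'M[R]_(k, d)) :
  (forall i j, euclid_dist (row i x) (row j x) <> s) ->
  \forall n \near \oo, h_graph G (r n) x = h_graph G s x.
Proof.
move=> xs.
have : \forall n \near \oo, forall i j,
    (euclid_dist (row i x) (row j x) <= r n) = (euclid_dist (row i x) (row j x) <= s).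
  apply: filter_forall => i; apply: filter_forall => j.
  have [ijs|ijs] := leP (euclid_dist (row i x) (row j x)) s.
    have {}ijs : euclid_dist (row i x) (row j x) < s.
      by rewrite lt_neqAle ijs andbT; apply/eqP.
    by apply: filterS (cvgr_ge _ r_cvg _ ijs) => n ->.
  by apply: filterS (cvgr_lt _ r_cvg _ ijs) => n rn; apply/negbTE; rewrite -ltNge.
apply: filterS => n rn; apply: h_graph_ext => // i j _.
by rewrite rn.
Qed.

Definition in_window n (x : 'M[R]_(m.+1, d)) : R :=
  \1_(mx_cube (window_side d n / 2)) x.

Variables (F Q : nat -> 'M[R]_(m.+1, d) -> R) (q : 'M[R]_(m.+1, d) -> R).
Hypothesis mF : forall n, measurable_fun setT (F n).
Hypothesis F01 : forall n x, 0 <= F n x <= 1.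
Hypothesis Q01 : forall n x, 0 <= Q n x <= 1.
Hypothesis mq : measurable_fun setT q.
Hypothesis F_inner : forall n t x,
  (forall i j, `|translate t x i j| + r n <= window_side d n / 2) ->
  F n (translate t x) = Q n x.
Hypothesis Q_cvg : {ae lebesgue_mx m d, forall z, 0 < rho (anchor z) ->
  (fun n => Q n (anchor z)) @ \oo --> q (anchor z)}.

(** The volume of the positions of the first point for which a tuple of shape z lies
    in the window, weighted by F *)
Let occ n z : \bar R := (\int[lebesgue_mx (R := R) 1 d]_t
  (in_window n (translate t (anchor z)) * F n (translate t (anchor z)))%:E)%E.

Let measurable_in_window n : measurable_fun setT (in_window n).
Proof. by apply: measurable_indic; exact: measurable_mx_cube. Qed.

Let measurable_occ_integrand n z : measurable_fun setT (fun t : 'rV[R]_d =>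
  (in_window n (translate t (anchor z)) * F n (translate t (anchor z)))%:E).
Proof.
have ma : measurable_fun setT (fun t : 'rV[R]_d => translate t (anchor z)).
  apply: (measurableT_comp (f := @anchor_at R m d) (g := fun t => (t, z))).
    exact: measurable_anchor_at.
  exact: measurable_pair2.
by apply/measurable_EFinP; apply: measurable_funM; exact: measurableT_comp ma.
Qed.

Let occ_integrand_ge0 n x : 0 <= in_window n x * F n x.
Proof. by rewrite mulr_ge0//; have /andP[] := F01 n x. Qed.

Let occ_ge0 n z : (0 <= occ n z)%E.
Proof. by apply: integral_ge0 => t _; rewrite lee_fin. Qed.

Let mwindow n : measurable (window n : set 'rV[R]_d).
Proof. by rewrite windowE; exact: measurable_mx_cube. Qed.

Let window_row n t z : in_window n (translate t (anchor z)) != 0 ->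
  (window n : set 'rV[R]_d) t.
Proof.
rewrite /in_window indicE pnatr_eq0 eqb0 negbK => /set_mem tz j.
by have := tz ord0 j; rewrite translateE anchor0E add0r.
Qed.

Let occ_le n z : (occ n z * (n%:R^-1)%:E <= 1)%E.
Proof.
have : (occ n z <= n%:R%:E)%E.
  have -> : (n%:R%:E : \bar R) =
      (\int[lebesgue_mx (R := R) 1 d]_t (\1_(window n) t)%:E)%E.
    by rewrite integral_indic// setIT; exact/esym/lebesgue_window.
  apply: ge0_le_lower_integral => t; rewrite lee_fin//.
  have [->|tz] := eqVneq (in_window n (translate t (anchor z))) 0.
    by rewrite mul0r indicE.
  rewrite indicE (mem_set (window_row tz)).
  have /andP[F0 F1] := F01 n (translate t (anchor z)).
  by rewrite /in_window indicE; case: (_ \in _); rewrite ?mul1r ?mul0r.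
have nV : (0 <= (n%:R^-1 : R)%:E)%E by rewrite lee_fin invr_ge0.
move=> /(fun h => lee_wpmul2r nV h)/le_trans; apply.
rewrite -EFinM lee_fin; case: (n) => [|n']; first by rewrite mul0r.
by rewrite divff.
Qed.

(** In the inner window F agrees with Q, and the boundary layer has measure of
    smaller order than the window. *)
Let occ_cvg z : (fun n => Q n (anchor z)) @ \oo --> q (anchor z) ->
  (fun n => occ n z * (n%:R^-1)%:E)%E @ \oo --> (q (anchor z))%:E.
Proof.
move=> Qq.
have [c cz] : exists c, forall i j, `|anchor z i j| <= c.
  exists (\sum_i \sum_j `|anchor z i j|) => i j.
  rewrite (bigD1 i)//= (bigD1 j)//= -addrA lerDl addr_ge0 ?sumr_ge0// => i' _.
  exact: sumr_ge0.
have [i_ i1 iE] := inner_window_ratio d_gt0 (c + (s + 1)).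
have rs : \forall n \near \oo, r n <= s + 1.
  by apply: (cvgr_le _ r_cvg); rewrite ltrDl.
apply: (@squeeze_cvge _ _ _ _ (fun n => (Q n (anchor z) * i_ n)%:E) _
  (fun n => (Q n (anchor z) * i_ n + (1 - i_ n))%:E)).
- near=> n.
  have n0 : (0 < n)%N by near: n; exists 1%N.
  have [L0 iL] : 0 <= window_side d n / 2 - (c + (s + 1)) /\
      lebesgue_mx (R := R) 1 d (mx_cube (window_side d n / 2 - (c + (s + 1)))) =
      (i_ n * n%:R)%:E by near: n.
  have rn : r n <= s + 1 by near: n.
  pose I : set 'rV[R]_d := mx_cube (window_side d n / 2 - (c + (s + 1))).
  have mI : measurable I by exact: measurable_mx_cube.
  have tzc t i j : I t -> `|translate t (anchor z) i j| + r n <= window_side d n / 2.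
    move=> /(_ 0 j) tI; rewrite translateE.
    have := ler_normD (anchor z i j) (t 0 j).
    by have := cz i j; lra.
  have Iin t : I t -> in_window n (translate t (anchor z)) = 1.
    move=> tI; rewrite /in_window indicE mem_set// => i j.
    by have := tzc t i j tI; have := r_gt0 n; lra.
  have IF t : I t -> F n (translate t (anchor z)) = Q n (anchor z).
    by move=> tI; apply: F_inner => i j; exact: tzc.
  have Iw : I `<=` window n.
    by move=> t /Iin tI; apply: (window_row (z := z)); rewrite tI oner_eq0.
  have nV : (0 <= (n%:R^-1 : R)%:E)%E by rewrite lee_fin invr_ge0.
  have /andP[Q0 Q1] := Q01 n (anchor z).
  have in1 : (i_ n * n%:R / n%:R) = i_ n by rewrite mulfK// pnatr_eq0 -lt0n.
  have intI (D : set 'rV[R]_d) (a : R) : 0 <= a -> measurable D ->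
      (\int[lebesgue_mx (R := R) 1 d]_t (a * \1_D t)%:E = a%:E * lebesgue_mx 1 d D)%E.
    move=> a0 mD; under eq_integral do rewrite EFinM.
    rewrite ge0_integralZl_EFin//; first by rewrite integral_indic// setIT.
    by apply/measurable_EFinP; exact: measurable_indic.
  apply/andP; split.
    have -> : (Q n (anchor z) * i_ n)%:E =
        ((Q n (anchor z))%:E * (i_ n * n%:R)%:E * (n%:R^-1)%:E)%E.
      by rewrite -!EFinM -!mulrA mulfV ?mulr1// pnatr_eq0 -lt0n.
    apply: lee_wpmul2r => //; rewrite -iL -intI//.
    apply: ge0_le_lower_integral => t; first by rewrite lee_fin mulr_ge0// indicE.
    rewrite lee_fin indicE; have [tI|_] := boolP (t \in I); last by rewrite mulr0.
    by rewrite Iin ?IF ?mulr1 ?mul1r//; exact: set_mem.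
  have -> : (Q n (anchor z) * i_ n + (1 - i_ n))%:E =
     (((Q n (anchor z))%:E * (i_ n * n%:R)%:E + (n%:R - i_ n * n%:R)%:E) * (n%:R^-1)%:E)%E.
    transitivity (((Q n (anchor z) * (i_ n * n%:R) + (n%:R - i_ n * n%:R)) * n%:R^-1)%:E).
      congr EFin; field.
      by rewrite pnatr_eq0 -lt0n.
    by [].
  apply: lee_wpmul2r => //; rewrite -iL -intI//.
  have -> : (n%:R - i_ n * n%:R)%:E = (1%:E * lebesgue_mx (R := R) 1 d (window n `\` I))%E.
    have wfin : (lebesgue_mx 1 d (window n : set 'rV[R]_d) < +oo)%E.
      by rewrite (lebesgue_window d_gt0 n) ltry.
    rewrite mul1e EFinD EFinN -iL -(lebesgue_window d_gt0 n).
    have := measureD (mwindow n) mI wfin.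
    by rewrite [window n `&` I]setIidr.
  rewrite -intI//; last exact: measurableD.
  rewrite -ge0_integralD//.
  - apply: ge0_le_lower_integral => t; first by rewrite lee_fin.
    rewrite -EFinD lee_fin !indicE in_setD.
    have [tI|tI] := boolP (t \in I); first last.
      rewrite /= andbT mulr0 add0r mul1r.
      have [->|tz] := eqVneq (in_window n (translate t (anchor z))) 0; first by rewrite mul0r.
      rewrite (mem_set (window_row tz)).
      have /andP[F0 F1] := F01 n (translate t (anchor z)).
      by rewrite /in_window indicE; case: (_ \in _); rewrite ?mul1r ?mul0r.
    by rewrite Iin ?IF ?andbF ?mulr0 ?addr0 ?mulr1 ?mul1r//; exact: set_mem.
  - by move=> t _; rewrite lee_fin mulr_ge0// indicE.
  - by apply/measurable_EFinP; apply: measurable_funM => //; exact: measurable_indic.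
  - apply/measurable_EFinP; apply: measurable_funM => //; apply: measurable_indic.
    exact: measurableD.
- apply: cvg_EFin; first by near=> n.
  rewrite -[X in _ --> X]mulr1; exact: cvgM.
- apply: cvg_EFin; first by near=> n.
  rewrite (_ : q (anchor z) = q (anchor z) * 1 + (1 - 1)); last first.
    by rewrite mulr1 subrr addr0.
  apply: cvgD; first exact: cvgM.
  by apply: cvgB => //; exact: cvg_cst.
Unshelve. all: by end_near. Qed.

Let ae_dist_anchor : {ae lebesgue_mx m d, forall z : 'M[R]_(m, d), forall i j,
  euclid_dist (row i (anchor z)) (row j (anchor z)) <> s}.
Proof.
apply: (ae_anchor (Q := fun x => forall i j, euclid_dist (row i x) (row j x) <> s)).
  by move=> t x xs i j; have := xs i j; rewrite !row_translate euclid_dist_translate.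
exact: ae_dist_neq (lt0r_neq0 s_gt0).
Qed.

Let weight n x : R := in_window n x * h_graph Gam (r n) x * rho x * F n x.

(** Fubini separates the position of the first point from the shape of the tuple;
    the positions fill the window up to its boundary layer, and the joint
    intensity is the same for all radii, so that its local integrability suffices
    for dominated convergence. Away from the boundary of
    the window the factor F, which may depend on the window, has to agree with a
    function Q of the shape. *)
Lemma window_average_cvg :
  (fun n => (\int[lebesgue_mx m.+1 d]_x (weight n x)%:E) * (n%:R^-1)%:E)%E @ \oo -->
  (\int[lebesgue_mx m d]_z
    (h_graph Gam s (anchor z) * rho (anchor z) * q (anchor z))%:E)%E.
Proof.
have weight0 n x : 0 <= weight n x.
  rewrite /weight !mulr_ge0 ?h_graph_ge0//.
  by have /andP[] := F01 n x.
have weightE0 n x : (0 <= (weight n x)%:E)%E by rewrite lee_fin.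
have mweight n : measurable_fun setT (fun x => (weight n x)%:E).
  apply/measurable_EFinP; do !apply: measurable_funM => //.
  exact: measurable_h_graph.
pose c n z : R := h_graph Gam (r n) (anchor z) * rho (anchor z).
have c0 n z : 0 <= c n z by rewrite mulr_ge0// h_graph_ge0.
have innerE n z : (\int[lebesgue_mx (R := R) 1 d]_t
    (weight n (translate t (anchor z)))%:E = (c n z)%:E * occ n z)%E.
  rewrite -ge0_integralZl_EFin//; last by move=> t _; rewrite lee_fin.
  apply: eq_integral => t _; rewrite -EFinM /weight /c.
  by rewrite h_graph_translate rho_translate; congr EFin; ring.
pose f n z : \bar R := ((c n z)%:E * (occ n z * (n%:R^-1)%:E))%E.
have fE n : ((\int[lebesgue_mx m.+1 d]_x (weight n x)%:E) * (n%:R^-1)%:E =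
    \int[lebesgue_mx m d]_z f n z)%E.
  rewrite ge0_integral_anchor//.
  have nV : (0 <= (n%:R^-1 : R)%:E)%E by rewrite lee_fin invr_ge0.
  have mI : measurable_fun setT (fun z => \int[lebesgue_mx (R := R) 1 d]_t
      (weight n (translate t (anchor z)))%:E)%E.
    exact: (measurable_integral_anchor (mweight n) (weightE0 n)).
  rewrite -ge0_integralZr//; last first.
    by move=> z _; apply: integral_ge0 => t _; rewrite lee_fin.
  by apply: eq_integral => z _; rewrite innerE /f muleA.
have mf n : measurable_fun setT (f n).
  rewrite (_ : f n = (fun z => (\int[lebesgue_mx (R := R) 1 d]_t
      (weight n (translate t (anchor z)))%:E) * (n%:R^-1)%:E))%E; last first.
    by apply/funext => z; rewrite innerE /f muleA.
  apply: emeasurable_funM; last exact: measurable_cst.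
  exact: (measurable_integral_anchor (mweight n) (weightE0 n)).
have [rM rMP] : exists rM, forall n, r n <= rM.
  have [M [_ MP]] := cvg_seq_bounded (cvgP _ r_cvg).
  exists (M + 1) => n; have := MP (M + 1); rewrite ltrDl ltr01 => /(_ isT n I).
  by move=> /=; apply: le_trans; exact: ler_norm.
have rM0 : 0 <= rM by rewrite (le_trans (ltW (r_gt0 0%N))).
pose C := rM * m%:R.
have C0 : 0 <= C by rewrite mulr_ge0.
pose g z : \bar R := (\1_(mx_cube C) z * rho (anchor z))%:E.
under eq_fun do rewrite fE.
suff [mlim flim fg] : [/\ measurable_fun setT (fun z =>
      (h_graph Gam s (anchor z) * rho (anchor z) * q (anchor z))%:E),
    {ae lebesgue_mx m d, forall z, setT z -> f ^~ z @ \oo -->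
      (h_graph Gam s (anchor z) * rho (anchor z) * q (anchor z))%:E} &
    {ae lebesgue_mx m d, forall z n, setT z -> (`|f n z| <= g z)%E}].
  by have [] := dominated_convergence measurableT mf mlim flim
    (integrable_rho_anchor C0) fg.
split.
- apply/measurable_EFinP; apply: measurable_funM; last exact: measurable_comp_anchor.
  apply: measurable_funM; last exact: measurable_comp_anchor.
  by apply: measurable_comp_anchor; exact: measurable_h_graph.
- apply: filterS2 Q_cvg ae_dist_anchor => z Qz dz _.
  have [rz0|rz0] := eqVneq (rho (anchor z)) 0.
    rewrite rz0 mulr0 mul0r (_ : (fun _ => _) = cst 0%E); first exact: cvg_cst.
    by apply/funext => n /=; rewrite /f /c rz0 mulr0 mul0e.
  have {}Qz := Qz _; rewrite EFinM.
  apply: (@cvg_trans _ ((fun n => (h_graph Gam s (anchor z) * rho (anchor z))%:E *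
      (occ n z * (n%:R^-1)%:E))%E @ \oo)).
    apply: near_eq_cvg; have := h_graph_cvg Gam dz.
    by apply: filterS => n hn; rewrite /f /c hn.
  apply: cvgeZl => //; apply: occ_cvg; apply: Qz.
  by rewrite lt0r rz0 rho_ge0.
- apply: aeW => z n _; rewrite gee0_abs; last first.
    by rewrite mule_ge0 ?lee_fin// mule_ge0// lee_fin invr_ge0.
  apply: (@le_trans _ _ (c n z)%:E).
    by rewrite -[leRHS]mule1; apply: lee_wpmul2l; rewrite ?lee_fin.
  rewrite lee_fin /c; have [->|hz] := eqVneq (h_graph Gam (r n) (anchor z)) 0.
    by rewrite mul0r mulr_ge0// indicE.
  rewrite (h_graph_neq0 hz) indicE mem_set// => i j.
  have := h_graph_diam (lift ord0 i) ord0 Gam_connected hz (ltW (r_gt0 n)).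
  move=> /(le_trans (coord_le_euclid_dist _ _ j)).
  rewrite row_anchor0 row_anchorS !mxE subr0 => /le_trans; apply.
  by rewrite ler_wpM2r.
Qed.

End window_average.

(** * Continuity and invariance of void probabilities *)

Section void_probabilities.
Context {R : realType} {d k : nat}.
Implicit Types (phi : config R d) (x : 'M[R]_(k, d)) (t : 'rV[R]_d).

Lemma npoints_eq0P (A : set 'rV[R]_d) (B : set 'rV[R]_d) :
  npoints A B = 0%E <-> forall y, A y -> ~ B y.
Proof.
rewrite npoints_eq0; split=> [AB0 y Ay By|AB].
  by have : (A `&` B) y by []; rewrite AB0.
by apply/seteqP; split=> y //= -[Ay By]; exact: (AB y).
Qed.

Lemma void_translate t phi x W r :
  (balls (translate t x) r `<=` W) ->
  npoints (config_translate t phi) (W `&` balls (translate t x) r) = 0%E <->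
  npoints phi (setT `&` balls x r) = 0%E.
Proof.
move=> BW; rewrite !npoints_eq0P; split=> void y.
  move=> phiy [_ xy]; apply: (void (translate t y)); first by exists y.
  by split; [apply: BW|]; exact/balls_translate.
move=> [y' phiy' <-] [_ xy]; apply: (void y') => //; split => //.
by apply/(balls_translate t); exact: xy.
Qed.

Lemma on_boundary_translate s t phi x :
  on_boundary s (config_translate t phi, translate t x) <->
  on_boundary s (phi, x).
Proof.
split=> bd n; have [y [/= phiy yb nyb]] := bd n.
  case: phiy => y' phiy' yy'; exists y'; split => //=.
    by apply/(balls_translate t); rewrite yy'; exact: yb.
  by move=> yb'; apply: nyb; rewrite -yy'; apply/balls_translate.
exists (translate t y); split => /=; first by exists y.
  exact/balls_translate.
by move/balls_translate.
Qed.

(** By local finiteness no point enters the balls when the radius exceeds s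
    slightly, and off the boundary none leaves when it decreases slightly. *)
Lemma void_cvg (r : nat -> R) (s : R) phi x : r @ \oo --> s ->
  ~ on_boundary s (phi, x) ->
  \forall n \near \oo, (npoints phi (setT `&` balls x (r n)) = 0%E <->
                        npoints phi (setT `&` balls x s) = 0%E).
Proof.
move=> rs /existsNP[n0 /forallNP nb].
have [e e0 xe] := balls_enlarge phi x s.
near=> n; rewrite !npoints_eq0P; split=> void y phiy [_ yb].
  apply: (void y phiy); split => //; apply: contrapT => nyb.
  apply: (nb y); split => //= yb'; apply: nyb; apply: balls_le yb'.
  near: n; apply: (cvgr_ge _ rs); by rewrite gtrBl.
apply: (void y phiy); split => //; apply: xe; split => //; apply: balls_le yb.
by near: n; apply: (cvgr_le _ rs); rewrite ltrDl.
Unshelve. all: by end_near. Qed.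

Variable palm : R.-pker 'M[R]_(k, d) ~> config R d.

Lemma void_prob_fin W r x : measurable W -> void_prob palm W r x \is a fin_num.
Proof.
move=> mW; rewrite ge0_fin_numE ?void_prob_ge0//.
by rewrite (le_lt_trans (palm_le1 _ _ _)) ?ltry//; exact: measurable_void_set.
Qed.

Lemma fine_void_prob01 W r x : measurable W ->
  0 <= fine (void_prob palm W r x) <= 1.
Proof.
move=> mW; rewrite fine_ge0 ?void_prob_ge0//= -lee_fin fineK ?void_prob_fin//.
by apply: palm_le1; exact: measurable_void_set.
Qed.

Lemma measurable_fine_void_prob W r : measurable W ->
  measurable_fun setT (fun x => fine (void_prob palm W r x)).
Proof. by move=> mW; apply: measurableT_comp => //; exact: measurable_void_prob. Qed.

Lemma void_prob_cvg (r : nat -> R) (s : R) x : r @ \oo --> s ->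
  palm x [set phi | on_boundary s (phi, x)] = 0%E ->
  (fun n => fine (void_prob palm setT (r n) x)) @ \oo -->
  fine (void_prob palm setT s x).
Proof.
move=> rs px0.
pose V (a : R) := [set phi : config R d | npoints phi (setT `&` balls x a) = 0%E].
have mV a : measurable (V a) by exact: measurable_void_set.
have VE a : (\int[palm x]_phi (\1_(V a) phi : R)%:E)%E = void_prob palm setT a x.
  by rewrite integral_indic// setIT.
have mI a : measurable_fun setT (fun phi => (\1_(V a) phi : R)%:E).
  by apply/measurable_EFinP; exact: measurable_indic.
have Vcvg : {ae palm x, forall phi, setT phi ->
    (fun n => (\1_(V (r n)) phi : R)%:E) @ \oo --> (\1_(V s) phi : R)%:E}.
  exists [set phi | on_boundary s (phi, x)]; split => //.
    have mf := measurable_fun_pair (@measurable_id _ (config R d) setT)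
      (@measurable_cst _ _ (config R d) _ setT x).
    rewrite -[X in measurable X]setTI.
    exact: (mf measurableT _ (measurable_on_boundary s)).
  move=> phi /= ncvg; apply: contrapT => nbd; apply: ncvg => _.
  have near_eq : \forall n \near \oo, (\1_(V (r n)) phi : R)%:E = (\1_(V s) phi : R)%:E :> \bar R.
    apply: filterS (void_cvg rs nbd) => n nE; rewrite !indicE; congr (_%:R%:E).
    congr nat_of_bool; apply/idP/idP => /set_mem Vphi; apply/mem_set; exact/nE.
  exact: cvg_near_cst near_eq.
have i1 : (palm x).-integrable setT (cst 1%E).
  apply/integrableP; split => //.
  under eq_integral do rewrite /= normr1.
  by rewrite integral_cst// mul1e prob_kernel ltry.
have dom : {ae palm x, forall phi (n : nat), setT phi ->
    (`|(\1_(V (r n)) phi : R)%:E| <= cst 1 phi)%E}.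
  by apply: aeW => phi n _; rewrite /= lee_fin indicE; case: (_ \in _); rewrite ?normr1 ?normr0.
have [_ _] := dominated_convergence measurableT (fun n => mI (r n)) (mI s) Vcvg i1 dom.
under eq_fun do rewrite VE; rewrite VE => vcvg.
apply: fine_cvg; rewrite fineK; first exact: vcvg.
exact: void_prob_fin.
Qed.

Hypothesis palm_translate : forall t x (A : set (config R d)), measurable A ->
  palm (translate t x) A = palm x [set phi | A (config_translate t phi)].

(** Balls inside the window contain the same points as in the whole space, and the
    Palm distributions are covariant under translations. *)
Lemma void_prob_translate W t r x : measurable W ->
  balls (translate t x) r `<=` W ->
  void_prob palm W r (translate t x) = void_prob palm setT r x.
Proof.
move=> mW BW; rewrite /void_prob palm_translate; last exact: measurable_void_set.
by congr (palm x _); apply/seteqP; split=> phi /= /(void_translate phi BW).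
Qed.

End void_probabilities.

(** * The two limits *)

Section limit_functionals.
Context {R : realType} {d m : nat}.
Variables (beta : R) (rho : 'M[R]_(m.+1, d) -> R) (Gam : rel 'I_m.+1).
Hypothesis d_gt0 : (0 < d)%N.
Hypothesis beta_gt0 : 0 < beta.
Hypothesis mrho : measurable_fun setT rho.
Hypothesis rho_ge0 : forall x, 0 <= rho x.
Hypothesis Gam_connected : connected_graph Gam.

Let s := beta `^ (d%:R^-1).
Let s_gt0 : 0 < s. Proof. exact: powR_gt0. Qed.

Lemma integral_shape_scale (q : 'M[R]_(m.+1, d) -> R) :
  measurable_fun setT q -> (forall x, 0 <= q x) ->
  (\int[lebesgue_mx m d]_z (h_graph Gam s (anchor z) * rho (anchor z) * q (anchor z))%:E =
   (beta ^+ m)%:E * \int[lebesgue_mx m d]_y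
     (h_graph Gam 1 (anchor y) * rho (s *: anchor y) * q (s *: anchor y))%:E)%E.
Proof.
move=> mq q0; rewrite (ge0_integral_scale s_gt0); first last.
- by move=> z; rewrite lee_fin !mulr_ge0// h_graph_ge0.
- apply/measurable_EFinP; apply: measurable_funM; last exact: measurable_comp_anchor.
  apply: measurable_funM; last exact: measurable_comp_anchor.
  by apply: measurable_comp_anchor; exact: measurable_h_graph.
rewrite mulnC exprM root_exprn ?ltW//; congr (_ * _)%E.
apply: eq_integral => y _; rewrite anchorZ.
by rewrite -[X in h_graph Gam X _]mulr1 h_graph_scale.
Qed.

End limit_functionals.

Section single_vertex.
Context {R : realType} {d : nat}.
Variable Gam : rel 'I_1.
Hypothesis Gam_connected : connected_graph Gam.

Lemma h_graph_single (r : R) (x : 'M[R]_(1, d)) : h_graph Gam r x = 1.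
Proof.
have [_ Girr _] := Gam_connected.
rewrite h_graphE; case: asboolP => // -[]; split=> [i j _|]; first by rewrite !ord1.
exists [ffun i => i]; split=> [i j _|i j]; first by rewrite !ord1.
by rewrite !ord1 Girr; split=> // -[].
Qed.

Lemma anchor_single (z : 'M[R]_(0, d)) : anchor z = 0.
Proof.
by apply/matrixP => i j; rewrite (ord1 i) anchor0E mxE.
Qed.

Lemma integral_single (a : R) : 
  (\int[lebesgue_mx 0 d]_(z in [set: 'M[R]_(0, d)]) a%:E = a%:E)%E.
Proof.
have T1 : lebesgue_mx 0 d [set: 'M[R]_(0, d)] = 1%E.
  rewrite (_ : setT = mx_cube 0); first by rewrite lebesgue_mx_cube.
  by apply/seteqP; split=> x _ // -[].
rewrite integral_cst//; transitivity (a%:E * 1)%E; last by rewrite mule1.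
by congr (_ * _)%E; exact: T1.
Qed.

(** Translation invariance makes the intensity constant, and the unit cube fixes
    its value. *)
Lemma rho_single dT (T : measurableType dT) (P : probability T R)
    (Phi : {mfun T >-> config R d}) (rho : 'M[R]_(1, d) -> R) :
  unit_intensity P Phi -> joint_intensity P Phi rho ->
  (forall t x, rho (translate t x) = rho x) -> forall x, rho x = 1.
Proof.
move=> Phi1 [mrho rho0 _ rhoE] rho_tr x.
have rhox y : rho y = rho x.
  have E (z : 'M[R]_(1, d)) : z = translate z 0.
    by apply/matrixP => i j; rewrite !mxE add0r ord1.
  by rewrite (E y) rho_tr (E x) rho_tr.
pose B : set 'M[R]_(1, d) := mx_cube 2^-1.
have mB : measurable B by exact: measurable_mx_cube.
have B1 : lebesgue_mx 1 d B = 1%E.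
  by rewrite lebesgue_mx_cube ?invr_ge0// divff// expr1n.
have := rhoE B mB; rewrite Phi1// B1.
under eq_integral do rewrite rhox.
rewrite integral_cst// => h.
have := etrans h (congr1 (mule (rho x)%:E) B1).
by rewrite mule1 => -[].
Qed.

End single_vertex.

Section thermodynamic_limits.
Context {R : realType} {dT : measure_display} {T : measurableType dT}.
Variables (P : probability T R) (d m : nat) (Phi : {mfun T >-> config R d}).
Variable rho : 'M[R]_(m.+1, d) -> R.
Variables (palm : R.-pker 'M[R]_(m.+1, d) ~> config R d).
Variables (Gam : rel 'I_m.+1) (r : nat -> R) (beta : R).
Hypothesis d_gt0 : (0 < d)%N.
Hypothesis Phi_unit : unit_intensity P Phi.
Hypothesis rhoP : joint_intensity P Phi rho.
Hypothesis rho_translate : forall (t : 'rV[R]_d) (x : 'M[R]_(m.+1, d)),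
  rho (translate t x) = rho x.
Hypothesis palmE : reduced_palm P Phi rho palm.
Hypothesis Gam_connected : connected_graph Gam.
Hypothesis r_gt0 : forall n : nat, 0 < r n.
Hypothesis beta_gt0 : 0 < beta.
Hypothesis r_cvg : (fun n : nat => r n ^+ d) @ \oo --> beta.

Let s := beta `^ (d%:R^-1).
Let s_gt0 : 0 < s. Proof. exact: powR_gt0. Qed.
Let rs : r @ \oo --> s. Proof. exact: cvg_radius. Qed.
Let mrho : measurable_fun setT rho. Proof. by have [] := rhoP. Qed.
Let rho_ge0 x : 0 <= rho x. Proof. by have [] := rhoP. Qed.
Let rho_loc (B : set 'M[R]_(m.+1, d)) : measurable B -> bounded_mx B ->
  (\int[lebesgue_mx m.+1 d]_(x in B) (rho x)%:E < +oo)%E.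
Proof. by move=> mB bB; have [_ _ fin <-//] := rhoP; exact: fin. Qed.

(** One formula covers all numbers of vertices, the integral over no further
    points being evaluation at the origin. For more points it differs from the
    definition by the substitution of s times the shape, whose Jacobian is the
    power of beta there. *)
Lemma mu_limE : mu_lim beta rho Gam =
  ((m.+1)`!%:R^-1%:E * \int[lebesgue_mx m d]_z
    (h_graph Gam s (anchor z) * rho (anchor z) * 1)%:E)%E.
Proof.
rewrite (integral_shape_scale Gam d_gt0 beta_gt0 mrho rho_ge0 (q := cst 1))//.
rewrite muleA -EFinM mulrC /mu_lim; case: ifPn => [/eqP m0|_]; last first.
  by congr (_ * _)%E; apply: eq_integral => y _; rewrite mulr1.
clear rs s_gt0 rho_loc palmE; subst m.
rewrite (eq_integral (cst 1%:E)); last first.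
  move=> z _; rewrite h_graph_single// (rho_single Phi_unit rhoP)//.
  by rewrite !mul1r.
by rewrite integral_single expr0 invr1 !mul1r mule1.
Qed.

Lemma gamma_limE : gamma_lim beta rho palm Gam =
  ((m.+1)`!%:R^-1%:E * \int[lebesgue_mx m d]_z
    (h_graph Gam s (anchor z) * rho (anchor z) *
     fine (void_prob palm setT s (anchor z)))%:E)%E.
Proof.
have void01 x : 0 <= fine (void_prob palm setT s x) by rewrite fine_ge0// void_prob_ge0.
rewrite (integral_shape_scale Gam d_gt0 beta_gt0 mrho rho_ge0
  (q := fun x => fine (void_prob palm setT s x)))//; last first.
  exact: measurable_fine_void_prob.
have voidE x : palm x [set phi | npoints phi (balls x s) = 0%E] =
    (fine (void_prob palm setT s x))%:E.
  rewrite fineK ?void_prob_fin// /void_prob; congr (palm x _).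
  by apply/seteqP; split=> phi /=; rewrite setTI.
rewrite muleA -EFinM mulrC /gamma_lim; case: ifPn => [/eqP m0|_]; last first.
  by congr (_ * _)%E; apply: eq_integral => y _; rewrite -/s voidE EFinM.
rewrite -/s voidE.
clear rho_loc palmE; subst m.
rewrite (eq_integral (cst (fine (void_prob palm setT s 0))%:E)); last first.
  move=> z _; rewrite h_graph_single// (rho_single Phi_unit rhoP)//.
  by rewrite !mul1r anchor_single scaler0.
by rewrite integral_single expr0 invr1 !mul1r mul1e.
Qed.

Let wt n (F : 'M[R]_(m.+1, d) -> R) x : R :=
  in_window n x * h_graph Gam (r n) x * rho x * F x.

Let g n (x : 'M[R]_(m.+1, d)) : R := (m.+1)`!%:R^-1 * (in_window n x * h_graph Gam (r n) x).

Let mg n : measurable_fun setT (g n).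
Proof.
apply: measurable_funM => //; apply: measurable_funM; last exact: measurable_h_graph.
by apply: measurable_indic; exact: measurable_mx_cube.
Qed.

Let g01 n x : 0 <= g n x <= 1.
Proof.
have w01 : 0 <= in_window n x * h_graph Gam (r n) x <= 1.
  rewrite mulr_ge0 ?h_graph_ge0 ?mulr_ile1 ?h_graph_ge0 ?h_graph_le1//;
    by rewrite /in_window indicE; case: (_ \in _).
have /andP[w0 w1] := w01; rewrite /g mulr_ge0 ?invr_ge0//= mulr_ile1 ?invr_ge0//.
by rewrite invf_le1 ?ler1n ?fact_gt0// ltr0n fact_gt0.
Qed.

Let g_cube n x : g n x != 0 -> mx_cube (window_side d n / 2) x.
Proof.
rewrite /g /in_window indicE; case: (boolP (x \in _)) => [/set_mem//|_].
by rewrite mul0r mulr0 eqxx.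
Qed.

Let g_distinct n x : g n x != 0 ->
  injective (fun i => row i x) /\ forall i, (window n : set 'rV[R]_d) (row i x).
Proof.
move=> gx; split; last by move=> i j; have := g_cube gx i j; rewrite mxE.
apply: (@h_graph_inj _ _ _ Gam (r n)); apply: contraNN gx => /eqP h0.
by rewrite /g h0 !mulr0.
Qed.

Let distinct_window n (A : set 'rV[R]_d) :
  distinct_tuples (k := m.+1) (A `&` window n) =
  distinct_tuples A `&` mx_cube (window_side d n / 2).
Proof.
apply/seteqP; split=> x.
  move=> [xA xI]; split; first by split => // i; have [] := xA i.
  by move=> i j; have [_ /(_ j)] := xA i; rewrite mxE.
move=> [[xA xI] xc]; split => // i; split; first exact: xA.
by move=> j; rewrite mxE.
Qed.

Let const_limit n (F : 'M[R]_(m.+1, d) -> R) : measurable_fun setT F ->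
  (forall x, 0 <= F x) ->
  (\int[lebesgue_mx m.+1 d]_x (g n x * rho x * F x)%:E =
   (m.+1)`!%:R^-1%:E * \int[lebesgue_mx m.+1 d]_x (wt n F x)%:E)%E.
Proof.
move=> mF F0; rewrite -ge0_integralZl_EFin ?invr_ge0//.
- by apply: eq_integral => x _; rewrite -EFinM /g /wt !mulrA.
- move=> x _; rewrite lee_fin /wt /in_window indicE.
  by rewrite !mulr_ge0 ?h_graph_ge0.
- apply/measurable_EFinP; do !apply: measurable_funM => //.
    by apply: measurable_indic; exact: measurable_mx_cube.
  exact: measurable_h_graph.
Qed.

Lemma G_count_cvg :
  (fun n : nat => ((\int[P]_w G_count Gam (r n) n (Phi w)) *
     (n%:R^-1)%:E)%E) @ \oo --> mu_lim beta rho Gam.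
Proof.
have [palmC _ _] := palmE.
have EG n : (\int[P]_w G_count Gam (r n) n (Phi w) =
    (m.+1)`!%:R^-1%:E * \int[lebesgue_mx m.+1 d]_x (wt n (cst 1) x)%:E)%E.
  rewrite -const_limit//.
  under [RHS]eq_integral do rewrite mulr1.
  rewrite -(campbell_tuples palmC (mg n) (g01 n) (g_cube (n := n))).
  apply: eq_integral => w _; rewrite /G_count -ge0_esumZl ?invr_ge0//; last first.
    by move=> x; rewrite lee_fin h_graph_ge0.
  rewrite distinct_window esum_mkcondr; apply: eq_esum => x _.
  rewrite /g /in_window indicE; case: ifPn => _; first by rewrite mul1r -EFinM.
  by rewrite mul0r mulr0.
rewrite mu_limE; under eq_fun do rewrite EG -muleA.
apply: cvgeZl => //.
apply: (window_average_cvg d_gt0 mrho rho_ge0 rho_translate rho_loc Gam_connected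
  r_gt0 s_gt0 rs (F := fun _ => cst 1) (Q := fun _ => cst 1) (q := cst 1)) => //.
- by move=> n x; rewrite /= ler01 lexx.
- by move=> n x; rewrite /= ler01 lexx.
- by apply: aeW => z _; exact: cvg_cst.
Qed.

Variable rho' : 'M[R]_(m.+2, d) -> R.
Hypothesis rho'P : joint_intensity P Phi rho'.

Lemma J_count_cvg :
  (fun n : nat => ((\int[P]_w J_count Gam (r n) n (Phi w)) *
     (n%:R^-1)%:E)%E) @ \oo --> gamma_lim beta rho palm Gam.
Proof.
have [palmC palm_red palm_tr] := palmE.
have mW n : measurable (window n : set 'rV[R]_d).
  by rewrite windowE; exact: measurable_mx_cube.
pose F n x := fine (void_prob palm (window n) (r n) x).
pose Q n x := fine (void_prob palm setT (r n) x).
have EJ n : (\int[P]_w J_count Gam (r n) n (Phi w) =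
    (m.+1)`!%:R^-1%:E * \int[lebesgue_mx m.+1 d]_x (wt n (F n) x)%:E)%E.
  have F01 x := fine_void_prob01 palm (r n) x (mW n).
  rewrite -const_limit//; first last.
  - by move=> x; have /andP[] := F01 x.
  - exact: measurable_fine_void_prob.
  transitivity (\int[lebesgue_mx m.+1 d]_x
      ((g n x * rho x)%:E * void_prob palm (window n) (r n) x))%E; last first.
    by apply: eq_integral => x _; rewrite [in RHS]EFinM fineK// void_prob_fin.
  rewrite -(campbell_isolated mrho rho_ge0 palmC palm_red (mW n) (ltW (r_gt0 n))
    (mg n) (g01 n) (g_cube (n := n)) (g_distinct (n := n))).
  apply: eq_integral => w _; rewrite /J_count -ge0_esumZl ?invr_ge0//; last first.
    by move=> x; rewrite lee_fin mulr_ge0 ?h_graph_ge0.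
  rewrite distinct_window esum_mkcondr; apply: eq_esum => x _.
  rewrite /g /in_window indicE {1}/npoints -setIA -/(npoints _ _).
  case: ifPn => _; first by rewrite mul1r -EFinM mulrA.
  by rewrite !mul0r mulr0 mul0r.
rewrite gamma_limE; under eq_fun do rewrite EJ -muleA.
apply: cvgeZl => //.
apply: (window_average_cvg d_gt0 mrho rho_ge0 rho_translate rho_loc Gam_connected
  r_gt0 s_gt0 rs (F := F) (Q := Q) (q := fun x => fine (void_prob palm setT s x))).
- by move=> n; exact: measurable_fine_void_prob.
- by move=> n x; exact: fine_void_prob01.
- by move=> n x; exact: fine_void_prob01.
- exact: measurable_fine_void_prob.
- move=> n t x xin; congr fine; apply: void_prob_translate => //.
  move=> y [i xy] j; have := xin i j.
  have := le_trans (coord_le_euclid_dist _ _ j) xy; rewrite !mxE distrC => xyj.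
  have := ler_normD (y 0 j - (x i j + t 0 j)) (x i j + t 0 j); rewrite subrK.
  rewrite /window_side; lra.
- suff bd : {ae lebesgue_mx m d, forall z, 0 < rho (anchor z) ->
      palm (anchor z) [set phi | on_boundary s (phi, anchor z)] = 0%E}.
    move: bd; apply: filterS => z pz rz0; apply: void_prob_cvg => //; exact: pz.
  apply: (ae_anchor (Q := fun x => 0 < rho x ->
    palm x [set phi | on_boundary s (phi, x)] = 0%E)); last first.
    have := palm_on_boundary mrho rho_ge0 palmC rho'P s_gt0.
    by apply: filterS => x; apply.
  move=> t x; rewrite rho_translate => ptx rx0; rewrite -(ptx rx0) palm_tr.
    congr (palm x _); apply/seteqP.
    by split=> phi /= /(on_boundary_translate s t phi x).
  have mf := measurable_fun_pair (@measurable_id _ (config R d) setT)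
    (@measurable_cst _ _ (config R d) _ setT (translate t x)).
  rewrite -[X in measurable X]setTI.
  exact: (mf measurableT _ (measurable_on_boundary s)).
Qed.

End thermodynamic_limits.

(** * Negative association of hitting and avoiding *)

Section threshold_function.
Context {R : realType} {p : nat}.

(** On vectors of counts this is the indicator that no entry vanishes; the values
    between 0 and 1 elsewhere make it continuous. *)
Definition all_positive (a : 'rV[R]_p) : R :=
  Num.max 0 (\big[Num.min/1]_i a 0 i).

Lemma all_positive_increasing : increasing_bounded_continuous all_positive.
Proof.
split.
- move=> a b ab; rewrite /all_positive ge_max le_max lexx/= le_max; apply/orP; right.
  apply/bigmin_geP; split; first exact: bigmin_le_id.
  by move=> i _; apply: le_trans (ab i); exact: bigmin_le_cond.
- exists 1 => a; rewrite ger0_norm ?le_max ?lexx//.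
  by rewrite ge_max ler01; exact: bigmin_le_id.
- have cmin : continuous (fun a : 'rV[R]_p => \big[Num.min/1]_i a 0 i).
    apply: (@continuous_big R _ Num.min 1 xpredT _ _ (index_enum _)
      (fun i (a : 'rV[R]_p) => a 0 i)) => [|i _]; first exact: min_continuous.
    exact: coord_continuous.
  move=> a; have c0 : {for a, continuous (cst 0 : 'rV[R]_p -> R^o)} by apply: cst_continuous.
  exact: continuous_max c0 (cmin a).
Qed.

Lemma all_positive_counts {d : nat} (B : 'I_p -> set 'rV[R]_d)
    (phi : config R d) : (forall i, bounded_mx (B i)) ->
  all_positive (counts B phi) = (`[< forall i, npoints phi (B i) <> 0%E >])%:R.
Proof.
move=> bB; rewrite /all_positive; case: asboolP => [B1|/existsNP[i /contrapT B0]].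
  have -> : \big[Num.min/1]_i counts B phi 0 i = 1; last by rewrite max_r.
  apply/eqP; rewrite eq_le bigmin_le_id; apply/bigmin_geP; split => // i _.
  rewrite mxE; have := B1 i; have [n ->] := npoints_bounded phi (bB i).
  by case: n => //= n _; rewrite ler1n.
rewrite max_l//; apply: (@le_trans _ _ (counts B phi 0 i)).
  exact: bigmin_le_cond.
by rewrite mxE B0.
Qed.

End threshold_function.

Section negative_association.
Context {R : realType} {dT : measure_display} {T : measurableType dT}.
Variables (P : probability T R) (d : nat) (Phi : {mfun T >-> config R d}).

Definition hits {p} (B : 'I_p -> set 'rV[R]_d) : set T :=
  [set w | forall i, npoints (Phi w) (B i) <> 0%E].

Lemma measurable_Phi (A : set (config R d)) : measurable A ->
  measurable [set w | A (Phi w)].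
Proof.
by move=> mA; rewrite -[X in measurable X]setTI; exact: (measurable_funPT Phi).
Qed.

Lemma measurable_void_event (B : set 'rV[R]_d) : measurable B ->
  measurable [set w | npoints (Phi w) B = 0%E].
Proof.
by move=> mB; apply: (measurable_Phi (A := [set phi | npoints phi B = 0%:R%:E]));
  exact: measurable_npoints_eq.
Qed.

Lemma measurable_hits p (B : 'I_p -> set 'rV[R]_d) :
  (forall i, measurable (B i)) -> measurable (hits B).
Proof.
move=> mB; rewrite (_ : hits B = \bigcap_(i : 'I_p)
    ~` [set w | npoints (Phi w) (B i) = 0%E]).
  apply: fin_bigcap_measurable => // i _; apply: measurableC.
  exact: measurable_void_event.
by apply/seteqP; split=> w wB i => [_|]; exact: wB.
Qed.

(** Hitting the sets Q and hitting C are increasing functions of counts in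
    disjoint regions, hence negatively correlated; passing to the complement of
    the second event reverses the inequality. *)
Lemma hits_void_ge p (Q : 'I_p -> set 'rV[R]_d) (C : set 'rV[R]_d) :
  negatively_associated P Phi ->
  (forall i, measurable (Q i) /\ bounded_mx (Q i)) ->
  measurable C -> bounded_mx C -> (\bigcup_i Q i) `&` C = set0 ->
  (P (hits Q) * P [set w | npoints (Phi w) C = 0%E] <=
   P (hits Q `&` [set w | npoints (Phi w) C = 0%E]))%E.
Proof.
move=> NA Qp mC bC QC; set V := [set w | npoints (Phi w) C = 0%E].
pose C1 (i : 'I_1) := C.
have mV : measurable V by exact: measurable_void_event.
have mH : measurable (hits Q) by apply: measurable_hits => i; have [] := Qp i.
have H1 : hits C1 = ~` V.
  by apply/seteqP; split=> w wC; [exact: (wC ord0)|move=> i].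
have indE q (B : 'I_q -> set 'rV[R]_d) : (forall i, bounded_mx (B i)) ->
    (fun w => all_positive (counts B (Phi w))) = \1_(hits B) :> (T -> R).
  by move=> bB; apply/funext => w; rewrite all_positive_counts// indicE.
have := NA p 1%N Q C1 all_positive all_positive Qp (fun=> conj mC bC) _
  all_positive_increasing all_positive_increasing.
have UC : \bigcup_i C1 i = C by apply/seteqP; split=> [x [i _]//|x Cx]; exists ord0.
rewrite UC => /(_ QC); rewrite !indE//; last by move=> i; have [] := Qp i.
have iL (A : set T) : measurable A -> (\1_A : T -> R) \in Lfun P 1.
  by move=> mA; apply/Lfun1_integrable; exact: integrable_indic.
have XY : (\1_(hits Q) : T -> R) * \1_(hits C1) = \1_(hits Q `&` hits C1).
  by apply/funext => w; rewrite indicI.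
have mH1 : measurable (hits C1) by rewrite H1; exact: measurableC.
have mI : measurable (hits Q `&` hits C1) by exact: measurableI.
rewrite covarianceE ?XY ?iL// !expectation_indic//.
have Pfin A : measurable A -> exists a : R, P A = a%:E.
  by move=> mA; exists (fine (P A)); rewrite fineK// fin_num_measure.
have e2 := measureDI P mH mV; rewrite setDE -H1 in e2.
have := probability_setC P mV; rewrite -H1.
have [h Ph] := Pfin _ mH; have [v ->] := Pfin _ mV.
have [h1 ->] := Pfin _ mH1; have [i1 Pi1] := Pfin _ mI.
have [i2 Pi2] := Pfin _ (measurableI _ _ mH mV).
have {}e2 := etrans (esym Ph) (etrans e2 (f_equal2 adde Pi1 Pi2)).
rewrite Ph Pi1 Pi2.
move=> e1 e3.
have h1E : h1 = 1 - v by apply: EFin_inj; exact: e1.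
have hE : h = i1 + i2 by apply: EFin_inj; exact: e2.
have cov : i1 - h * h1 <= 0 by rewrite -lee_fin; exact: e3.
suff : h * v <= i2 by rewrite -lee_fin EFinM.
by rewrite h1E in cov; rewrite hE in cov *; lra.
Qed.

End negative_association.

(** * Cells that are rarely hit twice *)

Section uncrowded_cells.
Context {R : realType} {dT : measure_display} {T : measurableType dT}.
Variables (P : probability T R) (d k : nat) (Phi : {mfun T >-> config R d}).
Variables (rho' : 'M[R]_(k.+1, d) -> R).
Hypothesis rho'P : joint_intensity P Phi rho'.
Variable V : 'I_k -> set 'rV[R]_d.
Hypothesis mV : forall i, measurable (V i).
Hypothesis bV : forall i, bounded_mx (V i).
Hypothesis V_disjoint : forall i j y, V i y -> V j y -> i = j.

Definition crowded {p} (Q : 'I_p -> set 'rV[R]_d) : set T :=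
  [set w | exists i y y', [/\ (points (Phi w) `&` Q i) y,
    (points (Phi w) `&` Q i) y' & y <> y']].

Definition tuple_in (Q : 'I_k -> set 'rV[R]_d) : set 'M[R]_(k, d) :=
  [set x | forall i, Q i (row i x)].

Lemma hits_tuple (Q : 'I_k -> set 'rV[R]_d) w : hits Phi Q w ->
  exists x, tuple_in Q x /\ forall i, points (Phi w) (row i x).
Proof.
move=> wQ; have /choice[f fP] i : exists y, (points (Phi w) `&` Q i) y.
  apply: contrapT => /forallNP ny; apply: (wQ i); apply/npoints_eq0.
  by apply/seteqP; split=> y //= /ny.
exists (\matrix_i f i); split=> i; rewrite rowK; have [] := fP i => //.
Qed.

Lemma measurable_crowded p (Q : 'I_p -> set 'rV[R]_d) :
  (forall i, measurable (Q i)) -> (forall i, bounded_mx (Q i)) ->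
  measurable (crowded Q).
Proof.
move=> mQ bQ; rewrite (_ : crowded Q = \bigcup_(i : 'I_p)
    ~` [set w | (npoints (Phi w) (Q i) <= 1%:R%:E)%E]).
  apply: fin_bigcup_measurable => // i _; apply: measurableC.
  apply: (measurable_Phi Phi (A := [set phi | (npoints phi (Q i) <= 1%:R%:E)%E])).
  exact: measurable_npoints_le.
apply/seteqP; split=> [w [i [y [y' [Qy Qy' yy']]]]|w [i _ /= Qi]].
  exists i => //= Q1.
  have : (counting [set y; y'] <= npoints (Phi w) (Q i) :> \bar R)%E.
    by apply: counting_le => _ [->|->].
  move=> /le_trans/(_ Q1); rewrite countingU; last first.
    by apply/seteqP; split=> z //= -[-> /yy'].
  rewrite !counting_esum !esum_set1 ?lee01// -EFinD lee_fin.
  by rewrite -subr_ge0 opprD addrA subrr sub0r oppr_ge0 ler10.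
apply: contrapT => nc; apply: Qi.
have [Q0|/set0P[y Qy]] := eqVneq (points (Phi w) `&` Q i) set0.
  by rewrite /npoints Q0 measure0 lee_fin.
have -> : npoints (Phi w) (Q i) = counting [set y].
  congr counting; apply/seteqP; split=> [y' Qy'|_ ->//].
  apply: contrapT => yy'; apply: nc; exists i, y, y'; split => // yy.
  by apply: yy'; rewrite yy.
by rewrite counting_esum esum_set1 ?lee01// lee_fin.
Qed.

Definition extended_tuple_in (Q : 'I_k -> set 'rV[R]_d) : set 'M[R]_(k.+1, d) :=
  [set x | (forall i, Q i (row (lift ord0 i) x)) /\ exists i, Q i (row ord0 x)].

Lemma measurable_row_in n (i : 'I_n) (A : set 'rV[R]_d) : measurable A ->
  measurable [set x : 'M[R]_(n, d) | A (row i x)].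
Proof.
by move=> mA; rewrite -[X in measurable X]setTI; exact: (@measurable_row R d n i measurableT A mA).
Qed.

Lemma measurable_extended_tuple_in (Q : 'I_k -> set 'rV[R]_d) :
  (forall i, measurable (Q i)) -> measurable (extended_tuple_in Q).
Proof.
move=> mQ; rewrite (_ : extended_tuple_in Q =
  (\bigcap_(i : 'I_k) [set x | Q i (row (lift ord0 i) x)]) `&`
  (\bigcup_(i : 'I_k) [set x : 'M[R]_(k.+1, d) | Q i (row ord0 x)])).
  apply: measurableI.
    by apply: fin_bigcap_measurable => // i _; exact: measurable_row_in.
  by apply: fin_bigcup_measurable => // i _; exact: measurable_row_in.
apply/seteqP; split=> [x [xQ [i xi]]|x [xQ [i _ xi]]]; split.
- by move=> j _; exact: xQ.
- by exists i.
- by move=> j; exact: xQ.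
- by exists i.
Qed.

(** A second point in one of the sets extends a tuple of points, one from each
    set, so that its probability is controlled by the next joint intensity. *)
Lemma crowded_le (Q : 'I_k -> set 'rV[R]_d) :
  (forall i, measurable (Q i)) -> (forall i, Q i `<=` V i) ->
  (P (hits Phi Q `&` crowded Q) <=
   \int[lebesgue_mx k.+1 d]_(x in extended_tuple_in Q) (rho' x)%:E)%E.
Proof.
move=> mQ QV; have [_ _ _ <-] := rho'P; last exact: measurable_extended_tuple_in.
have bQ i : bounded_mx (Q i) by have [M VM] := bV i; exists M => x /QV/VM.
have mE : measurable (hits Phi Q `&` crowded Q).
  by apply: measurableI; [exact: measurable_hits|exact: measurable_crowded].
have -> : P (hits Phi Q `&` crowded Q) =
    (\int[P]_w (\1_(hits Phi Q `&` crowded Q) w : R)%:E)%E.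
  by rewrite integral_indic// setIT.
apply: ge0_le_lower_integral => w; first by rewrite lee_fin indicE.
rewrite indicE; have [/set_mem[wQ [i [y [y' [Qy Qy' yy']]]]]|_] := boolP (_ \in _); last first.
  by rewrite counting_esum esum_ge0// => x _; exact: lee01.
have [x0 [x0Q x0Phi]] := hits_tuple wQ.
pose x : 'M[R]_(k, d) := \matrix_j (if j == i then y else row j x0).
have xE j : row j x = if j == i then y else row j x0 by rewrite rowK.
have xQ j : Q j (row j x) by rewrite xE; case: eqP => [->|_]; [case: Qy|exact: x0Q].
have xdt : distinct_tuples (Phi w) x.
  split=> [j|j j' jj'].
    by rewrite xE; case: eqP => [_|_]; [case: Qy|exact: x0Phi].
  have Vj' : V j' (row j x) by rewrite [row j x]jj'; exact: QV (xQ j').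
  exact: V_disjoint (QV _ _ (xQ j)) Vj'.
have : (counting [set cons_mx y' x] <=
    counting (distinct_tuples (Phi w) `&` extended_tuple_in Q) :> \bar R)%E.
  apply: counting_le => _ ->; split.
    apply: distinct_tuples_cons => //; first by case: Qy'.
    move=> j jy'; have [ji|ji] := eqVneq j i.
      by apply: yy'; rewrite -jy' ji xE eqxx.
    move/eqP: ji; apply; apply: (@V_disjoint _ _ y'); apply: QV.
      by rewrite -jy'; exact: xQ.
    by case: Qy'.
  split=> [j|]; first by rewrite row_consS; exact: xQ.
  by exists i; rewrite row_cons0; case: Qy'.
by rewrite {1}counting_esum esum_set1 ?lee01.
Qed.

(** The sets are partitioned by the grid of mesh 1 / (N + 1), one grid cell being
    chosen in each of them. *)
Let cell (N : nat) (c : 'M[int]_(k, d)) (i : 'I_k) : set 'rV[R]_d :=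
  [set y | V i y /\ forall j, (c i j)%:~R <= y 0 j * N.+1%:R < (c i j + 1)%:~R].

(** An enumeration of the countably many choices of cells, empty at the numbers
    that encode no choice *)
Let cells N (n : nat) : 'I_k -> set 'rV[R]_d :=
  if pickle_inv n is Some c then cell N c else fun=> set0.

Let measurable_cells N n i : measurable (cells N n i).
Proof.
rewrite /cells; case: pickle_inv => // c.
rewrite (_ : cell N c i = V i `&` \bigcap_(j : 'I_d)
  [set y | (c i j)%:~R <= y 0 j * N.+1%:R < (c i j + 1)%:~R]).
  apply: measurableI => //; apply: fin_bigcap_measurable => // j _.
  have mf : measurable_fun setT (fun y : 'rV[R]_d => y 0 j * N.+1%:R).
    by apply: measurable_funM => //; exact: measurable_coord.
  rewrite -[X in measurable X]setTI [X in _ `&` X](_ : _ =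
    (fun y : 'rV[R]_d => y 0 j * N.+1%:R) @^-1` `[(c i j)%:~R, (c i j + 1)%:~R[).
    exact: mf.
  by apply/seteqP; split=> y /=; rewrite in_itv.
by apply/seteqP; split=> y [Vy yc]; split => // j; [move=> _|]; exact: yc.
Qed.

Let cells_sub N n i : cells N n i `<=` V i.
Proof. by rewrite /cells; case: pickle_inv => [c y []//|y]. Qed.

Let hits_cells N : hits Phi V `<=` \bigcup_n hits Phi (cells N n).
Proof.
move=> w /hits_tuple[x [xV xPhi]].
pose c : 'M[int]_(k, d) := \matrix_(i, j) Num.floor (x i j * N.+1%:R).
exists (choice.pickle c) => // i; rewrite /cells pickleK_inv => /npoints_eq0 E.
suff : (points (Phi w) `&` cell N c i) (row i x) by rewrite E.
split; first exact: xPhi.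
split; first exact: xV.
by move=> j; rewrite !mxE; exact: floor_itv.
Qed.

Let cells_disjoint N : trivIset setT (fun n => extended_tuple_in (cells N n)).
Proof.
apply/trivIsetP => n n' _ _ nn'; apply/seteqP; split=> x //= -[].
rewrite /extended_tuple_in /cells.
case E: (pickle_inv n) => [c|]; last by move=> [_ []].
case E': (pickle_inv n') => [c'|]; last by move=> _ [_ []].
move=> [xc _] [xc' _]; move/eqP: nn'; apply.
have pn : n = choice.pickle c by have := @pickle_invK 'M[int]_(k, d) n; rewrite E.
have pn' : n' = choice.pickle c' by have := @pickle_invK 'M[int]_(k, d) n'; rewrite E'.
rewrite pn pn'; congr choice.pickle; apply/matrixP => i j.
have [_ /(_ j)] := xc i; have [_ /(_ j)] := xc' i.
by rewrite mxE => /floor_def <- /floor_def <-.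
Qed.

(** An additional point in one of the cells lies within the mesh of the point of
    the tuple in this cell. *)
Let strip (N : nat) : set 'M[R]_(k.+1, d) :=
  [set x | (forall i, V i (row (lift ord0 i) x)) /\
    exists i, forall j, `|x (lift ord0 i) j - x ord0 j| <= N.+1%:R^-1].

Let measurable_strip N : measurable (strip N).
Proof.
rewrite (_ : strip N =
  (\bigcap_(i : 'I_k) [set x | V i (row (lift ord0 i) x)]) `&`
  (\bigcup_(i : 'I_k) \bigcap_(j : 'I_d)
    [set x : 'M[R]_(k.+1, d) | `|x (lift ord0 i) j - x ord0 j| <= N.+1%:R^-1])).
  apply: measurableI.
    by apply: fin_bigcap_measurable => // i _; exact: measurable_row_in.
  apply: fin_bigcup_measurable => // i _; apply: fin_bigcap_measurable => // j _.
  have mf : measurable_fun setT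
      (fun x : 'M[R]_(k.+1, d) => `|x (lift ord0 i) j - x ord0 j|).
    apply: measurableT_comp => //.
    by apply: measurable_funB; exact: measurable_coord.
  rewrite -[X in measurable X]setTI [X in _ `&` X](_ : _ =
    (fun x : 'M[R]_(k.+1, d) => `|x (lift ord0 i) j - x ord0 j|) @^-1`
      `]-oo, N.+1%:R^-1]).
    exact: mf.
  by apply/seteqP; split=> x /=; rewrite in_itv.
apply/seteqP; split=> [x [xV [i xi]]|x [xV [i _ xi]]]; split.
- by move=> j _; exact: xV.
- by exists i => // j _; exact: xi.
- by move=> j; exact: xV.
- by exists i => j; exact: xi.
Qed.

Let bounded_strip : exists M, strip 0 `<=` mx_cube M.
Proof.
have /choice[f fV] i : exists M, forall y, V i y -> forall j, `|y 0 j| <= M.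
  by have [M VM] := bV i; exists M => y /VM yM j; exact: yM.
exists (\sum_i `|f i| + 1) => x [xV [i xi]] i' j.
have xl l : `|x (lift ord0 l) j| <= \sum_i `|f i|.
  have := fV l _ (xV l) j; rewrite mxE => /le_trans; apply.
  rewrite (le_trans (ler_norm _))// (bigD1 l)//= lerDl.
  exact: sumr_ge0.
case: (unliftP ord0 i') => [l ->|->]; first by rewrite (le_trans (xl l))// lerDl.
have := xi j; have := xl i; rewrite invr1.
have := ler_normB (x (lift ord0 i) j) (x (lift ord0 i) j - x ord0 j).
rewrite subKr; lra.
Qed.

Let cells_strip N n : extended_tuple_in (cells N n) `<=` strip N.
Proof.
move=> x [xc [i xi]]; split=> [i'|]; first exact: cells_sub (xc i').
exists i => j; have := xc i; move: xi; rewrite /cells; case: pickle_inv => // c.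
move=> [_ /(_ j)] + [_ /(_ j)]; rewrite !mxE => /andP[a1 a2] /andP[b1 b2].
have N0 : 0 < N.+1%:R :> R by rewrite ltr0n.
rewrite -(ler_pM2r N0) mulVf ?gt_eqF// -[X in _ * X](gtr0_norm N0) -normrM mulrBl.
by move: a2 b2; rewrite !intrD ler_norml => a2 b2; apply/andP; split; lra.
Qed.

Let rho'0 x : 0 <= rho' x. Proof. by have [] := rho'P. Qed.
Let mrho' : measurable_fun setT rho'. Proof. by have [] := rho'P. Qed.

(** A simple point process has no pair of coinciding points, so that the strips
    around the diagonals carry little of the joint intensity. *)
Let strip_cvg0 :
  (fun N => \int[lebesgue_mx k.+1 d]_(x in strip N) (rho' x)%:E)%E @ \oo --> 0%E.
Proof.
pose S : set 'M[R]_(k.+1, d) := \bigcap_N strip N.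
have mS : measurable S by exact: bigcapT_measurable.
have restrE (A : set 'M[R]_(k.+1, d)) :
    (\int[lebesgue_mx k.+1 d]_(x in A) (rho' x)%:E =
     \int[lebesgue_mx k.+1 d]_x (\1_A x * rho' x)%:E)%E.
  rewrite integral_mkcond; apply: eq_integral => x _.
  by rewrite patchE indicE; case: ifP => _; rewrite ?mul1r ?mul0r.
have mI (A : set 'M[R]_(k.+1, d)) : measurable A ->
    measurable_fun setT (fun x => (\1_A x * rho' x)%:E).
  by move=> mA; apply/measurable_EFinP; apply: measurable_funM.
have S0 : (\int[lebesgue_mx k.+1 d]_(x in S) (rho' x)%:E = 0)%E.
  have [_ _ _ <-//] := rho'P; rewrite /alpha integral0_eq// => w _.
  rewrite (_ : _ `&` _ = set0) ?measure0//.
  apply/seteqP; split=> x //= [[_ xI] xS].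
  have : \forall N \near \oo, forall i : 'I_k, exists j,
      N.+1%:R^-1 < `|x (lift ord0 i) j - x ord0 j|.
    apply: filter_forall => i.
    have [j xij] : exists j, 0 < `|x (lift ord0 i) j - x ord0 j|.
      apply: contrapT => /forallNP xi.
      suff /xI : row (lift ord0 i) x = row ord0 x by [].
      apply/rowP => j; rewrite !mxE; apply/eqP; rewrite -subr_eq0 -normr_eq0.
      by rewrite eq_le normr_ge0 andbT leNgt; apply/negP; exact: xi.
    by apply: filterS (near_infty_natSinv_lt (PosNum xij)) => N xN; exists j.
  move=> [N _ /(_ N (leqnn _)) xN].
  have [_ [i xi]] := xS N I; have [j] := xN i.
  by rewrite ltNge xi.
have strip_le N N' : (N <= N')%N -> strip N' `<=` strip N.
  move=> NN' x [xV [i xi]]; split => //; exists i => j.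
  by rewrite (le_trans (xi j))// lef_pV2 ?posrE// ler_nat.
have [M SM] := bounded_strip.
have int0 : (lebesgue_mx k.+1 d).-integrable setT
    (fun x => (\1_(strip 0) x * rho' x)%:E).
  apply/integrableP; split; first exact: mI.
  rewrite (eq_integral (fun x => (\1_(strip 0) x * rho' x)%:E)); last first.
    by move=> x _; rewrite gee0_abs// lee_fin mulr_ge0// indicE.
  rewrite -restrE; have [_ _ fin <-//] := rho'P; apply: fin => //.
have cvgI : {ae lebesgue_mx k.+1 d, forall x, setT x ->
    (fun N => (\1_(strip N) x * rho' x)%:E) @ \oo --> (\1_S x * rho' x)%:E}.
  apply: aeW => x _; have [xS|/existsNP[N0 /not_implyP[_ xN0]]] := pselect (S x).
    apply: cvg_near_cst; exists 0%N => // N _ /=.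
    by rewrite !indicE !mem_set//; exact: xS.
  apply: cvg_near_cst; exists N0 => // N /= N0N.
  have xN : ~ strip N x by move=> xN; apply: xN0; exact: strip_le xN.
  have nS : ~ S x by move=> /(_ N0 I).
  by rewrite !indicE (memNset xN) (memNset nS).
have dom : {ae lebesgue_mx k.+1 d, forall x N, setT x ->
    (`|(\1_(strip N) x * rho' x)%:E| <= (\1_(strip 0) x * rho' x)%:E)%E}.
  apply: aeW => x N _; rewrite gee0_abs ?lee_fin ?mulr_ge0 ?indicE//.
  rewrite ler_wpM2r// ler_nat; have [xN|//] := boolP (x \in strip N).
  by rewrite mem_set//; apply: strip_le (set_mem xN).
have [_ _] := dominated_convergence measurableT (fun N => mI _ (measurable_strip N))
  (mI _ mS) cvgI int0 dom.
rewrite -restrE S0; apply: cvg_trans; apply: near_eq_cvg.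
by exists 0%N => // N _ /=; rewrite restrE.
Qed.

(** Otherwise summation over all choices of cells of one mesh would bound p times
    the probability of hitting the sets V by the expected number of tuples in the
    strip, which vanishes with the mesh. *)
Lemma exists_uncrowded (p : R) : 0 < p -> (0 < P (hits Phi V))%E ->
  exists Q : 'I_k -> set 'rV[R]_d,
    [/\ forall i, measurable (Q i), forall i, Q i `<=` V i &
      (P (hits Phi Q `&` crowded Q) < P (hits Phi Q) * p%:E)%E].
Proof.
move=> p0 hV; apply: contrapT => /forallNP noQ.
have mh : measurable (hits Phi V) by exact: measurable_hits.
have crowd N n : (P (hits Phi (cells N n)) * p%:E <=
    \int[lebesgue_mx k.+1 d]_(x in extended_tuple_in (cells N n)) (rho' x)%:E)%E.
  apply: le_trans (crowded_le (measurable_cells N n) (fun i => @cells_sub N n i)).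
  rewrite leNgt; apply/negP => lt; apply: (noQ (cells N n)); split => //.
have bound N : (P (hits Phi V) * p%:E <=
    \int[lebesgue_mx k.+1 d]_(x in strip N) (rho' x)%:E)%E.
  have mc n : measurable (hits Phi (cells N n)) by exact: measurable_hits.
  have me n : measurable (extended_tuple_in (cells N n)).
    exact: measurable_extended_tuple_in.
  have mU : measurable (\bigcup_n extended_tuple_in (cells N n)).
    exact: bigcupT_measurable.
  apply: (@le_trans _ _ (\int[lebesgue_mx k.+1 d]_(x in
      \bigcup_n extended_tuple_in (cells N n)) (rho' x)%:E)%E); last first.
    apply: ge0_subset_integral => //.
    - by apply: measurable_funTS; exact/measurable_EFinP.
    - by move=> x _; rewrite lee_fin.
    - by move=> x [n _]; exact: cells_strip.
  rewrite ge0_integral_bigcup//; first last.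
  - by move=> x _; rewrite lee_fin.
  - by apply: measurable_funTS; exact/measurable_EFinP.
  apply: (@le_trans _ _ ((\sum_(n <oo) P (hits Phi (cells N n))) * p%:E)%E).
    apply: lee_wpmul2r; first by rewrite lee_fin ltW.
    exact: (measure_sigma_subadditive P mc mh (@hits_cells N)).
  rewrite muleC -nneseriesZl//; apply: lee_nneseries => n _.
    by rewrite mule_ge0// lee_fin ltW.
  by rewrite muleC; exact: crowd.
have : (P (hits Phi V) * p%:E <= 0)%E.
  by apply: cvge_ge strip_cvg0; exists 0%N => // N _; exact: bound.
by rewrite leNgt mule_gt0// lte_fin.
Qed.

End uncrowded_cells.

(** * Positivity of the limit for isolated subgraphs *)

Section cubes.
Context {R : realType} {k d : nat}.
Implicit Types (x : 'M[R]_(k, d)) (e : R).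

Definition cubes x e (i : 'I_k) : set 'rV[R]_d :=
  [set y | forall j, `|y 0 j - x i j| <= e].

Let tuple_in_cubes x e : tuple_in (cubes x e) =
  mx_rect (fun i j => `[x i j - e, x i j + e]%classic).
Proof.
by apply/seteqP; split=> y xy i j; have := xy i j;
  rewrite /= !mxE ?in_itv/= ler_distl.
Qed.

Lemma measurable_cubes x e i : measurable (cubes x e i).
Proof.
rewrite (_ : cubes x e i = mx_rect (fun _ j => `[x i j - e, x i j + e]%classic)).
  by apply: measurable_mx_rect => i' j; exact: measurable_itv.
apply/seteqP; split=> y xy.
  by move=> i' j; have := xy j; rewrite (ord1 i') /= in_itv/= ler_distl.
by move=> j; have := xy 0 j; rewrite /= in_itv/= ler_distl.
Qed.

Lemma bounded_cubes x e i : bounded_mx (cubes x e i).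
Proof.
exists (e + \sum_j `|x i j|) => y xy i' j; rewrite (ord1 i').
have := ler_normD (y 0 j - x i j) (x i j); rewrite subrK => /le_trans; apply.
by rewrite lerD// (bigD1 j)//= lerDl sumr_ge0.
Qed.

Lemma measurable_tuple_in (Q : 'I_k -> set 'rV[R]_d) :
  (forall i, measurable (Q i)) -> measurable (tuple_in Q).
Proof.
move=> mQ; rewrite (_ : tuple_in Q = \bigcap_(i : 'I_k) [set x | Q i (row i x)]).
  by apply: fin_bigcap_measurable => // i _; exact: measurable_row_in.
by apply/seteqP; split=> x xQ i => [_|]; exact: xQ.
Qed.

Lemma lebesgue_cubes_gt0 x e : 0 < e ->
  (0 < lebesgue_mx k d (tuple_in (cubes x e)))%E.
Proof.
move=> e0; rewrite tuple_in_cubes lebesgue_mx_rect; last first.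
  by move=> i j; exact: measurable_itv.
have prod_gt0 n (F : 'I_n -> \bar R) : (forall i, 0 < F i)%E -> (0 < \prod_(i < n) F i)%E.
  by move=> F0; elim/big_ind: _ => // a b; exact: mule_gt0.
apply: (prod_gt0) => i; apply: (prod_gt0) => j.
have e2 : x i j - e < x i j + e by lra.
by rewrite lebesgue_measure_itv/= lte_fin e2 -EFinB lte_fin subr_gt0.
Qed.

End cubes.

Section positivity.
Context {R : realType} {dT : measure_display} {T : measurableType dT}.
Variables (P : probability T R) (d m : nat) (Phi : {mfun T >-> config R d}).
Variables (rho : 'M[R]_(m.+1, d) -> R) (rho' : 'M[R]_(m.+2, d) -> R).
Variables (palm : R.-pker 'M[R]_(m.+1, d) ~> config R d) (Gam : rel 'I_m.+1).
Hypothesis d_gt0 : (0 < d)%N.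
Hypothesis rhoP : joint_intensity P Phi rho.
Hypothesis rho'P : joint_intensity P Phi rho'.
Hypothesis rho_translate : forall (t : 'rV[R]_d) (x : 'M[R]_(m.+1, d)),
  rho (translate t x) = rho x.
Hypothesis palmE : reduced_palm P Phi rho palm.
Hypothesis Gam_connected : connected_graph Gam.
Variable s : R.
Hypothesis s_gt0 : 0 < s.
Hypothesis Gam_feasible : feasible_at s rho Gam.
Hypothesis rho_continuous : {ae lebesgue_mx m.+1 d, forall x,
  {for x, continuous rho}}.
Hypothesis NA : negatively_associated P Phi.
Hypothesis void_pos : {ae lebesgue_mx m.+1 d, forall x,
  (forall i, euclid_dist 0 (row i x) <= s * m.+1%:R) ->
  (0 < P [set w | npoints (Phi w) (balls x s) = 0%E])%E}.

Let mrho : measurable_fun setT rho. Proof. by have [] := rhoP. Qed.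
Let rho_ge0 x : 0 <= rho x. Proof. by have [] := rhoP. Qed.
Let hrho x : R := h_graph Gam s x * rho x.
Let hrho_ge0 x : 0 <= hrho x. Proof. by rewrite mulr_ge0// h_graph_ge0. Qed.
Let mhrho : measurable_fun setT hrho.
Proof. by apply: measurable_funM => //; exact: measurable_h_graph. Qed.
Let hrho_translate t x : hrho (translate t x) = hrho x.
Proof. by rewrite /hrho h_graph_translate rho_translate. Qed.

(** Feasibility gives a tuple somewhere, whereas the void probabilities are known
    to be positive for almost all tuples near the origin. As the graph indicator
    and the joint intensity are invariant under translations, the shape can be
    taken from feasibility and the position of the first point chosen freely in a
    small cube at the origin, off a null set. *)
Lemma exists_generic_tuple : exists x : 'M[R]_(m.+1, d),
  [/\ h_graph Gam s x = 1, 0 < rho x, {for x, continuous rho},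
    forall i j, euclid_dist (row i x) (row j x) <> s &
    (0 < P [set w | npoints (Phi w) (balls x s) = 0%E])%E].
Proof.
have [N [mN N0 goodN]] : {ae lebesgue_mx m.+1 d, forall x : 'M[R]_(m.+1, d),
    [/\ {for x, continuous rho},
      forall i j, euclid_dist (row i x) (row j x) <> s &
      (forall i, euclid_dist 0 (row i x) <= s * m.+1%:R) ->
      (0 < P [set w | npoints (Phi w) (balls x s) = 0%E])%E]}.
  exact: filterS3 rho_continuous (ae_dist_neq m.+1 (lt0r_neq0 s_gt0)) void_pos.
pose C : set 'rV[R]_d := mx_cube (s / d%:R).
have sd0 : 0 < s / d%:R by rewrite divr_gt0// ltr0n.
have C0 : (0 < lebesgue_mx 1 d C)%E.
  by rewrite lebesgue_mx_cube ?(ltW sd0)// lte_fin exprn_gt0// mulr_gt0.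
have mC : measurable C by exact: measurable_mx_cube.
have [t Ct tN] := exists_null_section mN N0 mC C0.
have [z [zN hz]] : exists z : 'M[R]_(m, d),
    ~ N (translate t (anchor z)) /\ hrho (anchor z) != 0.
  apply: contrapT => /forallNP nz; have := Gam_feasible; rewrite /feasible_at.
  suff -> : (\int[lebesgue_mx m.+1 d]_x (h_graph Gam s x * rho x)%:E = 0)%E.
    by rewrite ltxx.
  rewrite ge0_integral_anchor; last 2 first.
  - exact/measurable_EFinP.
  - by move=> x; rewrite lee_fin; exact: hrho_ge0.
  rewrite -(integral0 (lebesgue_mx m d) setT).
  apply: ge0_ae_eq_lower_integral => //.
    by move=> z; apply: integral_ge0 => t' _; rewrite lee_fin; exact: hrho_ge0.
  exists [set z | N (translate t (anchor z))]; split => //.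
    by rewrite -[X in measurable X]setTI; exact: measurable_translate_anchor.
  move=> z /= Iz; apply: contrapT => nN; apply: Iz.
  apply: integral0_eq => t' _; congr EFin; rewrite -/(hrho _) hrho_translate.
  by apply: contrapT => /eqP hz; apply: (nz z).
have hz0 : h_graph Gam s (anchor z) != 0.
  by apply: contraNN hz => /eqP h0; rewrite /hrho h0 mul0r.
have rz0 : 0 < rho (anchor z).
  by rewrite lt0r rho_ge0 andbT; apply: contraNN hz => /eqP h0; rewrite /hrho h0 mulr0.
have [cx dx vx] : [/\ {for translate t (anchor z), continuous rho},
      forall i j, euclid_dist (row i (translate t (anchor z)))
        (row j (translate t (anchor z))) <> s &
      (forall i, euclid_dist 0 (row i (translate t (anchor z))) <= s * m.+1%:R) ->
      (0 < P [set w | npoints (Phi w) (balls (translate t (anchor z)) s) = 0%E])%E].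
  by apply: contrapT => nx; apply: zN; exact: goodN.
exists (translate t (anchor z)); split => //.
- by rewrite h_graph_translate; exact: h_graph_neq0.
- by rewrite rho_translate.
apply: vx => i.
rewrite (le_trans (euclid_dist_triangle (translate t (row ord0 (anchor z))) _ _))//.
rewrite row_translate euclid_dist_translate row_anchor0 -natr1 mulrDr mulr1 addrC.
rewrite lerD//.
  have := h_graph_diam ord0 i Gam_connected hz0 (ltW s_gt0).
  by rewrite row_anchor0.
rewrite (le_trans (euclid_dist_le_sup (e := s / d%:R) _ (ltW sd0)))//.
  move=> j; by rewrite !mxE !add0r normrN; exact: Ct.
by rewrite mulrC divfK// pnatr_eq0 -lt0n.
Qed.

(** By local finiteness the event that closed balls are void is the increasing
    union of the events for slightly larger balls. *)
Lemma void_enlarge (x : 'M[R]_(m.+1, d)) :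
  (0 < P [set w | npoints (Phi w) (balls x s) = 0%E])%E ->
  exists2 e : R, 0 < e &
    (0 < P [set w | npoints (Phi w) (balls x (s + e)) = 0%E])%E.
Proof.
move=> v0; apply: contrapT => /forall2NP nv.
have mv r : measurable [set w | npoints (Phi w) (balls x r) = 0%E].
  by apply: measurable_void_event; exact: measurable_balls.
have Un : P.-negligible (\bigcup_n
    [set w | npoints (Phi w) (balls x (s + n.+1%:R^-1)) = 0%E]).
  apply: negligible_bigcup => n; apply/negligibleP => //.
  have [/negP|/negP] := nv n.+1%:R^-1; first by rewrite invr_gt0 ltr0n.
  by rewrite -leNgt measure_le0 => /eqP.
have vU : [set w | npoints (Phi w) (balls x s) = 0%E] `<=` \bigcup_n
    [set w | npoints (Phi w) (balls x (s + n.+1%:R^-1)) = 0%E].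
  move=> w /= w0; have [e e0 xe] := balls_enlarge (Phi w) x s.
  have [n _ /(_ n (leqnn _)) ne] := near_infty_natSinv_lt (PosNum e0).
  exists n => //=; apply/npoints_eq0P => y phiy yb.
  move: w0 => /npoints_eq0P/(_ y phiy); apply; apply: xe; split => //.
  by apply: balls_le yb; rewrite lerD2l ltW.
by move: v0; rewrite (measure_negligible (mv s) (negligibleS vU Un)) ltxx.
Qed.

(** All requirements on a generic tuple are open, so that they hold in a
    neighbourhood of cubes around its points. *)
Lemma exists_good_cubes : exists x (e u : R),
  [/\ 0 < e, 0 < u & (0 < P [set w | npoints (Phi w) (balls x u) = 0%E])%E] /\
  [/\ (forall i j y, cubes x e i y -> cubes x e j y -> i = j),
    (forall i, cubes x e i `<=` balls x u) &
    (forall x', tuple_in (cubes x e) x' -> [/\ h_graph Gam s x' = 1, 0 < rho x' &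
      balls x' s `<=` balls x u])].
Proof.
have [x [hx rx cx dx vx]] := exists_generic_tuple.
have [a a0 va] := void_enlarge vx.
have xI : injective (fun i => row i x) by apply: (@h_graph_inj _ _ _ Gam s); rewrite hx oner_eq0.
have [eta eta0 xeta] : exists2 eta : R, 0 < eta & forall x' : 'M[R]_(m.+1, d),
    (forall i j, `|x' i j - x i j| < eta) -> 0 < rho x'.
  have : nbhs x [set x' | 0 < rho x'] by exact: (cvgr_gt _ cx _ rx).
  move=> /nbhs_ballP[eta /= eta0 xeta].
  exists eta => // x' xx'; apply: xeta; split => // i j.
  by rewrite /ball/= distrC; exact: xx'.
have d1 : 0 < d%:R :> R by rewrite ltr0n.
(* Moving the points by at most e in each coordinate changes distances by at most
   2 * d * e, which must neither reach the gap between a distance and s nor merge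
   two points. *)
have [e [e0 [e_eta ea] eD eI]] : exists e : R, [/\ 0 < e, e < eta /\ e < a / d%:R,
    forall i j, e < `|euclid_dist (row i x) (row j x) - s| / (2 * d%:R) &
    forall i j, i <> j -> e < euclid_dist (row i x) (row j x) / (2 * d%:R)].
  have : \forall e \near (0 : R)^'+, [/\ 0 < e, e < eta /\ e < a / d%:R,
    forall i j, e < `|euclid_dist (row i x) (row j x) - s| / (2 * d%:R) &
    forall i j, i <> j -> e < euclid_dist (row i x) (row j x) / (2 * d%:R)].
    near=> e; split.
    - by near: e; exact: nbhs_right_gt.
    - split; near: e; first exact: nbhs_right_lt.
      by apply: nbhs_right_lt; rewrite divr_gt0.
    - move=> i j; move: i j; near: e; apply: filter_forall => i; apply: filter_forall => j.
      apply: nbhs_right_lt; rewrite divr_gt0 ?mulr_gt0// normr_gt0 subr_eq0.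
      exact/eqP.
    - near: e; apply: filter_forall => i; apply: filter_forall => j.
      have [->|ij] := eqVneq i j; first by near=> e.
      have : \forall e \near (0 : R)^'+, e < euclid_dist (row i x) (row j x) / (2 * d%:R).
        apply: nbhs_right_lt; rewrite divr_gt0 ?mulr_gt0// ltNge.
        by apply/negP => /euclid_dist_eq0/xI/eqP; rewrite (negbTE ij).
      by apply: filterS => e.
  by move=> /filter_ex.
exists x, e, (s + a); split; first by split => //; rewrite addr_gt0.
have cubes_dist i y : cubes x e i y -> euclid_dist (row i x) y <= d%:R * e.
  move=> xy; apply: euclid_dist_le_sup; last exact: ltW.
  by move=> j; rewrite mxE distrC; exact: xy.
split=> [i j y xiy xjy|i y xiy|x' xx'].
- apply: contrapT => ij; have := eI _ _ ij.
  rewrite ltr_pdivlMr ?mulr_gt0// ltNge => /negP; apply.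
  rewrite (le_trans (euclid_dist_triangle y _ _))//.
  have := cubes_dist _ _ xiy; have := cubes_dist _ _ xjy.
  rewrite (euclid_distC _ y); lra.
- exists i; rewrite (le_trans (cubes_dist _ _ xiy))//.
  move: ea; rewrite ltr_pdivlMr// mulrC => ea'.
  by rewrite (le_trans (ltW ea'))// lerDr ltW.
have xx'd i : euclid_dist (row i x) (row i x') <= d%:R * e by exact: cubes_dist (xx' i).
have dd i j : `|euclid_dist (row i x') (row j x') - euclid_dist (row i x) (row j x)|
    <= 2 * (d%:R * e).
  have := euclid_dist_triangle (row i x') (row i x) (row j x).
  have := euclid_dist_triangle (row j x') (row i x') (row j x).
  have := euclid_dist_triangle (row i x) (row i x') (row j x').
  have := euclid_dist_triangle (row j x) (row i x) (row j x').
  have := xx'd i; have := xx'd j.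
  rewrite (euclid_distC (row i x') (row i x)) (euclid_distC (row j x') (row j x)).
  by rewrite ler_norml => ? ? ? ? ? ?; apply/andP; split; lra.
split.
- rewrite -hx; apply: h_graph_ext => i j.
    split=> [xij|/xI ->//]; apply: contrapT => nxij.
    have ij : i <> j by move=> ij; apply: nxij; rewrite ij.
    have := eI _ _ ij; have := dd i j; rewrite xij euclid_distxx sub0r normrN.
    rewrite ger0_norm ?euclid_dist_ge0// ltr_pdivlMr ?mulr_gt0//; lra.
  move=> ij; have := eD i j; rewrite ltr_pdivlMr ?mulr_gt0//.
  have := dd i j; rewrite ler_norml => /andP[dd1 dd2] sd.
  have [xs|xs] := leP (euclid_dist (row i x) (row j x)) s.
    by rewrite ler0_norm ?subr_le0// in sd; split=> // _; lra.
  rewrite gtr0_norm ?subr_gt0// in sd; split=> // x's; exfalso.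
  by move: x's; apply/negP; rewrite -ltNge; lra.
- apply: xeta => i j; rewrite (le_lt_trans _ e_eta)//.
  by have := xx' i j; rewrite mxE.
- move=> y yb; apply: (balls_le _ (balls_near _ yb)); last first.
    by move=> i; rewrite euclid_distC; exact: xx'd.
  by rewrite lerD2l; move: ea; rewrite ltr_pdivlMr// mulrC => /ltW.
Unshelve. all: by end_near. Qed.

(** Otherwise almost surely no tuple of the process has its points in the cubes,
    and the joint intensity would vanish almost everywhere on their product. *)
Lemma hits_cubes_gt0 x e : 0 < e ->
  (forall x', tuple_in (cubes x e) x' -> 0 < rho x') ->
  (0 < P (hits Phi (cubes x e)))%E.
Proof.
move=> e0 rx; have mh : measurable (hits Phi (cubes x e)).
  by apply: measurable_hits => i; exact: measurable_cubes.
have mt : measurable (tuple_in (cubes x e)).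
  by apply: measurable_tuple_in => i; exact: measurable_cubes.
rewrite lt0e measure_ge0 andbT; apply/eqP => h0.
have [_ _ _ /(_ _ mt)] := rhoP.
have -> : alpha P Phi (tuple_in (cubes x e)) = 0%E.
  rewrite -(integral0 P setT); apply: ge0_ae_eq_lower_integral => //.
  exists (hits Phi (cubes x e)); split => // w /= nw i ni; apply: nw.
  rewrite (_ : _ `&` _ = set0) ?measure0//.
  apply/seteqP; split=> y //= -[[yPhi _] yV].
  by move: ni => /npoints_eq0P /(_ _ (yPhi i)); apply; exact: yV.
move=> /esym I0; have [||N [mN N0 rN]] := ge0_integral0_ae mt _ _ I0.
- by apply: measurable_funTS; exact/measurable_EFinP.
- by move=> x'; rewrite lee_fin.
have := lebesgue_cubes_gt0 x e0; apply/negP; rewrite -leNgt.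
rewrite -[leRHS]N0; apply: measureS => // x' xx'; apply: rN => /= /(_ xx') [rx'].
by have := rx _ xx'; rewrite rx' ltxx.
Qed.

Let hvoid x : R := h_graph Gam s x * rho x * fine (void_prob palm setT s x).
Let void01 x := fine_void_prob01 palm s x (@measurableT _ 'rV[R]_d).
Let hvoid_ge0 x : 0 <= hvoid x.
Proof. by have /andP[v0 _] := void01 x; rewrite !mulr_ge0// h_graph_ge0. Qed.

(** In uncrowded subsets Q of the cubes the event that all of them are hit, that
    the process avoids the rest U \ Q of the surroundings, and that no set is
    hit twice has positive probability: negative association bounds the probability
    of the first two requirements from below by a product that exceeds, by the
    choice of Q, the probability of violating the third. On this event there is a tuple in the
    cubes with no further point in its balls, so that the Campbell formula has a
    positive value. *)
Lemma isolated_integral_gt0 : (0 < \int[lebesgue_mx m.+1 d]_x (hvoid x)%:E)%E.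
Proof.
have [x [e [u [[e0 u0 vu] [cI cu good]]]]] := exists_good_cubes.
pose V := cubes x e.
have mV i : measurable (V i) by exact: measurable_cubes.
have bV i : bounded_mx (V i) by exact: bounded_cubes.
have hV : (0 < P (hits Phi V))%E.
  by apply: hits_cubes_gt0 => // x' /good[].
pose U := balls x u; pose voidU := [set w | npoints (Phi w) U = 0%E].
have mU : measurable U by exact: measurable_balls.
have mvoid B : measurable B -> measurable [set w | npoints (Phi w) B = 0%E].
  exact: measurable_void_event.
pose p := fine (P voidU).
have pE : P voidU = p%:E by rewrite fineK// fin_num_measure//; exact: mvoid.
have p0 : 0 < p by rewrite -lte_fin -pE.
have [Q [mQ QV uncrowded]] := exists_uncrowded rho'P mV bV cI p0 hV.
have bQ i : bounded_mx (Q i) by have [M VM] := bV i; exists M => y /QV/VM.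
pose C := U `\` \bigcup_(i in [set: 'I_m.+1]) Q i.
have mC : measurable C.
  by apply: measurableD => //; apply: fin_bigcup_measurable.
have bC : bounded_mx C.
  by have [M UM] := bounded_balls x u; exists M => y [/UM].
have QC : (\bigcup_i Q i) `&` C = set0.
  by apply/seteqP; split=> y //= -[yQ [_ /(_ yQ)]].
set voidC := [set w | npoints (Phi w) C = 0%E].
have mvC : measurable voidC by exact: mvoid.
have mH : measurable (hits Phi Q) by exact: measurable_hits.
have mcr : measurable (crowded Phi Q) by exact: measurable_crowded.
pose S := (hits Phi Q `&` voidC) `\` crowded Phi Q.
have mS : measurable S by apply: measurableD => //; exact: measurableI.
have S0 : (0 < P S)%E.
  rewrite ltNge; apply/negP => S0.
  have : (P (hits Phi Q) * p%:E <= P (hits Phi Q `&` crowded Phi Q))%E.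
    apply: (@le_trans _ _ (P (hits Phi Q) * P voidC)%E).
      apply: lee_wpmul2l => //; rewrite -pE; apply: measureS => //.
        exact: mvoid.
      by move=> w /npoints_eq0P wU; apply/npoints_eq0P => y /wU yU [].
    apply: le_trans (hits_void_ge NA (fun i => conj (mQ i) (bQ i)) mC bC QC) _.
    apply: (@le_trans _ _ (P (S `|` (hits Phi Q `&` crowded Phi Q)))).
      apply: measureS.
      - exact: measurableI.
      - by apply: measurableU => //; exact: measurableI.
      move=> w wH; have [wc|nwc] := pselect (crowded Phi Q w).
        by right; split => //; case: wH.
      by left.
    apply: le_trans (measureU2 _ _ _) _ => //; first exact: measurableI.
    by rewrite -[leRHS]add0e; apply: leeD.
  by rewrite leNgt uncrowded.
pose g : 'M[R]_(m.+1, d) -> R := \1_(tuple_in V).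
have mtV : measurable (tuple_in V) by exact: measurable_tuple_in.
have mg : measurable_fun setT g by exact: measurable_indic.
have g01 y : 0 <= g y <= 1 by rewrite /g indicE; case: (_ \in _); rewrite ?lexx ler01.
have gV y : g y != 0 -> tuple_in V y.
  by rewrite /g indicE; case: (boolP (y \in _)) => [/set_mem//|_]; rewrite eqxx.
have inj_V y : tuple_in V y -> injective (fun i => row i y).
  by move=> yV i j ij; apply: (cI i j (row i y)); [exact: yV|rewrite ij; exact: yV].
have /choice[M VM] i : exists M, forall y, V i y -> forall j, `|y 0 j| <= M.
  by have [M VM] := bV i; exists M => y /VM yM j; exact: yM.
have g_cube y : g y != 0 -> mx_cube (\sum_i `|M i|) y.
  move=> /gV yV i j; have := VM _ _ (yV i) j; rewrite mxE => /le_trans; apply.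
  by rewrite (le_trans (ler_norm _))// (bigD1 i)//= lerDl sumr_ge0.
have [palmC palm_red _] := palmE.
have := campbell_isolated mrho rho_ge0 palmC palm_red (@measurableT _ 'rV[R]_d)
  (ltW s_gt0) mg g01 g_cube (fun y gy => conj (inj_V y (gV y gy)) (fun=> I)).
set I := (\int[P]_w _)%E => Ieq.
have I0 : (0 < I)%E.
  apply: (lt_le_trans S0).
  have -> : P S = (\int[P]_w (\1_S w : R)%:E)%E by rewrite integral_indic// setIT.
  apply: ge0_le_lower_integral => w; first by rewrite lee_fin indicE.
  have esum0 y : (0 <= (g y * (npoints (Phi w) (setT `&` balls y s) ==
      m.+1%:R%:E)%:R)%:E)%E.
    by rewrite lee_fin mulr_ge0//; have /andP[] := g01 y.
  rewrite indicE; case: (boolP (w \in S)) => [/set_mem[[wQ wC] wcr]|_]; last first.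
    exact: esum_ge0.
  have [y [yQ yPhi]] := hits_tuple wQ.
  have yV : tuple_in V y by move=> i; exact: QV (yQ i).
  have [_ _ yU] := good _ yV.
  apply: esum_ge; exists [set y].
    by split; [exact: finite_set1|move=> _ ->; split => //; exact: inj_V].
  rewrite fsbig_set1 /g indicE mem_set// mul1r setTI.
  rewrite (_ : npoints _ _ = m.+1%:R%:E) ?eqxx//.
  rewrite -(counting_rows (inj_V _ yV)); congr counting.
  apply/seteqP; split=> [z [zPhi zy]|_ [i _ <-]]; last first.
    by split; [exact: yPhi|exists i; rewrite euclid_distxx ltW].
  have [[i _ Qz]|nQz] := pselect ((\bigcup_(i in [set: 'I_m.+1]) Q i) z).
    exists i => //; apply: contrapT => yz; apply: wcr; exists i, (row i y), z.
    by split.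
  by move: wC => /npoints_eq0P/(_ _ zPhi) []; split => //; exact: yU.
rewrite {}Ieq in I0; apply: lt_le_trans I0 _.
apply: ge0_le_lower_integral => y.
  by rewrite mule_ge0 ?void_prob_ge0// lee_fin mulr_ge0//; have /andP[] := g01 y.
rewrite -[void_prob _ _ _ _]fineK ?void_prob_fin// -EFinM lee_fin /hvoid.
have /andP[v0 _] := void01 y; rewrite ler_wpM2r// ler_wpM2r//.
rewrite /g indicE; case: (boolP (y \in _)) => [/set_mem/good[-> _ _]//|_].
exact: h_graph_ge0.
Qed.

(** The integrand depends on the shape of the tuple alone, so that the integral
    over tuples vanishes along with the integral over shapes. *)
Lemma isolated_anchor_integral_gt0 :
  (0 < \int[lebesgue_mx m d]_z (hvoid (anchor z))%:E)%E.
Proof.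
have [_ _ palm_tr] := palmE.
have mhvoid : measurable_fun setT hvoid.
  apply: measurable_funM; last exact: measurable_fine_void_prob.
  by apply: measurable_funM => //; exact: measurable_h_graph.
have hvoid_translate t x : hvoid (translate t x) = hvoid x.
  by rewrite /hvoid h_graph_translate rho_translate (void_prob_translate palm_tr).
rewrite lt0e integral_ge0 ?andbT; last by move=> z _; rewrite lee_fin.
apply/eqP => I0; have := isolated_integral_gt0; apply/negP; rewrite -leNgt.
rewrite ge0_integral_anchor; first last.
- by move=> x; rewrite lee_fin.
- exact/measurable_EFinP.
rewrite (_ : (\int[_]_z _)%E = 0%E)// -(integral0 (lebesgue_mx m d) setT).
apply: ge0_ae_eq_lower_integral => //.
  by move=> z; apply: integral_ge0 => t _; rewrite lee_fin.
have [||N [mN N0 zN]] := ge0_integral0_ae measurableT _ _ I0.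
- by apply/measurable_EFinP; exact: measurable_comp_anchor.
- by move=> z; rewrite lee_fin.
exists N; split => // z /= nz; apply: zN => /= /(_ Logic.I) hz; apply: nz.
by apply: integral0_eq => t _; rewrite hvoid_translate.
Qed.

End positivity.

Unset Implicit Arguments.

Theorem theorem3p4 (R : realType) (dT : measure_display)
    (T : measurableType dT) (P : probability T R) (d m : nat)
    (Phi : {mfun T >-> config R d})
    (rho : forall j : nat, 'M[R]_(j, d) -> R)
    (palm : R.-pker 'M[R]_(m.+1, d) ~> config R d)
    (Gam : rel 'I_m.+1) (r : nat -> R) (beta : R)
    (d_gt0 : (0 < d)%N)
    (Phi_stationary : stationary P Phi)
    (Phi_unit : unit_intensity P Phi)
    (rhoE : forall j : nat, joint_intensity P Phi (rho j))
    (rho_translate : forall (t : 'rV[R]_d) (x : 'M[R]_(m.+1, d)),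
      rho m.+1 (translate t x) = rho m.+1 x)
    (palmE : reduced_palm P Phi (rho m.+1) palm)
    (Gam_connected : connected_graph Gam)
    (Gam_feasible : feasible (rho m.+1) Gam)
    (rho_continuous : {ae lebesgue_mx m.+1 d, forall x,
      {for x, continuous (rho m.+1)}})
    (r_gt0 : forall n : nat, 0 < r n)
    (beta_gt0 : 0 < beta)
    (r_cvg : (fun n : nat => r n ^+ d) @ \oo --> beta) :
  [/\ (fun n : nat => ((\int[P]_w G_count Gam (r n) n (Phi w)) *
         (n%:R^-1)%:E)%E) @ \oo --> mu_lim beta (rho m.+1) Gam,
      (fun n : nat => ((\int[P]_w J_count Gam (r n) n (Phi w)) *
         (n%:R^-1)%:E)%E) @ \oo --> gamma_lim beta (rho m.+1) palm Gam &
      negatively_associated P Phi ->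
      {ae lebesgue_mx m.+1 d, forall x,
        (forall i, euclid_dist 0 (row i x) <=
           beta `^ (d%:R^-1) * m.+1%:R) ->
        (0 < P [set w | npoints (Phi w) (balls x (beta `^ (d%:R^-1))) = 0%E])%E} ->
      feasible_at (beta `^ (d%:R^-1)) (rho m.+1) Gam ->
      (0 < gamma_lim beta (rho m.+1) palm Gam)%E].
Proof.
split.
- exact: (G_count_cvg (palm := palm)).
- exact: (J_count_cvg d_gt0 Phi_unit (rhoE m.+1) rho_translate palmE
    Gam_connected r_gt0 beta_gt0 r_cvg (rhoE m.+2)).
move=> NA void_pos feas; have s_gt0 : 0 < beta `^ (d%:R^-1) by exact: powR_gt0.
rewrite (gamma_limE palm d_gt0 Phi_unit (rhoE m.+1))//; apply: mule_gt0.
  by rewrite lte_fin invr_gt0 ltr0n fact_gt0.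
exact: (isolated_anchor_integral_gt0 d_gt0 (rhoE m.+1) (rhoE m.+2)).
Qed.
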